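(* Fix $p\in(0,1)$ with $p\ne\frac12$. Let $m=m(n)\ge n$, $d=d(n)$ be positive integers and $q=q(n)\in(0,1]$. (1) If $\log(n)^3\ll d\ll m\sqrt n\,q^2$, then counting signed wedges distinguishes $\mathbb W(n,m,q,p,d)$ from $\mathbb M(n,m,p)$: there are thresholds $t_n\in\mathbb R$ such that $$\mathbb P_{M\sim\mathbb M(n,m,p)}\big(P_2(M)\ge t_n\big)+\mathbb P_{M\sim\mathbb W(n,m,q,p,d)}\big(P_2(M)<t_n\big)\to0\quad\text{as }n\to\infty.$$ (2) If $\log(n)^3\ll d\ll m\sqrt n\,q$, then counting signed wedges within the mask distinguishes $\mathbb W_{\mathbf M}(n,m,p,d)$ from $\mathbb M(n,m,p)$ when the mask $\mathbf M\sim\mathbb M(n,m,q)$ is known: there are thresholds $t_n\in\mathbb R$ such that $$\mathbb P\big(P_2^{\mathbf M}(M_0)\ge t_n\big)+\mathbb P\big(P_2^{\mathbf M}(M_1)<t_n\big)\to0\quad\text{as }n\to\infty,$$ where $\mathbf M\sim\mathbb M(n,m,q)$, $M_0\sim\mathbb M(n,m,p)$ is independent of $\mathbf M$, and, conditionally on $\mathbf M$, $M_1\sim\mathbb W_{\mathbf M}(n,m,p,d)$.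
   Context: For functions of $n$, $f\gg g$ (equivalently $g\ll f$) means $f(n)/g(n)\to\infty$ as $n\to\infty$. $\mathbb M(n,m,p)$: the law of a random $n\times m$ $\{0,1\}$-matrix with i.i.d. $\mathrm{Bern}(p)$ entries. $\mathbb W(n,m,p,d)$: let $R$ be the set of $n$ rows and $L$ the set of $m$ columns. Draw independent vectors $(\mathbf x_u)_{u\in R}$, $(\mathbf x_u)_{u\in L}$ from $\mathcal N(0,\mathbf I_d)$. Let $\tau=\tau(d,p)$ be such that $\mathbb P(d^{-1/2}\langle \mathbf x,\mathbf y\rangle\le\tau)=p$ for independent $\mathbf x,\mathbf y\sim\mathcal N(0,\mathbf I_d)$. The entry in row $u$ and column $v$ is $\mathbf 1(d^{-1/2}\langle\mathbf x_u,\mathbf x_v\rangle\le\tau)$. For $\mathbf M\in\{0,1\}^{n\times m}$, $\mathbb W_{\mathbf M}(n,m,p,d)$ is the law of $W\odot\mathbf M+B\odot(1-\mathbf M)$ with independent $W\sim\mathbb W(n,m,p,d)$, $B\sim\mathbb M(n,m,p)$ and $\odot$ the entrywise product. $\mathbb W(n,m,q,p,d)$ is the mixture of $\mathbb W_{\mathbf M}(n,m,p,d)$ over $\mathbf M\sim\mathbb M(n,m,q)$. Signed wedge count: $P_2(M):=\sum_{i=1}^n\sum_{1\le k<l\le m}(M_{i,k}-p)(M_{i,l}-p)$. Its restriction $P_2^{\mathbf M}(M)$ to the mask is the same sum restricted to those $(i,k,l)$ for which $\mathbf M_{i,k}=\mathbf M_{i,l}=1$. *)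

(* Defs.v *)
From HB Require Import structures.
From mathcomp Require Import all_boot all_order all_algebra.
From mathcomp Require Import all_classical all_reals all_analysis.
Set Implicit Arguments.
Unset Strict Implicit.
Unset Printing Implicit Defensive.
Import Order.TTheory GRing.Theory Num.Theory.
Import numFieldNormedType.Exports.
Local Open Scope classical_set_scope.
Local Open Scope ring_scope.

(* f >> g, i.e. f(n) / g(n) -> +oo. Finitely many zeros of g are harmless. *)
Definition gg (R : realType) (f g : nat -> R) : Prop :=
  (fun n => f n / g n) @ \oo --> +oo.

(** * Finite powers of a probability measure *)

Section iid.
Context (disp : measure_display) (T : measurableType disp) (R : realType).

Definition tcons k (x : T * k.-tuple T) : k.+1.-tuple T :=
  [the k.+1.-tuple T of x.1 :: x.2].

Lemma measurable_tcons k : measurable_fun [set: T * k.-tuple T] (@tcons k).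
Proof.
exact: (measurable_cons (f := fst) (g := snd) measurable_fst measurable_snd).
Qed.

HB.instance Definition _ k := isMeasurableFun.Build _ _ _ _ (@tcons k)
  (@measurable_tcons k).

(* The law of k independent samples from P. *)
Fixpoint iid (P : probability T R) k : probability (k.-tuple T) R :=
  match k with
  | 0 => [the probability _ R of dirac ([tuple] : 0.-tuple T)]
  | k'.+1 => [the probability _ R of
      distribution [the probability _ R of (P \x iid P k')%E]
        [the {mfun _ >-> _} of @tcons k']]
  end.

End iid.

(** * Laws on finite types, given by their probability mass functions *)

Section finite_laws.
Context (R : realType).

Definition prob (T : finType) (mu : T -> R) (E : pred T) : R :=
  \sum_(x | E x) mu x.

Definition indep_law (S T : finType) (mu : S -> R) (nu : T -> R) : S * T -> R :=
  fun x => mu x.1 * nu x.2.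

(* The law of f(X) for X distributed as mu. *)
Definition image_law (S T : finType) (f : S -> T) (mu : S -> R) : T -> R :=
  fun y => prob mu (fun x => f x == y).

(* The law of Y, for X distributed as mu and Y as K X conditionally on X. *)
Definition mixture (S T : finType) (mu : S -> R) (K : S -> T -> R) : T -> R :=
  fun y => \sum_x mu x * K x y.

(* The joint law of such a pair (X, Y). *)
Definition joint_law (S T : finType) (mu : S -> R) (K : S -> T -> R) :
  S * T -> R := fun x => mu x.1 * K x.1 x.2.

End finite_laws.

(** * Random matrices; the entries 0 and 1 are encoded as booleans *)

Section models.
Context (R : realType).

Definition bern_law n m (p : R) : 'M[bool]_(n, m) -> R :=
  fun A => \prod_(i < n) \prod_(k < m) (if A i k then p else 1 - p).

Definition gauss d : probability (d.-tuple (measurableTypeR R)) R :=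
  iid [the probability (measurableTypeR R) R of normal_prob (0 : R) 1] d.

Definition dotp d (x y : d.-tuple R) : R := \sum_(k < d) tnth x k * tnth y k.

Definition below d (t : R) (x y : d.-tuple R) : bool :=
  (Num.sqrt d%:R)^-1 * dotp x y <= t.

(* For 0 < d and 0 < p < 1 there is exactly one such real number, since the
   distribution function is continuous and strictly increasing; the default
   value of xget is then irrelevant. *)
Definition tau d (p : R) : R :=
  xget 0 [set t | (gauss d \x gauss d)%E [set xy | below t xy.1 xy.2] = p%:E].

Definition geom_mx n m d (p : R)
    (x : n.-tuple (d.-tuple R) * m.-tuple (d.-tuple R)) : 'M[bool]_(n, m) :=
  \matrix_(i < n, k < m) below (tau d p) (tnth x.1 i) (tnth x.2 k).

Definition geom_law n m (p : R) d : 'M[bool]_(n, m) -> R := fun A =>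
  fine ((iid (gauss d) n \x iid (gauss d) m)%E [set x | geom_mx p x = A]).

(* W (.) Mk + B (.) (1 - Mk) *)
Definition mask_mx n m (Mk W B : 'M[bool]_(n, m)) : 'M[bool]_(n, m) :=
  \matrix_(i, k) if Mk i k then W i k else B i k.

Definition masked_law n m (p : R) d (Mk : 'M[bool]_(n, m)) :
    'M[bool]_(n, m) -> R :=
  image_law (fun WB => mask_mx Mk WB.1 WB.2)
    (indep_law (geom_law p d) (bern_law p)).

Definition mixed_law n m (q p : R) d : 'M[bool]_(n, m) -> R :=
  mixture (bern_law q) (masked_law p d).

Definition wedges n m (p : R) (A : 'M[bool]_(n, m)) : R :=
  \sum_(i < n) \sum_(k < m) \sum_(l < m | (k < l)%N)
    ((A i k)%:R - p) * ((A i l)%:R - p).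

Definition mask_wedges n m (p : R) (Mk A : 'M[bool]_(n, m)) : R :=
  \sum_(i < n) \sum_(k < m) \sum_(l < m | [&& (k < l)%N, Mk i k & Mk i l])
    ((A i k)%:R - p) * ((A i l)%:R - p).

End models.

(* Main.v *)
Require Import Defs.
From HB Require Import structures.
From mathcomp Require Import all_boot all_order all_algebra.
From mathcomp Require Import all_classical all_reals all_analysis.
From mathcomp Require Import measurable_realfun ring lra.
Set Implicit Arguments.
Unset Strict Implicit.
Unset Printing Implicit Defensive.
Import Order.TTheory GRing.Theory Num.Theory.
Import numFieldNormedType.Exports.
Local Open Scope classical_set_scope.
Local Open Scope ring_scope.

(** The count of signed wedges is a second order statistic of the columns, and
    both claims are instances of the second moment method for it.

    Give each entry a weight s_ik: the centred entry for the count on the whole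
    matrix, and its product with the mask bit for the count within the mask. Given
    the matrix W before masking, s_ik has mean q (W_ik - p) and mean square at most
    Q, with Q = 1 in the first case and Q = q in the second. The count is the sum
    over pairs of columns k < l of the kernel sum_i s_ik s_il. In both models the
    columns are independent once the vectors of the rows are given, so the first
    two moments of the count are explicit (column_second_moment, avg_wedge_stat,
    geom_law_disintegration). They involve

    - g(x), the conditional mean of W_ik - p given the vector x of row i (gdev);
    - h(x, x'), the conditional mean of (W_ik - p) (W_jk - p) given the vectors of
      two rows (hcov).

    Under the null law both vanish, the count has mean 0 and its second moment is at
    most m^2 n Q^2. Under the alternative the mean is s = (m (m - 1) / 2) q^2 n v,
    where v is the mean of g^2.

    The geometric part shows that v is of order 1/d, and that g^4 and h^2 have means
    O(1/d^2) and O(1/d) (row_estimates). Given x, the inner product with x is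
    Gaussian of standard deviation |x|, so that W_ik = 1 has the probability
    Phi (t / u), where u = |x| / sqrt d and t is the threshold. The fluctuation of u is
    of order d^(-1/2), and Phi (t / u) is a Lipschitz function of u^2 (cp_lipschitz)
    and, if t is bounded and bounded away from 0, a bi-Lipschitz one near the typical
    value (cp_separation). Chebyshev's inequality
    bounds t, and t is bounded away from 0 because t near 0 gives p near 1/2: this is
    where p != 1/2 is used. For h, the pair of inner products with x and x' has the
    law of a triangular pair of combinations of two independent Gaussians
    (gaussian_pair, from the rotation invariance of the plane Gaussian law), whose
    coupling is of order <x, x'> / d, hence of order d^(-1/2).

    With the threshold s / 2, Chebyshev's inequality bounds both error probabilities
    by a constant times 1/n + r^2 + r + r^4, where r^2 = Q d / (m sqrt n q^2) tends to
    0 by hypothesis (error_bound, detection). *)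

(** * Expectations of real functions *)

Section expectation.
Context d (T : measurableType d) (R : realType) (P : probability T R).
Implicit Types (f g : T -> R) (c : R).

Definition Ex f : R := \int[P]_x f x.
Definition L1 f : Prop := P.-integrable [set: T] (EFin \o f).

Lemma L1_meas f : L1 f -> measurable_fun [set: T] f.
Proof. by move=> /measurable_int /measurable_EFinP. Qed.

Lemma eq_Ex f g : f =1 g -> Ex f = Ex g.
Proof. by move=> /funext ->. Qed.

Lemma L1_ext f g : f =1 g -> L1 f -> L1 g.
Proof. by move=> /funext ->. Qed.

Lemma L1_cst c : L1 (fun=> c).
Proof. exact: finite_measure_integrable_cst. Qed.

Lemma L1D f g : L1 f -> L1 g -> L1 (fun x => f x + g x).
Proof. by move=> If Ig; exact: (integrableD measurableT If Ig). Qed.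

Lemma L1B f g : L1 f -> L1 g -> L1 (fun x => f x - g x).
Proof. by move=> If Ig; exact: (integrableB measurableT If Ig). Qed.

Lemma L1Z c f : L1 f -> L1 (fun x => c * f x).
Proof. by move=> If; exact: (integrableZl measurableT c If). Qed.

Lemma L1_sum (I : Type) (s : seq I) (Q : pred I) (F : I -> T -> R) :
  (forall i, Q i -> L1 (F i)) -> L1 (fun x => \sum_(i <- s | Q i) F i x).
Proof.
move=> H; elim: s => [|i s IH].
  by apply: (L1_ext (f := fun=> 0)); [move=> x /=; rewrite big_nil|exact: L1_cst].
apply: (L1_ext (f := fun x => (if Q i then F i x else 0) +
    \sum_(j <- s | Q j) F j x)).
  by move=> x; rewrite big_cons; case: (Q i); rewrite ?add0r.
by apply: L1D => //; case: (boolP (Q i)) => Qi; [exact: H|exact: L1_cst].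
Qed.

Lemma L1_le g f : measurable_fun [set: T] f -> L1 g ->
  (forall x, `|f x| <= g x) -> L1 f.
Proof.
move=> mf Ig fg; apply: (le_integrable measurableT _ _ Ig).
  exact/measurable_EFinP.
move=> x _ /=; rewrite lee_fin (le_trans (fg x))// ler_norm//.
Qed.

Lemma L1_bounded c f : measurable_fun [set: T] f ->
  (forall x, `|f x| <= c) -> L1 f.
Proof. by move=> mf fc; apply: (L1_le mf (L1_cst c)). Qed.

Lemma Ex_cst c : Ex (fun=> c) = c.
Proof.
by rewrite /Ex Rintegral_cst// (_ : _ setT = 1%E) ?mulr1//; exact: (probability_setT P).
Qed.

Lemma ExD f g : L1 f -> L1 g -> Ex (fun x => f x + g x) = Ex f + Ex g.
Proof. by move=> If Ig; exact: RintegralD. Qed.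

Lemma ExB f g : L1 f -> L1 g -> Ex (fun x => f x - g x) = Ex f - Ex g.
Proof. by move=> If Ig; exact: RintegralB. Qed.

Lemma ExZ c f : L1 f -> Ex (fun x => c * f x) = c * Ex f.
Proof. by move=> If; exact: RintegralZl. Qed.

Lemma Ex_sum (I : Type) (s : seq I) (Q : pred I) (F : I -> T -> R) :
  (forall i, Q i -> L1 (F i)) ->
  Ex (fun x => \sum_(i <- s | Q i) F i x) = \sum_(i <- s | Q i) Ex (F i).
Proof.
move=> H; elim: s => [|i s IH].
  by rewrite big_nil -[RHS](Ex_cst 0); apply: eq_Ex => x; rewrite big_nil.
rewrite big_cons -IH; case: ifP => Qi.
  rewrite -ExD; [|exact: H|exact: L1_sum].
  by apply: eq_Ex => x; rewrite big_cons Qi.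
by apply: eq_Ex => x; rewrite big_cons Qi.
Qed.

Lemma Ex_ge0 f : (forall x, 0 <= f x) -> 0 <= Ex f.
Proof. by move=> f0; apply: Rintegral_ge0 => x _. Qed.

Lemma Ex_le f g : L1 f -> L1 g -> (forall x, f x <= g x) -> Ex f <= Ex g.
Proof. by move=> If Ig fg; apply: le_Rintegral. Qed.

Lemma Ex_norm f : L1 f -> `|Ex f| <= Ex (fun x => `|f x|).
Proof. by move=> If; apply: le_normr_Rintegral. Qed.

Lemma L1_norm f : L1 f -> L1 (fun x => `|f x|).
Proof. by move=> If; exact: integrable_norm. Qed.

Lemma EFin_Ex f : L1 f -> (Ex f)%:E = (\int[P]_x (f x)%:E)%E.
Proof. by move=> If; rewrite /Ex /Rintegral fineK//; exact: integrable_fin_num. Qed.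

Lemma L1_ge0_ltoo f : measurable_fun [set: T] f -> (forall x, 0 <= f x) ->
  (\int[P]_x (f x)%:E < +oo)%E -> L1 f.
Proof.
move=> mf f0 foo; apply/integrableP; split; first exact/measurable_EFinP.
by under eq_integral do rewrite /= ger0_norm//.
Qed.

Definition ind (A : set T) (x : T) : R := (x \in A)%:R.

Lemma measurable_ind (A : set T) : measurable A -> measurable_fun [set: T] (ind A).
Proof.
move=> mA; rewrite (_ : ind A = \1_A); first exact: measurable_indic.
by apply/funext => x; rewrite indicE.
Qed.

Lemma L1_ind (A : set T) : measurable A -> L1 (ind A).
Proof.
move=> mA; apply: (L1_bounded (c := 1)); first exact: measurable_ind.
by move=> x; rewrite /ind normr_nat; case: (_ \in _).
Qed.

Lemma Ex_ind (A : set T) : measurable A -> Ex (ind A) = fine (P A).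
Proof.
move=> mA; rewrite /Ex /Rintegral; congr fine.
rewrite (_ : (fun x => (ind A x)%:E) = (fun x => (\1_A x)%:E)).
  by rewrite integral_indic// setIT.
by apply/funext => x; rewrite indicE.
Qed.

(** The variance, the mean of (f - Ex f)^2, is nonnegative. *)
Lemma Ex_sqr_ge f : L1 f -> L1 (fun x => f x ^+ 2) ->
  Ex f ^+ 2 <= Ex (fun x => f x ^+ 2).
Proof.
move=> If If2.
have : 0 <= Ex (fun x => (f x ^+ 2 - 2 * Ex f * f x) + Ex f ^+ 2).
  by apply: Ex_ge0 => x; have := sqr_ge0 (f x - Ex f); lra.
rewrite ExD ?ExB ?ExZ ?Ex_cst; try exact: L1_cst; try exact: L1Z => //.
- by nra.
- by [].
- by [].
- by apply: L1B => //; exact: L1Z.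
Qed.

Lemma measurable_event (b : T -> bool) :
  measurable_fun [set: T] (fun t => (b t)%:R : R) -> measurable [set t | b t].
Proof.
move=> mb; rewrite (_ : [set t | _] = setT `&` (fun t => (b t)%:R : R) @^-1` [set 1]).
  by apply: mb => //; exact: measurable_set1.
rewrite setTI; apply/seteqP; split => t /=; first by move=> ->.
by case: (b t) => // /eqP; rewrite eq_sym oner_eq0.
Qed.

Lemma Ex_event (b : T -> bool) : measurable_fun [set: T] (fun t => (b t)%:R : R) ->
  Ex (fun t => (b t)%:R) = fine (P [set t | b t]).
Proof.
move=> mb; rewrite -(Ex_ind (measurable_event mb)); apply: eq_Ex => t.
by rewrite /ind; congr ((nat_of_bool _)%:R); apply/idP/idP; rewrite inE.
Qed.

Lemma L1_event (b : T -> bool) : measurable_fun [set: T] (fun t => (b t)%:R : R) ->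
  L1 (fun t => (b t)%:R).
Proof.
by move=> mb; apply: (L1_bounded (c := 1)) => // t; rewrite normr_nat; case: (b t).
Qed.

End expectation.

Section change_of_variables.
Context d d' (T : measurableType d) (T' : measurableType d') (R : realType).
Context (P : probability T R) (X : {mfun T >-> T'}).

Lemma L1_distribution (f : T' -> R) : measurable_fun [set: T'] f ->
  L1 P (f \o X) -> L1 (distribution P X) f.
Proof.
move=> mf If; apply: integrable_pushforward => //; first exact/measurable_EFinP.
Qed.

Lemma Ex_distribution (f : T' -> R) : measurable_fun [set: T'] f ->
  L1 P (f \o X) -> Ex (distribution P X) f = Ex P (f \o X).
Proof.
move=> mf If; rewrite /Ex /Rintegral integral_distribution//.
exact/measurable_EFinP.
Qed.

End change_of_variables.

Section fubini.
Context d1 d2 (T1 : measurableType d1) (T2 : measurableType d2) (R : realType).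
Context (P : probability T1 R) (Q : probability T2 R).
Implicit Type f : T1 * T2 -> R.

Lemma Fubini12 f : L1 (P \x Q)%E f -> (forall x, L1 Q (fun y => f (x, y))) ->
  L1 P (fun x => Ex Q (fun y => f (x, y))) /\
  Ex (P \x Q)%E f = Ex P (fun x => Ex Q (fun y => f (x, y))).
Proof.
move=> If Ix.
have E : (EFin \o (fun x => Ex Q (fun y => f (x, y)))) =
    fubini_F Q (EFin \o f).
  by apply/funext => x; rewrite /= EFin_Ex//.
split; first by rewrite /L1 E; exact: integrable_fubini_F.
rewrite /Ex /Rintegral -[LHS]/(fine _) -(integral12_prod_meas1 If); congr fine.
by apply: eq_integral => x _; rewrite -E.
Qed.

Lemma Fubini21 f : L1 (P \x Q)%E f -> (forall y, L1 P (fun x => f (x, y))) ->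
  Ex (P \x Q)%E f = Ex Q (fun y => Ex P (fun x => f (x, y))).
Proof.
move=> If Ix; rewrite /Ex /Rintegral -(integral21_prod_meas1 If); congr fine.
by apply: eq_integral => y _; rewrite EFin_Ex.
Qed.

Lemma L1_prodM (f : T1 -> R) (g : T2 -> R) : L1 P f -> L1 Q g ->
  L1 (P \x Q)%E (fun x => f x.1 * g x.2).
Proof.
move=> If Ig.
have mf := L1_meas If; have mg := L1_meas Ig.
have mfg : measurable_fun [set: T1 * T2] (fun x => f x.1 * g x.2).
  by apply: measurable_funM; apply: measurableT_comp.
apply/integrable12ltyP; first exact/measurable_EFinP.
rewrite (eq_integral (fun x => (Ex Q (fun y => `|g y|))%:E * `|f x|%:E)%E).
  have := integrable_lty measurableT (integrableZl measurableT (Ex Q (fun y => `|g y|)) (L1_norm If)).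
  by [].
move=> x _ /=; rewrite EFin_Ex; last exact: L1_norm.
rewrite muleC -integralZl//; last exact: L1_norm.
by apply: eq_integral => y _; rewrite normrM.
Qed.

Lemma Ex_prodM (f : T1 -> R) (g : T2 -> R) : L1 P f -> L1 Q g ->
  Ex (P \x Q)%E (fun x => f x.1 * g x.2) = Ex P f * Ex Q g.
Proof.
move=> If Ig; have [|_ ->] := Fubini12 (L1_prodM If Ig).
  by move=> x; exact: (L1Z (f x) Ig).
rewrite mulrC -ExZ//; apply: eq_Ex => x /=.
by rewrite ExZ// mulrC.
Qed.

End fubini.

(** * Rotations of the standard Gaussian measure *)

Section affine.
Context (R : realType).
Notation mu := (@lebesgue_measure R).
Local Notation RM := (measurableTypeR R).

Definition affine (c e : R) (x : RM) : RM := c * x + e.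

Lemma measurable_affine (c e : R) : measurable_fun [set: RM] (affine c e).
Proof. by rewrite /affine; apply: measurable_funD => //; apply: measurable_funM. Qed.

HB.instance Definition _ c e := isMeasurableFun.Build _ _ _ _ (affine c e)
  (@measurable_affine c e).

Lemma lebesgue_measure_affine (c e : R) (A : set RM) : c != 0 -> measurable A ->
  mu A = (`|c|%:E * mu (affine c e @^-1` A))%E.
Proof.
move=> c0 mA.
pose phi := affine c e.
have mphi : measurable_fun [set: RM] phi := @measurable_affine c e.
pose nu := mscale (NngNum (normr_ge0 c)) (pushforward mu phi).
have -> : (`|c|%:E * mu (phi @^-1` A))%E = nu mphi A by [].
apply: lebesgue_measure_unique => // X [[a b] _ <-] /=.
rewrite /nu /mscale /= /pushforward.
have [cp|cn|c00] := ltgtP c 0; last by rewrite c00 eqxx in c0.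
  rewrite (_ : phi @^-1` _ = [set` `[(b - e) / c, (a - e) / c[%R]).
    rewrite !lebesgue_measure_itv/= !lte_fin.
    rewrite ltr_nM2r ?invr_lt0// ltrD2r; case: ifP => ab; last by rewrite mule0.
    rewrite -!EFinB -EFinM ltr0_norm//; congr (_%:E).
    by field.
  apply/seteqP; split => x /=; rewrite !in_itv/= /phi /affine.
    by move=> /andP[h1 h2]; rewrite ler_ndivrMr// ltr_ndivlMr// mulrC; apply/andP; split; lra.
  by rewrite ler_ndivrMr// ltr_ndivlMr// mulrC => /andP[h1 h2]; apply/andP; split; lra.
rewrite (_ : phi @^-1` _ = [set` `](a - e) / c, (b - e) / c]%R]).
  rewrite !lebesgue_measure_itv/= !lte_fin.
  rewrite ltr_pM2r ?invr_gt0// ltrD2r; case: ifP => ab; last by rewrite mule0.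
  rewrite -!EFinB -EFinM gtr0_norm//; congr (_%:E).
  by field.
apply/seteqP; split => x /=; rewrite !in_itv/= /phi /affine.
  by move=> /andP[h1 h2]; rewrite ler_pdivlMr// ltr_pdivrMr// mulrC; apply/andP; split; lra.
by rewrite ler_pdivlMr// ltr_pdivrMr// mulrC => /andP[h1 h2]; apply/andP; split; lra.
Qed.

Lemma integral_affine (c e : R) (f : RM -> \bar R) : c != 0 ->
  measurable_fun [set: RM] f -> (forall x, 0 <= f x)%E ->
  (\int[mu]_x f x = `|c|%:E * \int[mu]_x f (c * x + e)%R)%E.
Proof.
move=> c0 mf f0.
pose phi := affine c e.
have mphi : measurable_fun [set: RM] phi := @measurable_affine c e.
pose nu := mscale (NngNum (normr_ge0 c)) (pushforward mu phi).
transitivity (\int[nu mphi]_x f x)%E.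
  by apply: eq_measure_integral => A mA _; exact: lebesgue_measure_affine.
rewrite /nu ge0_integral_mscale//=; congr (_ * _)%E.
by rewrite ge0_integral_pushforward.
Qed.

End affine.

Section normal_density.
Context (R : realType).
Notation mu := (@lebesgue_measure R).
Local Notation RM := (measurableTypeR R).
Definition stdn : probability RM R := [the probability RM R of normal_prob (0 : R) 1].

(** The Gaussian measure is defined by its density; the Radon-Nikodym change of
    variables extends the density formula from sets to functions. *)
Lemma integral_stdn (f : RM -> \bar R) :
  measurable_fun [set: RM] f -> (forall x, 0 <= f x)%E ->
  (\int[stdn]_x f x = \int[mu]_x (f x * (normal_pdf 0 1 x)%:E))%E.
Proof.
move=> mf f0.
have dom := @normal_prob_dominates R 0 1.
rewrite -(Radon_Nikodym_SigmaFinite.change_of_variables dom)//.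
apply: ae_eq_integral => //.
- apply: emeasurable_funM => //; apply: measurable_int.
  exact: Radon_Nikodym_SigmaFinite.f_integrable.
- apply: emeasurable_funM => //; apply/measurable_EFinP.
  exact: measurable_normal_pdf.
- apply: ae_eqe_mul2l; apply: integral_ae_eq => //=.
  + exact: Radon_Nikodym_SigmaFinite.f_integrable.
  + by apply/measurable_EFinP; exact: measurable_normal_pdf.
  + by move=> E _ mE; rewrite -Radon_Nikodym_SigmaFinite.f_integral.
Qed.

Lemma stdn_cst (c : \bar R) : (\int[stdn]_u c = c)%E.
Proof.
rewrite integral_cst// (_ : _ setT = 1%E) ?mule1//; exact: (probability_setT stdn).
Qed.

Lemma measurable_lin2 d (T : measurableType d) (a b : R) (f g : T -> RM) :
  measurable_fun [set: T] f -> measurable_fun [set: T] g ->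
  measurable_fun [set: T] (fun x => a * f x + b * g x : RM).
Proof. by move=> mf mg; apply: measurable_funD; apply: measurable_funM. Qed.

(** The rotation is the composition of an affine substitution in v with u fixed
    and of one in u with the second coordinate fixed; both are invertible as
    a is nonzero, and their scaling factors cancel. *)
Lemma lebesgue_rotation (a b : R) (f : RM * RM -> \bar R) :
  a ^+ 2 + b ^+ 2 = 1 -> a != 0 ->
  measurable_fun [set: RM * RM] f -> (forall x, 0 <= f x)%E ->
  (\int[mu]_u \int[mu]_v f (a * u + b * v, - b * u + a * v)%R =
   \int[mu]_u \int[mu]_v f (u, v))%E.
Proof.
move=> ab1 a0 mf f0.
pose g (z : RM * RM) := f (a^-1 * z.1 + b / a * z.2, z.2)%R.
have mg : measurable_fun [set: RM * RM] g.
  apply: measurableT_comp => //; apply: measurable_fun_pair => //.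
  exact: measurable_lin2.
have g0 x : (0 <= g x)%E by exact: f0.
have a10 : a^-1 != 0 by rewrite invr_eq0.
have E u : (\int[mu]_v f (a * u + b * v, - b * u + a * v)%R =
    `|a^-1|%:E * \int[mu]_v g (u, v))%E.
  rewrite (integral_affine (b * u / a) a10)//.
    congr (_ * _)%E; apply: eq_integral => w _; rewrite /g/=; congr (f (_, _)).
      transitivity (a^-1 * ((a ^+ 2 + b ^+ 2) * u) + b / a * w); last by rewrite ab1 mul1r.
      by field.
    by field.
  apply: measurableT_comp => //; apply: measurable_fun_pair.
    by apply: measurable_funD => //; exact: measurable_funM.
  by apply: measurable_funD => //; exact: measurable_funM.
under eq_integral do rewrite E.
rewrite ge0_integralZl//; last 2 first.
- exact: (measurable_fun_fubini_tonelli_F g mg g0).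
- by move=> x _; exact: integral_ge0.
rewrite (fubini_tonelli g mg)//.
rewrite (fubini_tonelli f mf)//.
rewrite -ge0_integralZl//; last 2 first.
- exact: (measurable_fun_fubini_tonelli_G g mg g0).
- by move=> x _; apply: integral_ge0 => y _; exact: f0.
apply: eq_integral => w _.
rewrite [RHS](integral_affine (b / a * w) a10)//.
by apply: measurableT_comp => //; exact: measurable_fun_pair.
Qed.

Lemma normal_pdf_rotation (a b u v : R) : a ^+ 2 + b ^+ 2 = 1 ->
  normal_pdf 0 1 (a * u + b * v) * normal_pdf 0 1 (- b * u + a * v) =
  normal_pdf 0 1 u * normal_pdf 0 1 v :> R.
Proof.
move=> ab1; rewrite !normal_pdfE ?oner_eq0// /normal_fun !subr0.
rewrite mulrACA [RHS]mulrACA -!expRD; congr (_ * expR _).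
rewrite -!mulrDl -!opprD; congr (- _ / _).
by rewrite -[RHS]mul1r -ab1; ring.
Qed.

Lemma integral_stdn2 (f : RM * RM -> \bar R) :
  measurable_fun [set: RM * RM] f -> (forall x, 0 <= f x)%E ->
  (\int[stdn]_u \int[stdn]_v f (u, v) = \int[mu]_u \int[mu]_v
    (f (u, v) * (normal_pdf 0 1 u * normal_pdf 0 1 v)%:E))%E.
Proof.
move=> mf f0.
have mp : measurable_fun [set: RM] (fun x => (normal_pdf 0 1 x : R)%:E).
  by apply/measurable_EFinP; exact: measurable_normal_pdf.
have p0 x : (0 <= (normal_pdf 0 1 x : R)%:E)%E by rewrite lee_fin normal_pdf_ge0.
rewrite integral_stdn; last 2 first.
- exact: (measurable_fun_fubini_tonelli_F f mf f0).
- by move=> x; exact: integral_ge0.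
apply: eq_integral => u _.
have mfu : measurable_fun [set: RM] (fun v => f (u, v)) by exact: measurableT_comp.
rewrite integral_stdn// -ge0_integralZr//.
- by apply: eq_integral => v _; rewrite EFinM [in RHS]muleA muleAC.
- exact: emeasurable_funM.
- by move=> v _; exact: mule_ge0.
Qed.

(** The standard Gaussian measure of the plane is invariant under rotations,
    because Lebesgue measure and the density are. *)
Lemma stdn_rotation (a b : R) (f : RM * RM -> \bar R) :
  a ^+ 2 + b ^+ 2 = 1 -> a != 0 ->
  measurable_fun [set: RM * RM] f -> (forall x, 0 <= f x)%E ->
  (\int[stdn]_u \int[stdn]_v f (a * u + b * v, - b * u + a * v)%R =
   \int[stdn]_u \int[stdn]_v f (u, v))%E.
Proof.
move=> ab1 a0 mf f0.
have mpp : measurable_fun [set: RM * RM]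
    (fun z => (normal_pdf 0 1 z.1 * normal_pdf 0 1 z.2 : R)%:E).
  apply/measurable_EFinP; apply: measurable_funM;
  by apply: measurableT_comp => //; exact: measurable_normal_pdf.
pose g (z : RM * RM) := f (a * z.1 + b * z.2, - b * z.1 + a * z.2).
have mg : measurable_fun [set: RM * RM] g.
  by apply: measurableT_comp => //; apply: measurable_fun_pair; exact: measurable_lin2.
have g0 z : (0 <= g z)%E by exact: f0.
pose F (z : RM * RM) := (f z * (normal_pdf 0 1 z.1 * normal_pdf 0 1 z.2)%:E)%E.
have mF : measurable_fun [set: RM * RM] F by exact: emeasurable_funM.
have F0 z : (0 <= F z)%E by rewrite /F mule_ge0// lee_fin mulr_ge0// normal_pdf_ge0.
apply: (etrans _ (esym (integral_stdn2 mf f0))).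
apply: (etrans _ (lebesgue_rotation ab1 a0 mF F0)).
apply: (etrans (integral_stdn2 mg g0)).
apply: eq_integral => u _; apply: eq_integral => v _.
by rewrite /F/= normal_pdf_rotation.
Qed.

(** Negation is the rotation by the half turn. *)
Lemma stdn_opp (f : RM -> \bar R) :
  measurable_fun [set: RM] f -> (forall x, 0 <= f x)%E ->
  (\int[stdn]_u f (- u)%R = \int[stdn]_u f u)%E.
Proof.
move=> mf f0.
have mf1 : measurable_fun [set: RM * RM] (fun z => f z.1) by exact: measurableT_comp.
have := stdn_rotation (a := -1) (b := 0) (f := fun z => f z.1).
rewrite sqrrN expr1n expr0n addr0 oppr_eq0 oner_eq0 => /(_ erefl isT mf1 (fun z => f0 _)) /=.
under eq_integral => u _.
  under eq_integral do rewrite mul0r addr0 mulN1r.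
  rewrite stdn_cst.
  over.
move=> ->; apply: eq_integral => u _.
by rewrite stdn_cst.
Qed.

(** Rotating by the angle of (a, b) turns a u + b v into a multiple of the first
    coordinate. *)
Lemma stdn_combine (a b : R) (f : RM -> \bar R) :
  measurable_fun [set: RM] f -> (forall x, 0 <= f x)%E ->
  (\int[stdn]_u \int[stdn]_v f (a * u + b * v)%R =
   \int[stdn]_u f (Num.sqrt (a ^+ 2 + b ^+ 2) * u)%R)%E.
Proof.
move=> mf f0.
have [->|a0] := eqVneq a 0.
  rewrite expr0n add0r sqrtr_sqr.
  under eq_integral => u _ do under eq_integral do rewrite mul0r add0r.
  rewrite stdn_cst.
  have [b0|b0] := ger0P b; first by [].
  have mfb : measurable_fun [set: RM] (fun u => f (- b * u)%R).
    by apply: measurableT_comp => //; exact: measurable_funM.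
  rewrite -(stdn_opp mfb)//.
  by apply: eq_integral => u _; rewrite mulrNN.
set c := Num.sqrt _.
have c2 : c ^+ 2 = a ^+ 2 + b ^+ 2 by rewrite sqr_sqrtr// addr_ge0// sqr_ge0.
have c0 : c != 0.
  rewrite -sqrf_eq0 c2 paddr_eq0 ?sqr_ge0// negb_and sqrf_eq0 a0//.
have mF : measurable_fun [set: RM * RM] (fun z => f (c * z.1)).
  by apply: measurableT_comp => //; exact: measurable_funM.
have := stdn_rotation (a := a / c) (b := b / c) (f := fun z => f (c * z.1)).
have -> : (a / c) ^+ 2 + (b / c) ^+ 2 = 1.
  by rewrite !expr_div_n -mulrDl -c2 divff// sqrf_eq0.
rewrite mulf_neq0 ?invr_eq0// => /(_ erefl isT mF (fun z => f0 _)) /= E.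
transitivity (\int[stdn]_u \int[stdn]_v f (c * (a / c * u + b / c * v))%R)%E.
  by apply: eq_integral => u _; apply: eq_integral => v _; congr f; field.
rewrite E; apply: eq_integral => u _.
by rewrite stdn_cst.
Qed.

End normal_density.

(** * Pairs of linear forms in a Gaussian vector *)

Section iid_integral.
Context d (T : measurableType d) (R : realType) (P : probability T R).

Lemma ge0_integral_iidS k (f : k.+1.-tuple T -> \bar R) :
  measurable_fun [set: k.+1.-tuple T] f -> (forall x, 0 <= f x)%E ->
  (\int[iid P k.+1]_x f x = \int[P]_s \int[iid P k]_t f (tcons (s, t)))%E.
Proof.
move=> mf f0.
rewrite /= ge0_integral_distribution//.
rewrite (fubini_tonelli1 (f \o @tcons _ _ k))//; last by move=> z; exact: f0.
by apply: measurableT_comp => //; exact: measurable_tcons.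
Qed.

Lemma L1_iidS k (f : k.+1.-tuple T -> R) : measurable_fun [set: k.+1.-tuple T] f ->
  L1 (P \x iid P k)%E (fun z => f (tcons z)) -> L1 (iid P k.+1) f.
Proof. by move=> mf If; exact: L1_distribution. Qed.

Lemma Ex_iidS k (f : k.+1.-tuple T -> R) : measurable_fun [set: k.+1.-tuple T] f ->
  L1 (P \x iid P k)%E (fun z => f (tcons z)) ->
  Ex (iid P k.+1) f = Ex (P \x iid P k)%E (fun z => f (tcons z)).
Proof. by move=> mf If; rewrite /= Ex_distribution. Qed.

Lemma tnth_tcons0 k (s : T) (t : k.-tuple T) : tnth (tcons (s, t)) ord0 = s.
Proof. by rewrite /tcons tnth0. Qed.

Lemma tnth_tconsS k (s : T) (t : k.-tuple T) (i : 'I_k) :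
  tnth (tcons (s, t)) (lift ord0 i) = tnth t i.
Proof. by rewrite /tcons tnthS. Qed.

End iid_integral.

Section same_law.
Context (R : realType) dU (U : measurableType dU).

(** Equality in law, through integrals of nonnegative functions: this form
    composes with Tonelli's theorem without integrability conditions. *)
Definition same_law d1 d2 (T1 : measurableType d1) (T2 : measurableType d2)
    (P : probability T1 R) (X : T1 -> U) (Q : probability T2 R) (Y : T2 -> U) :=
  forall f : U -> \bar R, measurable_fun [set: U] f -> (forall u, 0 <= f u)%E ->
  (\int[P]_x f (X x) = \int[Q]_y f (Y y))%E.

Context d1 d2 (T1 : measurableType d1) (T2 : measurableType d2).
Context (P : probability T1 R) (X : T1 -> U) (Q : probability T2 R) (Y : T2 -> U).
Hypothesis mX : measurable_fun [set: T1] X.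
Hypothesis mY : measurable_fun [set: T2] Y.
Hypothesis XY : same_law P X Q Y.

Lemma same_law_L1 (f : U -> R) : measurable_fun [set: U] f ->
  L1 P (f \o X) -> L1 Q (f \o Y).
Proof.
move=> mf /integrableP[_ If]; apply/integrableP; split.
  by apply/measurable_EFinP; exact: measurableT_comp.
rewrite -(XY (f := fun u => `|(f u)%:E|%E))//.
by apply: measurableT_comp => //; exact/measurable_EFinP.
Qed.

Lemma same_law_Ex (f : U -> R) : measurable_fun [set: U] f ->
  Ex P (f \o X) = Ex Q (f \o Y).
Proof.
move=> mf; have mEf : measurable_fun [set: U] (EFin \o f) by exact/measurable_EFinP.
rewrite /Ex /Rintegral; congr fine; rewrite integralE [in RHS]integralE.
have mp : measurable_fun [set: U] (EFin \o f)^\+%E by exact: measurable_funepos.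
have mn : measurable_fun [set: U] (EFin \o f)^\-%E by exact: measurable_funeneg.
congr (_ - _)%E.
  rewrite -[Z in (\int[P]_x (Z^\+%E x))%E]/((EFin \o f) \o X).
  rewrite -[Z in (\int[Q]_x (Z^\+%E x))%E]/((EFin \o f) \o Y).
  by rewrite (funepos_comp (EFin \o f) X) (funepos_comp (EFin \o f) Y); exact: (XY mp (funepos_ge0 _)).
rewrite -[Z in (\int[P]_x (Z^\-%E x))%E]/((EFin \o f) \o X).
rewrite -[Z in (\int[Q]_x (Z^\-%E x))%E]/((EFin \o f) \o Y).
by rewrite (funeneg_comp (EFin \o f) X) (funeneg_comp (EFin \o f) Y); exact: (XY mn (funeneg_ge0 _)).
Qed.

End same_law.

Section gaussian_pair.
Context (R : realType).
Local Notation RM := (measurableTypeR R).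
Local Notation N := (@stdn R).

Lemma measurable_dotp d (x : d.-tuple R) :
  measurable_fun [set: d.-tuple RM] (fun y : d.-tuple RM => dotp x y : RM).
Proof.
rewrite /dotp; apply: measurable_sum => k; apply: measurable_funM => //.
exact: measurable_tnth.
Qed.

Lemma dotp_cons d x0 (x : d.-tuple R) (s : RM) (y : d.-tuple RM) :
  dotp [tuple of x0 :: x] (tcons (s, y)) = x0 * s + dotp x y.
Proof.
rewrite /dotp big_ord_recl tnth0 tnth_tcons0; congr (_ + _).
by apply: eq_bigr => i _; rewrite tnthS tnth_tconsS.
Qed.

Definition lin_pair (a b c : R) (z : RM * RM) : RM * RM :=
  (a * z.1, b * z.1 + c * z.2).

Lemma measurable_lin_pair a b c : measurable_fun [set: RM * RM] (lin_pair a b c).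
Proof.
apply: measurable_fun_pair; first exact: measurable_funM.
exact: measurable_lin2.
Qed.

Definition dotp_pair d (x x' : d.-tuple R) (y : d.-tuple RM) : RM * RM :=
  (dotp x y, dotp x' y).

Lemma measurable_dotp_pair d (x x' : d.-tuple R) :
  measurable_fun [set: d.-tuple RM] (dotp_pair x x').
Proof. by apply: measurable_fun_pair; exact: measurable_dotp. Qed.

Notation I f := (\int[N]_u f%E)%E.

(** Two linear forms of three independent Gaussians, the first of which does
    not involve the last variable, are brought to triangular form by a rotation
    that removes the second variable from the first form and then one that
    merges the two variables left in the second form. *)
Lemma triangular3 (a s b t c : R) : 0 <= a ->
  exists a' b' c', [/\ 0 <= a', 0 <= c',
    [/\ a' ^+ 2 = s ^+ 2 + a ^+ 2, a' * b' = s * t + a * b &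
     b' ^+ 2 + c' ^+ 2 = t ^+ 2 + b ^+ 2 + c ^+ 2] &
    forall f : RM * RM -> \bar R, measurable_fun [set: RM * RM] f ->
     (forall z, 0 <= f z)%E ->
     (\int[N]_w \int[N]_u \int[N]_v f (s * w + a * u, t * w + (b * u + c * v))%R
     = \int[N]_u \int[N]_v f (a' * u, b' * u + c' * v)%R)%E].
Proof.
move=> a0; have [a00|an0] := eqVneq a 0.
  (* With a = 0 the first form depends on w alone; the sign of s goes into w. *)
  exists `|s|, (if 0 <= s then t else - t), (Num.sqrt (b ^+ 2 + c ^+ 2)).
  rewrite normr_ge0 sqrtr_ge0 a00; split; [by []|by []| |].
    split.
    - by rewrite real_normK ?num_real// expr0n addr0.
    - rewrite mul0r addr0; case: ifPn => [s0|]; first by rewrite ger0_norm.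
      by rewrite -ltNge => s0; rewrite ltr0_norm// mulrNN.
    - rewrite sqr_sqrtr ?addr_ge0 ?sqr_ge0// addrA; congr (_ + _ + _).
      by case: ifP => //; rewrite sqrrN.
  move=> f mf f0.
  pose F (w : RM) := (\int[N]_u f (s * w, t * w + Num.sqrt (b ^+ 2 + c ^+ 2) * u)%R)%E.
  transitivity (\int[N]_w F w)%E.
    apply: eq_integral => w _.
    have mfw : measurable_fun [set: RM] (fun y : RM => f (s * w, t * w + y)%R).
      by apply: measurableT_comp => //; apply: measurable_fun_pair => //; exact: measurable_funD.
    apply: (etrans _ (stdn_combine b c mfw (fun _ => f0 _))).
    by apply: eq_integral => u _; apply: eq_integral => v _; rewrite mul0r addr0.
  case: ifPn => [s0|]; first by rewrite ger0_norm.
  rewrite -ltNge => s0; rewrite (ltr0_norm s0).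
  rewrite -(@stdn_opp R F).
  - by apply: eq_integral => w _; rewrite /F !mulNr !mulrN.
  - apply: (measurable_fun_fubini_tonelli_F (m2 := N)
      (fun z => f (s * z.1, t * z.1 + Num.sqrt (b ^+ 2 + c ^+ 2) * z.2)))%R => //.
    apply: measurableT_comp => //; apply: measurable_fun_pair.
      exact: measurable_funM.
    exact: measurable_lin2.
  - by move=> w; exact: integral_ge0.
pose a' := Num.sqrt (s ^+ 2 + a ^+ 2).
have a'2 : a' ^+ 2 = s ^+ 2 + a ^+ 2 by rewrite sqr_sqrtr// addr_ge0// sqr_ge0.
have a'0 : a' != 0.
  by rewrite -sqrf_eq0 a'2 paddr_eq0 ?sqr_ge0// negb_and !sqrf_eq0 an0 orbT.
pose e := (t * a - b * s) / a'.
pose b' := (s * t + a * b) / a'.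
exists a', b', (Num.sqrt (e ^+ 2 + c ^+ 2)); rewrite !sqrtr_ge0; split; [by []|by []| |].
  split=> //; first by rewrite mulrC divfK.
  rewrite sqr_sqrtr ?addr_ge0 ?sqr_ge0// addrA; congr (_ + _).
  have : a' ^+ 2 * (b' ^+ 2 + e ^+ 2) = a' ^+ 2 * (t ^+ 2 + b ^+ 2).
    rewrite {2}a'2 /b' /e; transitivity ((s * t + a * b) ^+ 2 + (t * a - b * s) ^+ 2).
      by field.
    by ring.
  by apply: mulfI; rewrite sqrf_eq0.
move=> f mf f0.
pose G (z : (RM * RM) * RM) : \bar R :=
  f (s * z.1.2 + a * z.1.1, t * z.1.2 + (b * z.1.1 + c * z.2))%R.
have mG : measurable_fun [set: (RM * RM) * RM] G.
  apply: measurableT_comp => //; apply: measurable_fun_pair.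
    by apply: measurable_lin2; exact: measurableT_comp.
  apply: measurable_funD; first by apply: measurable_funM => //; exact: measurableT_comp.
  by apply: measurable_lin2 => //; exact: measurableT_comp.
have G0 z : (0 <= G z)%E by exact: f0.
pose H := fubini_F N G.
have mH : measurable_fun [set: RM * RM] H := measurable_fun_fubini_tonelli_F G mG G0.
have H0 z : (0 <= H z)%E by apply: integral_ge0.
transitivity (\int[N]_w \int[N]_u H (u, w))%E; first by [].
rewrite -(fubini_tonelli H mH H0).
(* The rotation of the plane of (w, u) that makes s w + a u a multiple of one
   coordinate. *)
rewrite -(stdn_rotation (a := a / a') (b := - s / a') _ _ mH H0); last 2 first.
- by rewrite !expr_div_n sqrrN -mulrDl (addrC (a ^+ 2)) -a'2 divff// sqrf_eq0.
- by rewrite mulf_neq0// invr_eq0.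
apply: eq_integral => u _.
have mfu : measurable_fun [set: RM] (fun y : RM => f (a' * u, b' * u + y)%R).
  by apply: measurableT_comp => //; apply: measurable_fun_pair => //; exact: measurable_funD.
transitivity (\int[N]_w \int[N]_v f (a' * u, b' * u + (e * w + c * v))%R)%E; last first.
  apply: (etrans (stdn_combine e c mfu (fun _ => f0 _))).
  by apply: eq_integral => w _.
apply: eq_integral => w _; rewrite /H /fubini_F; apply: eq_integral => v _.
rewrite /G /=; congr (f (_, _)).
  transitivity ((s ^+ 2 + a ^+ 2) / a' * u); first by field.
  by rewrite -a'2 expr2 mulfK.
by rewrite /b' /e; field.
Qed.

(** The law of the pair of inner products with x and x' depends on the Gram
    matrix only, and is the one of a triangular pair in two variables. The
    coordinates are eliminated one at a time: induction replaces all but one of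
    them by a triangular pair, and triangular3 absorbs the last. *)
Lemma gaussian_pair d (x x' : d.-tuple R) :
  exists a b c, [/\ 0 <= a, 0 <= c,
    [/\ a ^+ 2 = dotp x x, a * b = dotp x x' & b ^+ 2 + c ^+ 2 = dotp x' x'] &
    same_law (gauss R d) (dotp_pair x x') (N \x N)%E (lin_pair a b c)].
Proof.
elim: d x x' => [|d IH] x x'.
  exists 0, 0, 0; split=> //; first by rewrite /dotp !big_ord0 expr0n !mul0r addr0.
  move=> f mf f0; rewrite /= integral_dirac//; last first.
    by apply: measurableT_comp => //; exact: measurable_dotp_pair.
  rewrite diracT mul1e fubini_tonelli1//; last first.
    by apply: measurableT_comp => //; exact: measurable_lin_pair.
  rewrite /fubini_F /lin_pair /=.
  under eq_integral do under eq_integral do rewrite !mul0r addr0.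
  rewrite !stdn_cst; congr f.
  by rewrite /dotp_pair /dotp !big_ord0.
case/tupleP: x => x0 x; case/tupleP: x' => x0' x'.
have [a [b [c [a0 c0 [aE abE bcE] L]]]] := IH x x'.
have [a' [b' [c' [a'0 c'0 [aE' abE' bcE'] L']]]] := triangular3 x0 b x0' c a0.
exists a', b', c'; split=> //.
  have cE (y y' : d.-tuple R) y0 y0' :
      dotp [tuple of y0 :: y] [tuple of y0' :: y'] = y0 * y0' + dotp y y'.
    exact: (dotp_cons y0 y y0' y').
  by rewrite !cE aE' abE' bcE' -aE -abE -bcE -!expr2 addrA.
move=> f mf f0; rewrite ge0_integral_iidS//; last first.
  by apply: measurableT_comp => //; exact: measurable_dotp_pair.
under eq_integral => w _.
  under eq_integral => y _ do rewrite /dotp_pair !dotp_cons.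
  rewrite (L (fun z => f (x0 * w + z.1, x0' * w + z.2)))//; last first.
    by apply: measurableT_comp => //; apply: measurable_fun_pair; exact: measurable_funD.
  rewrite fubini_tonelli1//; last first.
    apply: measurableT_comp => //; apply: measurable_fun_pair; apply: measurable_funD => //=.
      exact: measurable_funM.
    exact: measurable_lin2.
  over.
rewrite /fubini_F /= L'//.
rewrite fubini_tonelli1//.
by apply: measurableT_comp => //; exact: measurable_lin_pair.
Qed.

End gaussian_pair.

(** * The normal distribution function and its moments *)

Section normal_facts.
Context (R : realType).
Local Notation RM := (measurableTypeR R).
Local Notation N := (@stdn R).
Notation mu := (@lebesgue_measure R).

(** The fourth power of 1 + y <= exp y at y = z^2 / 16. *)
Lemma pow8_le (z : R) : z ^+ 8 <= 16 ^+ 4 * expR (z ^+ 2 / 4).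
Proof.
have -> : z ^+ 8 = 16 ^+ 4 * (z ^+ 2 / 16) ^+ 4 by field.
rewrite ler_pM2l ?exprn_gt0//.
have -> : z ^+ 2 / 4 = (z ^+ 2 / 16) * 4%:R by field.
rewrite expRM_natr lerXn2r ?nnegrE ?expR_ge0 ?divr_ge0 ?sqr_ge0//.
by apply: le_trans (expR_ge1Dx _); rewrite lerDr.
Qed.

(** The eighth power costs half of the exponent of the density, which leaves the
    density of variance 2 up to a constant. *)
Lemma L1_stdn_pow8 : L1 N (fun z : RM => z ^+ 8).
Proof.
have m8 : measurable_fun [set: RM] (fun z : RM => z ^+ 8 : R) by exact: measurable_funX.
apply: L1_ge0_ltoo => //; first by move=> z; rewrite exprn_even_ge0.
rewrite integral_stdn; last 2 first.
- exact/measurable_EFinP.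
- by move=> z; rewrite lee_fin exprn_even_ge0.
pose s := Num.sqrt 2 : R.
have s0 : s != 0 by rewrite sqrtr_eq0 -ltNge.
have s2 : s ^+ 2 = 2 by rewrite sqr_sqrtr.
pose c : R := 16 ^+ 4 * normal_peak 1 / normal_peak s.
have c0 : 0 <= c by rewrite !mulr_ge0 ?invr_ge0 ?normal_peak_ge0.
have mp t : measurable_fun [set: RM] (fun x => (normal_pdf 0 t x : R)%:E).
  by apply/measurable_EFinP; exact: measurable_normal_pdf.
apply: (@le_lt_trans _ _ (\int[mu]_x (c%:E * (normal_pdf 0 s x)%:E))%E).
  apply: ge0_le_integral => //.
  - move=> z _; rewrite -EFinM lee_fin mulr_ge0 ?normal_pdf_ge0//.
    by rewrite exprn_even_ge0.
  - by apply: emeasurable_funM => //; exact/measurable_EFinP.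
  - exact: emeasurable_funM.
  move=> z _; rewrite -!EFinM lee_fin !normal_pdfE ?oner_eq0//.
  rewrite /normal_fun !subr0.
  have ps0 : normal_peak s != 0 by rewrite gt_eqF// normal_peak_gt0.
  rewrite /c [leRHS]mulrA divfK// mulrCA -[leRHS]mulrA [leRHS]mulrCA.
  rewrite ler_wpM2l ?normal_peak_ge0//.
  rewrite expr1n s2.
  apply: (@le_trans _ _ (16 ^+ 4 * expR (z ^+ 2 / 4) * expR (- z ^+ 2 / (1 *+ 2)))).
    by rewrite ler_wpM2r ?expR_ge0// pow8_le.
  rewrite -mulrA -expRD ler_wpM2l ?exprn_ge0// ler_expR.
  rewrite (_ : 2 *+ 2 = 4 :> R); last by rewrite mulr2n; lra.
  by rewrite (_ : 1 *+ 2 = 2 :> R)//; lra.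
rewrite ge0_integralZl//; last by move=> z _; rewrite lee_fin normal_pdf_ge0.
by rewrite integral_normal_pdf mule1 ltry.
Qed.

Lemma L1_stdn_pow k : (k <= 8)%N -> L1 N (fun z : RM => z ^+ k).
Proof.
move=> k8; apply: (L1_le (g := fun z : RM => 1 + z ^+ 8)).
- exact: measurable_funX.
- by apply: L1D; [exact: L1_cst|exact: L1_stdn_pow8].
move=> z; have z8 : 0 <= z ^+ 8 by rewrite exprn_even_ge0.
rewrite normrX; have [z1|z1] := leP `|z| 1.
  by apply: (@le_trans _ _ 1); rewrite ?exprn_ile1// lerDl.
rewrite -[X in _ <= _ + X]ger0_norm// normrX.
apply: (@le_trans _ _ (`|z| ^+ 8)); last by rewrite lerDr.
by apply: ler_weXn2l => //; exact: ltW.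
Qed.

Lemma normal_peak1_le1 : normal_peak 1 <= 1 :> R.
Proof.
rewrite /normal_peak expr1n mul1r.
have p1 : 1 <= pi *+ 2 :> R by rewrite mulr2n; have := pi_ge2 R; lra.
have p0 : 0 < pi *+ 2 :> R by exact: lt_le_trans p1.
by rewrite invf_le1 ?sqrtr_gt0// -[leLHS]sqrtr1 ler_sqrt// ltW.
Qed.

Definition Phi (t : R) : R := fine (N `]-oo, t]%classic).

Lemma Phi_ge0 t : 0 <= Phi t. Proof. by rewrite fine_ge0. Qed.

Lemma Phi_le1 t : Phi t <= 1.
Proof. by rewrite -lee_fin fineK ?probability_le1// fin_num_measure. Qed.

Lemma Phi_itv s t : s <= t -> Phi t - Phi s = fine (N `]s, t]%classic).
Proof.
move=> st; rewrite /Phi.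
have -> : `]-oo, t]%classic = `]-oo, s]%classic `|` `]s, t]%classic :> set R.
  by rewrite -itv_bndbnd_setU.
rewrite measureU//.
  by rewrite fineD ?fin_num_measure// addrAC subrr add0r.
apply/seteqP; split => x //= [].
by rewrite !in_itv/= => /le_lt_trans h /andP[/h]; rewrite ltxx.
Qed.

Lemma stdn_itv s t : s <= t ->
  (N `]s, t]%classic = \int[mu]_(x in `]s, t]%classic) (normal_pdf 0 1 x)%:E)%E.
Proof. by []. Qed.

(** The standard density is at most 1. *)
Lemma Phi_le s t : s <= t -> Phi s <= Phi t <= Phi s + (t - s).
Proof.
move=> st; rewrite -subr_ge0 Phi_itv// fine_ge0//= -lerBlDl Phi_itv//.
rewrite -lee_fin fineK ?fin_num_measure// stdn_itv//.
apply: (@le_trans _ _ (\int[mu]_(x in `]s, t]%classic) (cst 1 x))%E).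
  apply: ge0_le_integral => //.
  - by move=> x _; rewrite lee_fin normal_pdf_ge0.
  - by apply/measurable_funTS/measurable_EFinP; exact: measurable_normal_pdf.
  - move=> x _; rewrite lee_fin (le_trans _ normal_peak1_le1)//.
    by apply: normal_pdf_ub; exact: oner_neq0.
rewrite integral_cst//= mul1e. rewrite lebesgue_measure_itv/= lte_fin.
case: ifP => _; first by rewrite -EFinB.
by rewrite lee_fin subr_ge0.
Qed.

Lemma Phi_lipschitz s t : `|Phi s - Phi t| <= `|s - t|.
Proof.
wlog st : s t / s <= t.
  move=> H; have [/H//|/ltW/H] := leP s t.
  by rewrite distrC (distrC t).
have /andP[h1 h2] := Phi_le st.
by rewrite distrC (distrC s) !ger0_norm ?subr_ge0//; lra.
Qed.

Lemma normal_pdf_gt0 x : 0 < normal_pdf 0 1 x :> R.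
Proof.
by rewrite normal_pdfE ?oner_eq0// mulr_gt0 ?expR_gt0// normal_peak_gt0// oner_neq0.
Qed.

(** On [- K, K] the density is at least its value at K. *)
Lemma Phi_increment K s t : - K <= s -> s <= t -> t <= K ->
  normal_pdf 0 1 K * (t - s) <= Phi t - Phi s.
Proof.
move=> Ks st tK; rewrite Phi_itv// -lee_fin fineK ?fin_num_measure// stdn_itv//.
apply: (@le_trans _ _ (\int[mu]_(x in `]s, t]%classic) (cst (normal_pdf 0 1 K)%:E x))%E).
  rewrite integral_cst//= lebesgue_measure_itv/= lte_fin EFinM.
  case: ltP => [_|ts]; first by rewrite -EFinB.
  rewrite (_ : t - s = 0) ?mule0//.
  by apply/eqP; rewrite subr_eq0 eq_le ts st.
apply: ge0_le_integral => //.
- by move=> x _; rewrite lee_fin normal_pdf_ge0.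
- by apply/measurable_funTS/measurable_EFinP; exact: measurable_normal_pdf.
- move=> x /=; rewrite in_itv/= => /andP[sx xt].
  rewrite lee_fin !normal_pdfE ?oner_eq0// ler_wpM2l ?normal_peak_ge0//.
  rewrite ler_expR !subr0 ler_pM2r ?invr_gt0 ?pmulrn_lgt0 ?exprn_gt0//.
  by rewrite lerN2; nra.
Qed.

Lemma stdn_set1 (a : R) : N [set a] = 0%E.
Proof.
by rewrite /stdn /= /normal_prob integral_set1.
Qed.

(** The second moment of the standard Gaussian, which is 1; it enters as a positive
    constant. *)
Definition stdn_m2 : R := Ex N (fun z : RM => z ^+ 2).
Local Notation kappa := stdn_m2.

Lemma Phi_pos_itv s t : s < t -> 0 < fine (N `]s, t]%classic).
Proof.
move=> st; rewrite -Phi_itv ?ltW//.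
pose K := Num.max (- s) t.
apply: (@lt_le_trans _ _ (normal_pdf 0 1 K * (t - s))).
  by rewrite mulr_gt0 ?normal_pdf_gt0// subr_gt0.
apply: Phi_increment; last by rewrite /K le_max lexx orbT.
- by rewrite lerNl /K le_max lexx.
- exact: ltW.
Qed.

Lemma Ex_stdn_gt0 (f : RM -> R) (s t : R) : s < t -> L1 N f ->
  (forall z, 0 <= f z) -> (forall z, s < z -> z <= t -> 1 <= f z) -> 0 < Ex N f.
Proof.
move=> st If f0 f1.
apply: (lt_le_trans (Phi_pos_itv st)); rewrite -Ex_ind//.
apply: Ex_le => //; first exact: L1_ind.
move=> z; rewrite /ind; case: (boolP (z \in _)) => // /[!inE] /=.
by rewrite in_itv/= => /andP[sz zt]; exact: f1.
Qed.

Lemma stdn_m2_gt0 : 0 < kappa.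
Proof.
apply: (@Ex_stdn_gt0 _ 1 2); first by rewrite ltr1n.
- exact: (L1_stdn_pow (k := 2)).
- by move=> z; exact: sqr_ge0.
- by move=> z z1 _; nra.
Qed.

Definition csq (z : RM) : R := z ^+ 2 - kappa.

Lemma measurable_csq : measurable_fun [set: RM] csq.
Proof. by apply: measurable_funB => //; exact: measurable_funX. Qed.

Lemma L1_csq4 : L1 N (fun z => csq z ^+ 4).
Proof.
apply: (L1_le (g := fun z : RM => 8 * z ^+ 8 + 8 * kappa ^+ 4)).
- by apply: measurable_funX; exact: measurable_csq.
- by apply: L1D; [apply: L1Z; exact: L1_stdn_pow8|exact: L1_cst].
move=> z; rewrite ger0_norm; last by rewrite exprn_even_ge0.
rewrite /csq -[8%N]/(2 * 4)%N exprM; move: (z ^+ 2) kappa => x y.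
have h : (x - y) ^+ 2 <= 2 * (x ^+ 2 + y ^+ 2) by have := sqr_ge0 (x + y); nra.
have h2 : (x ^+ 2 + y ^+ 2) ^+ 2 <= 2 * (x ^+ 4 + y ^+ 4).
  by have := sqr_ge0 (x ^+ 2 - y ^+ 2); nra.
have A0 := sqr_ge0 (x - y).
have -> : (x - y) ^+ 4 = ((x - y) ^+ 2) ^+ 2 by rewrite -exprM.
move: ((x - y) ^+ 2) (x ^+ 2 + y ^+ 2) (x ^+ 4) (y ^+ 4) h h2 A0 => A B C D h h2 A0.
nra.
Qed.

Lemma Ex_csq : Ex N csq = 0.
Proof.
rewrite /csq ExB ?Ex_cst ?subrr//; last exact: L1_cst.
exact: (L1_stdn_pow (k := 2)).
Qed.

Lemma L1_csq2 : L1 N (fun z => csq z ^+ 2).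
Proof.
apply: (L1_le (g := fun z => 1 + csq z ^+ 4)).
- by apply: measurable_funX; exact: measurable_csq.
- by apply: L1D; [exact: L1_cst|exact: L1_csq4].
by move=> z; rewrite ger0_norm ?sqr_ge0//; have := sqr_ge0 (csq z ^+ 2 - 1); nra.
Qed.

Lemma Ex_csq2_gt0 : 0 < Ex N (fun z => csq z ^+ 2).
Proof.
have k0 := stdn_m2_gt0.
apply: (@Ex_stdn_gt0 _ (kappa + 1) (kappa + 2)); first by rewrite ltrD2l ltr1n.
- exact: L1_csq2.
- by move=> z; exact: sqr_ge0.
- move=> z z1 _; rewrite /csq; have h : 1 <= z ^+ 2 - kappa by nra.
  by nra.
Qed.

End normal_facts.

(** * Moments of the squared length of a Gaussian vector *)

Lemma normr_pow_le (R : realDomainType) (y : R) j : (j <= 4)%N -> `|y ^+ j| <= 1 + y ^+ 4.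
Proof.
move=> j4; have y4 : 0 <= y ^+ 4 by rewrite exprn_even_ge0.
rewrite normrX; have [y1|y1] := leP `|y| 1.
  by apply: (@le_trans _ _ 1); rewrite ?exprn_ile1// lerDl.
rewrite -[X in _ <= _ + X]ger0_norm// normrX.
apply: (@le_trans _ _ (`|y| ^+ 4)); last by rewrite lerDr.
by apply: ler_weXn2l => //; exact: ltW.
Qed.

Lemma L1_pow4 d (T : measurableType d) (R : realType) (P : probability T R)
    (f : T -> R) j : (j <= 4)%N -> measurable_fun [set: T] f ->
  L1 P (fun x => f x ^+ 4) -> L1 P (fun x => f x ^+ j).
Proof.
move=> j4 mf If; apply: (L1_le (g := fun x => 1 + f x ^+ 4)).
- exact: measurable_funX.
- by apply: L1D => //; exact: L1_cst.
- by move=> x; exact: normr_pow_le.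
Qed.

Section sum_of_independent.
Context d1 d2 (T1 : measurableType d1) (T2 : measurableType d2) (R : realType).
Context (P : probability T1 R) (Q : probability T2 R) (f : T1 -> R) (g : T2 -> R).
Hypotheses (mf : measurable_fun [set: T1] f) (mg : measurable_fun [set: T2] g).
Hypotheses (f4 : L1 P (fun x => f x ^+ 4)) (g4 : L1 Q (fun x => g x ^+ 4)).
Hypotheses (f1 : Ex P f = 0) (g1 : Ex Q g = 0).
Let PQ := (P \x Q)%E.

Let If j : (j <= 4)%N -> L1 P (fun x => f x ^+ j).
Proof. by move=> j4; exact: L1_pow4. Qed.
Let Ig j : (j <= 4)%N -> L1 Q (fun x => g x ^+ j).
Proof. by move=> j4; exact: L1_pow4. Qed.
Let M i j c (z : T1 * T2) := c * (f z.1 ^+ i * g z.2 ^+ j).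
Let IM i j c : (i <= 4)%N -> (j <= 4)%N -> L1 PQ (M i j c).
Proof.
by move=> i4 j4; apply: L1Z; apply: (L1_prodM (f := fun x => f x ^+ i) (g := fun x => g x ^+ j)); [exact: If|exact: Ig].
Qed.
Let EM i j c : (i <= 4)%N -> (j <= 4)%N ->
  Ex PQ (M i j c) = c * (Ex P (fun x => f x ^+ i) * Ex Q (fun x => g x ^+ j)).
Proof.
move=> i4 j4; rewrite ExZ; last first.
  by apply: (L1_prodM (f := fun x => f x ^+ i) (g := fun x => g x ^+ j)); [exact: If|exact: Ig].
congr (_ * _); apply: (Ex_prodM (f := fun x => f x ^+ i) (g := fun x => g x ^+ j)).
  exact: If.
exact: Ig.
Qed.

Let D4 z : (f z.1 + g z.2) ^+ 4 =
  M 4 0 1 z + (M 3 1 4 z + (M 2 2 6 z + (M 1 3 4 z + M 0 4 1 z))).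
Proof. by rewrite /M; ring. Qed.

Let D2 z : (f z.1 + g z.2) ^+ 2 = M 2 0 1 z + (M 1 1 2 z + M 0 2 1 z).
Proof. by rewrite /M; ring. Qed.

Lemma L1_sum4 : L1 PQ (fun z => (f z.1 + g z.2) ^+ 4).
Proof.
apply: (L1_ext (fun z => esym (D4 z))).
by do ![apply: L1D; first exact: IM]; exact: IM.
Qed.

Lemma Ex_sum1 : Ex PQ (fun z => f z.1 + g z.2) = 0.
Proof.
rewrite (eq_Ex _ (g := fun z => M 1 0 1 z + M 0 1 1 z)); last first.
  by move=> z; rewrite /M; ring.
rewrite ExD ?EM//; [|exact: IM..].
rewrite !mul1r (_ : (fun x => f x ^+ 1) = f)// f1 mul0r add0r.
by rewrite (_ : (fun x => g x ^+ 1) = g)// g1 mulr0.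
Qed.

Lemma Ex_sum2 : Ex PQ (fun z => (f z.1 + g z.2) ^+ 2) =
  Ex P (fun x => f x ^+ 2) + Ex Q (fun x => g x ^+ 2).
Proof.
rewrite (eq_Ex _ D2) ExD ?ExD ?EM//; try by do ?[apply: L1D]; exact: IM.
rewrite (_ : (fun x => f x ^+ 1) = f)// f1 mul0r mulr0 add0r !mul1r.
by rewrite (Ex_cst Q) (Ex_cst P) mulr1 mul1r.
Qed.

(** The binomial terms with exponents (3, 1) and (1, 3) vanish by centring. *)
Lemma Ex_sum4 : Ex PQ (fun z => (f z.1 + g z.2) ^+ 4) =
  Ex P (fun x => f x ^+ 4) +
  6 * Ex P (fun x => f x ^+ 2) * Ex Q (fun x => g x ^+ 2) +
  Ex Q (fun x => g x ^+ 4).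
Proof.
rewrite (eq_Ex _ D4) !ExD ?EM//; try by do ?[apply: L1D]; exact: IM.
rewrite (_ : (fun x => f x ^+ 1) = f)// f1 (_ : (fun x => g x ^+ 1) = g)// g1.
by rewrite (Ex_cst Q) (Ex_cst P); ring.
Qed.

End sum_of_independent.

Section iid_moments.
Context d (T : measurableType d) (R : realType) (P : probability T R) (f : T -> R).
Hypothesis mf : measurable_fun [set: T] f.
Hypothesis f4 : L1 P (fun x => f x ^+ 4).
Hypothesis f1 : Ex P f = 0.

Definition iid_sum k (t : k.-tuple T) : R := \sum_(i < k) f (tnth t i).

Lemma measurable_iid_sum k : measurable_fun [set: k.-tuple T] (@iid_sum k).
Proof.
apply: measurable_sum => i; apply: measurableT_comp => //; exact: measurable_tnth.
Qed.

Lemma iid_sum_cons k s (t : k.-tuple T) : iid_sum (tcons (s, t)) = f s + iid_sum t.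
Proof.
rewrite /iid_sum big_ord_recl tnth_tcons0; congr (_ + _).
by apply: eq_bigr => i _; rewrite tnth_tconsS.
Qed.

(** The mixed moments with an odd exponent vanish. Besides its own fourth moment,
    the term after the first k adds 6 k times the square of the second moment,
    which is at most the fourth moment: the total grows quadratically. *)
Lemma iid_sum_moments k :
  [/\ L1 (iid P k) (fun t => iid_sum t ^+ 4), Ex (iid P k) (@iid_sum k) = 0,
   Ex (iid P k) (fun t => iid_sum t ^+ 2) = k%:R * Ex P (fun x => f x ^+ 2) &
   Ex (iid P k) (fun t => iid_sum t ^+ 4) <= 3 * k%:R ^+ 2 * Ex P (fun x => f x ^+ 4)].
Proof.
elim: k => [|k [I4 E1 E2 E4]].
  have s0 (t : 0.-tuple T) : iid_sum t = 0 by rewrite /iid_sum big_ord0.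
  split.
  - by apply: (L1_ext (f := fun=> 0)) => [t|]; [rewrite s0 expr0n|exact: L1_cst].
  - by rewrite (eq_Ex _ s0) Ex_cst.
  - rewrite (eq_Ex _ (g := fun=> 0)) ?Ex_cst ?mul0r// => t; by rewrite s0 expr0n.
  - rewrite (eq_Ex _ (g := fun=> 0)) ?Ex_cst ?expr0n/= ?mulr0 ?mul0r// => t.
    by rewrite s0 expr0n.
have mS j : measurable_fun [set: k.+1.-tuple T] (fun t => iid_sum t ^+ j).
  by apply: measurable_funX; exact: measurable_iid_sum.
have mSk := measurable_iid_sum (k := k).
have J4 : L1 (P \x iid P k)%E (fun z => iid_sum (tcons z) ^+ 4).
  apply: (L1_ext (f := fun z => (f z.1 + iid_sum z.2) ^+ 4)) => [[s t]|].
    by rewrite iid_sum_cons.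
  exact: L1_sum4.
have J j : (j <= 4)%N -> L1 (P \x iid P k)%E (fun z => iid_sum (tcons z) ^+ j).
  move=> j4; apply: L1_pow4 => //.
  by apply: measurableT_comp; [exact: measurable_iid_sum|exact: measurable_tcons].
have EE j : (j <= 4)%N -> Ex (iid P k.+1) (fun t => iid_sum t ^+ j) =
    Ex (P \x iid P k)%E (fun z => (f z.1 + iid_sum z.2) ^+ j).
  move=> j4; rewrite Ex_iidS//; last exact: J.
  by apply: eq_Ex => -[s t]; rewrite iid_sum_cons.
split.
- exact: L1_iidS.
- by rewrite (eq_Ex _ (g := fun t => iid_sum t ^+ 1))// EE//; exact: Ex_sum1.
- by rewrite EE// Ex_sum2// E2 -(natr1 k) mulrDl mul1r addrC.
- rewrite EE// Ex_sum4// E2.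
  have f2 : L1 P (fun x => f x ^+ 2) by exact: L1_pow4.
  have := Ex_sqr_ge f2.
  rewrite (eq_Ex _ (f := fun x => (f x ^+ 2) ^+ 2) (g := fun x => f x ^+ 4)); last first.
    by move=> x; rewrite -exprM.
  have I44 : L1 P (fun x => (f x ^+ 2) ^+ 2).
    by apply: (L1_ext (f := fun x => f x ^+ 4)) => // x; rewrite -exprM.
  move=> /(_ I44).
  set x2 := Ex P (fun x => f x ^+ 2); set x4 := Ex P (fun x => f x ^+ 4) => h.
  have x40 : 0 <= x4.
    by apply: Ex_ge0 => x; rewrite exprn_even_ge0.
  have := ler_wpM2l (ler0n R k) h.
  move: E4; rewrite -(natr1 k) -/x4.
  move: (Ex (iid P k) _) k%:R => X K E4 h'; lra.
Qed.

End iid_moments.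

Section chi_square.
Context (R : realType) (d : nat).
Local Notation RM := (measurableTypeR R).
Local Notation N := (@stdn R).
Local Notation kappa := (stdn_m2 R).
Local Notation G := (gauss R d).

Definition normsq (x : d.-tuple R) : R := dotp x x.

Lemma normsq_csq (x : d.-tuple RM) : normsq x - d%:R * kappa = iid_sum (@csq R) x.
Proof.
rewrite /normsq /dotp /iid_sum /csq sumrB sumr_const card_ord.
by congr (_ - _); rewrite mulr_natl.
Qed.

Lemma measurable_normsq : measurable_fun [set: d.-tuple RM] (normsq : d.-tuple RM -> R).
Proof.
by rewrite /normsq /dotp; apply: measurable_sum => k; apply: measurable_funM; exact: measurable_tnth.
Qed.

(** The relative deviation of the squared length; its size is of order d^(-1/2). *)
Definition dev (x : d.-tuple RM) : R := normsq x / d%:R - kappa.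

Lemma measurable_dev : measurable_fun [set: d.-tuple RM] dev.
Proof.
by apply: measurable_funB => //; apply: measurable_funM => //; exact: measurable_normsq.
Qed.

Hypothesis d0 : (0 < d)%N.

Lemma dev_csq (x : d.-tuple RM) : dev x = d%:R^-1 * iid_sum (@csq R) x.
Proof. by rewrite -normsq_csq /dev mulrBr mulKf ?pnatr_eq0 -?lt0n// mulrC. Qed.

Lemma dev_moments :
  [/\ L1 G (fun x => dev x ^+ 4), Ex G dev = 0,
   Ex G (fun x => dev x ^+ 2) = d%:R^-1 * Ex N (fun z => csq z ^+ 2) &
   Ex G (fun x => dev x ^+ 4) <= 3 * Ex N (fun z => csq z ^+ 4) / d%:R ^+ 2].
Proof.
have [I4 E1 E2 E4] := iid_sum_moments (@measurable_csq R) (@L1_csq4 R) (@Ex_csq R) d.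
have mS := measurable_iid_sum (@measurable_csq R) (k := d).
have dn0 : d%:R != 0 :> R by rewrite pnatr_eq0 -lt0n.
have dE j (x : d.-tuple RM) : dev x ^+ j = d%:R^-1 ^+ j * iid_sum (@csq R) x ^+ j.
  by rewrite dev_csq exprMn.
have I1 : L1 G (iid_sum (@csq R) (k := d)) by exact: (L1_pow4 (j := 1) isT mS I4).
split.
- by apply: (L1_ext (fun x => esym (dE 4%N x))); exact: L1Z.
- by rewrite (eq_Ex _ dev_csq) ExZ// E1 mulr0.
- by rewrite (eq_Ex _ (dE 2%N)) ExZ ?E2; [field|exact: L1_pow4].
- rewrite (eq_Ex _ (dE 4%N)) ExZ//.
  rewrite (le_trans (ler_wpM2l _ E4)) ?exprn_ge0//.
  rewrite le_eqVlt; apply/orP; left; apply/eqP; by field.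
Qed.

End chi_square.

Section dot_product.
Context (R : realType) (d : nat).
Local Notation RM := (measurableTypeR R).
Local Notation N := (@stdn R).
Local Notation kappa := (stdn_m2 R).
Local Notation G := (gauss R d).

(** The case x = x' of gaussian_pair, projected to the first coordinate. *)
Lemma gaussian_dotp (x : d.-tuple R) :
  same_law G (fun y => dotp x y : RM) N (fun z => Num.sqrt (normsq x) * z : RM).
Proof.
have [a [b [c [a0 c0 [aE _ _] L]]]] := gaussian_pair x x.
have -> : Num.sqrt (normsq x) = a by rewrite /normsq -aE sqrtr_sqr ger0_norm.
move=> f mf f0.
have mf1 : measurable_fun [set: RM * RM] (fun z => f z.1) by exact: measurableT_comp.
rewrite (L _ mf1 (fun z => f0 _)) fubini_tonelli1//; last first.
  exact: (measurableT_comp mf1 (measurable_lin_pair a b c)).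
rewrite /fubini_F /lin_pair /=.
by apply: eq_integral => u _; exact: stdn_cst.
Qed.

Lemma normsq_ge0 (x : d.-tuple R) : 0 <= normsq x.
Proof. by apply: sumr_ge0 => i _; rewrite -expr2 sqr_ge0. Qed.

Lemma dotp_m2 (x : d.-tuple R) : L1 G (fun y => dotp x y ^+ 2) /\
  Ex G (fun y => dotp x y ^+ 2) = normsq x * kappa.
Proof.
have m2 : measurable_fun [set: RM] (fun z : RM => z ^+ 2 : R) by exact: measurable_funX.
have I2 : L1 N (fun z : RM => (Num.sqrt (normsq x) * z) ^+ 2).
  apply: (L1_ext (f := fun z : RM => normsq x * z ^+ 2)).
    by move=> z; rewrite exprMn sqr_sqrtr// normsq_ge0.
  by apply: L1Z; exact: (@L1_stdn_pow R 2 isT).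
split.
  apply: (same_law_L1 (f := fun z : RM => z ^+ 2) _ _ m2 I2).
    exact: measurable_dotp.
  by move=> f mf f0; rewrite (gaussian_dotp x mf f0).
rewrite (same_law_Ex (gaussian_dotp x) (f := fun z : RM => z ^+ 2) m2).
rewrite (eq_Ex _ (g := fun z : RM => normsq x * z ^+ 2)); last first.
  by move=> z /=; rewrite exprMn sqr_sqrtr// normsq_ge0.
by rewrite ExZ//; exact: (@L1_stdn_pow R 2 isT).
Qed.

End dot_product.

(** * The probability of an entry given the vector of its row *)

Section conditional_probability.
Context (R : realType).
Local Notation RM := (measurableTypeR R).
Local Notation N := (@stdn R).
Local Notation kappa := (stdn_m2 R).
Variable d : nat.
Local Notation G := (gauss R d).
Local Notation V := (d.-tuple RM).

Lemma measurable_dotp2 : measurable_fun [set: V * V] (fun z => dotp z.1 z.2 : R).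
Proof.
rewrite /dotp; apply: measurable_sum => k; apply: measurable_funM.
  by apply: (measurableT_comp (measurable_tnth k)).
by apply: (measurableT_comp (measurable_tnth k)).
Qed.

Definition lei (t v : R) : R := (v <= t)%R%:R.

Lemma measurable_lei t : measurable_fun [set: RM] (lei t : RM -> R).
Proof.
rewrite (_ : lei t = ind R `]-oo, t]%classic); last first.
  by apply/funext => v; rewrite /ind/lei mem_setE in_itv.
exact: measurable_ind.
Qed.

Lemma lei01 t v : 0 <= lei t v <= 1.
Proof. by rewrite /lei; case: (v <= t); rewrite ?lexx ler01. Qed.

Lemma below_lei (t : R) (x y : d.-tuple R) :
  (below t x y)%:R = lei t ((Num.sqrt d%:R)^-1 * dotp x y).
Proof. by []. Qed.

Lemma measurable_below (t : R) :
  measurable_fun [set: V * V] (fun z => (below t z.1 z.2)%:R : R).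
Proof.
apply: (measurableT_comp (measurable_lei t)); apply: measurable_funM => //.
exact: measurable_dotp2.
Qed.

Lemma measurable_belowr (t : R) (x : V) :
  measurable_fun [set: V] (fun y => (below t x y)%:R : R).
Proof. exact: (measurableT_comp (measurable_below t) (pair1_measurable x)). Qed.

(** For the vector x of a row, the conditional probability of an entry 1. *)
Definition cp (t : R) (x : V) : R := Ex G (fun y => (below t x y)%:R).

Lemma L1_below t x : L1 G (fun y => (below t x y)%:R).
Proof. by apply: L1_event; exact: measurable_belowr. Qed.

Lemma L1_below2 t : L1 (G \x G)%E (fun z => (below t z.1 z.2)%:R).
Proof. by apply: L1_event; exact: measurable_below. Qed.

Lemma L1_cp t : L1 G (cp t).
Proof. by have [] := Fubini12 (L1_below2 t) (L1_below t). Qed.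

Lemma Ex_cp t : Ex G (cp t) = fine ((G \x G)%E [set z | below t z.1 z.2]).
Proof.
have [_ <-] := Fubini12 (L1_below2 t) (L1_below t).
exact: Ex_event (measurable_below t).
Qed.

Lemma cp01 t x : 0 <= cp t x <= 1.
Proof.
rewrite Ex_ge0 => [|y]; last exact: ler0n.
rewrite -[leRHS](Ex_cst G) Ex_le//; first exact: L1_below.
  exact: L1_cst.
by move=> y; case: below.
Qed.

Lemma cp_stdn t x : cp t x =
  Ex N (fun z => lei t ((Num.sqrt d%:R)^-1 * (Num.sqrt (normsq x) * z))).
Proof.
pose f (v : RM) : R := lei t ((Num.sqrt d%:R)^-1 * v).
have mf : measurable_fun [set: RM] f.
  by apply: (measurableT_comp (measurable_lei t)); exact: measurable_funM.
exact: (same_law_Ex (gaussian_dotp x) mf).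
Qed.

Lemma Ex_lei (s : R) : Ex N (lei s) = Phi s.
Proof.
rewrite /Phi -Ex_ind//; apply: eq_Ex => z.
by rewrite /ind mem_setE in_itv.
Qed.

Hypothesis d0 : (0 < d)%N.

Lemma sqrtd_gt0 : 0 < Num.sqrt d%:R :> R.
Proof. by rewrite sqrtr_gt0 ltr0n. Qed.

Definition rad (x : V) : R := Num.sqrt (normsq x / d%:R).

(** Given x, the inner product is Gaussian with standard deviation the length of
    x, so that x enters through its length only. *)
Lemma cp_Phi t x : 0 < normsq x -> cp t x = Phi (t / rad x).
Proof.
move=> x0; rewrite cp_stdn -Ex_lei; apply: eq_Ex => z.
have r0 : 0 < rad x by rewrite sqrtr_gt0 divr_gt0// ltr0n.
rewrite /lei ler_pdivlMr// mulrA; congr ((nat_of_bool (_ <= _)%R)%:R).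
by rewrite mulrC /rad sqrtrM ?ltW// sqrtrV ?ler0n// (mulrC (Num.sqrt (normsq x))).
Qed.

Lemma rad_dev (x : V) : rad x ^+ 2 = dev x + kappa.
Proof. by rewrite sqr_sqrtr ?divr_ge0 ?normsq_ge0 ?ler0n// /dev subrK. Qed.

Lemma rad_ge0 (x : V) : 0 <= rad x. Proof. exact: sqrtr_ge0. Qed.

Let sk := Num.sqrt kappa.
Lemma sqrt_kappa_gt0 : 0 < Num.sqrt kappa.
Proof. by rewrite sqrtr_gt0 stdn_m2_gt0. Qed.
Let sk2 : sk ^+ 2 = kappa.
Proof. by rewrite sqr_sqrtr// ltW// stdn_m2_gt0. Qed.

Lemma rad_ge (x : V) : - (kappa / 2) <= dev x -> Num.sqrt kappa / 2 <= rad x.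
Proof.
move=> h; have k0 := stdn_m2_gt0 R; have s0 := sqrt_kappa_gt0.
have := rad_dev x; have := rad_ge0 x; rewrite -/sk in s0 *; have := sk2 => e r0 re.
rewrite leNgt; apply/negP => lt; nra.
Qed.

Lemma rad_le (x : V) : dev x <= kappa / 2 -> rad x <= 2 * Num.sqrt kappa.
Proof.
move=> h; have k0 := stdn_m2_gt0 R; have s0 := sqrt_kappa_gt0.
have := rad_dev x; have := rad_ge0 x; rewrite -/sk in s0 *; have := sk2 => e r0 re.
rewrite leNgt; apply/negP => lt; nra.
Qed.

Lemma normsq_gt0 (x : V) : - (kappa / 2) <= dev x -> 0 < normsq x.
Proof.
move=> h; have k0 := stdn_m2_gt0 R.
have : 0 < normsq x / d%:R by move: h; rewrite /dev; lra.
by rewrite pmulr_lgt0// invr_gt0 ltr0n.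
Qed.

(** For dev x >= - kappa / 2 the length is bounded below and Phi (t / rad x) is a
    Lipschitz function of dev x. For shorter vectors the term 2 / kappa makes the
    right-hand side at least 1. *)
Lemma cp_lipschitz t x :
  `|cp t x - Phi (t / Num.sqrt kappa)| <=
  (2 * `|t| / (kappa * Num.sqrt kappa) + 2 / kappa) * `|dev x|.
Proof.
have k0 := stdn_m2_gt0 R; have s0 := sqrt_kappa_gt0.
have [h|h] := leP (- (kappa / 2)) (dev x); last first.
  apply: (@le_trans _ _ 1).
    have /andP[a0 a1] := cp01 t x.
    have := Phi_ge0 (t / Num.sqrt kappa); have := Phi_le1 (t / Num.sqrt kappa).
    by rewrite ler_norml; lra.
  rewrite mulrDl -[leLHS]add0r lerD//.
    apply: mulr_ge0 => //; apply: divr_ge0; first by rewrite mulr_ge0.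
    by apply: mulr_ge0; exact: ltW.
  rewrite ltr0_norm; last lra.
  by rewrite mulrAC ler_pdivlMr//; lra.
rewrite cp_Phi; last exact: normsq_gt0.
apply: (le_trans (Phi_lipschitz _ _)).
have r0 : 0 < rad x by apply: (lt_le_trans _ (rad_ge h)); rewrite divr_gt0.
have re := rad_dev x; have rg := rad_ge h; have e := sk2.
rewrite -/sk in s0 rg *; set r := rad x in r0 re rg *.
have -> : t / r - t / sk = t * (sk - r) / (r * sk).
  by field; rewrite !gt_eqF.
have -> : sk - r = - dev x / (sk + r).
  rewrite (_ : dev x = r ^+ 2 - sk ^+ 2); last by rewrite re e; ring.
  by field; rewrite gt_eqF// addr_gt0.
rewrite !normrM normrN !normfV normrM (gtr0_norm r0) (gtr0_norm s0).
rewrite (gtr0_norm (addr_gt0 s0 r0)).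
apply: (@le_trans _ _ (2 * `|t| / (kappa * sk) * `|dev x|)); last first.
  by rewrite ler_wpM2r// lerDl divr_ge0// ltW.
have -> : `|t| * (`|dev x| / (sk + r)) / (r * sk) =
    (`|t| * `|dev x|) * (sk * r * (sk + r))^-1.
  by field; rewrite !gt_eqF// addr_gt0.
have -> : 2 * `|t| / (kappa * sk) * `|dev x| =
    (`|t| * `|dev x|) * (sk * (kappa / 2))^-1.
  by field; rewrite !gt_eqF.
rewrite ler_wpM2l ?mulr_ge0// lef_pV2 ?posrE ?mulr_gt0 ?divr_gt0 ?addr_gt0//.
by rewrite -mulrA ler_wpM2l ?ltW//; nra.
Qed.

(** The converse of cp_lipschitz on typical lengths: t / rad x stays in a bounded
    interval, where the normal density is bounded below, and it varies with
    rad x at a rate proportional to |t|. A threshold 0 would hide the length. *)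
Lemma cp_separation t T c1 (x x' : V) : `|t| <= T -> c1 <= `|t| ->
  `|dev x| <= kappa / 2 -> `|dev x'| <= kappa / 2 ->
  normal_pdf 0 1 (2 * T / Num.sqrt kappa) * c1 / (16 * kappa * Num.sqrt kappa)
    * `|dev x - dev x'| <= `|cp t x - cp t x'|.
Proof.
have k0 := stdn_m2_gt0 R; have s0 := sqrt_kappa_gt0.
move=> tT ct; wlog le : x x' / dev x <= dev x'.
  move=> H hx hx'; have [h|/ltW h] := leP (dev x) (dev x'); first exact: H.
  by rewrite distrC (distrC (cp t x)); exact: H.
rewrite !ler_norml => /andP[x1 x2] /andP[x1' x2'].
rewrite !cp_Phi; [|apply: normsq_gt0; lra..].
have rx := rad_ge (x := x); have rx' := rad_ge (x := x').
have {rx} /rx rg : - (kappa / 2) <= dev x by lra.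
have {rx'} /rx' rg' : - (kappa / 2) <= dev x' by lra.
have rl := rad_le x2; have rl' := rad_le x2'.
have re := rad_dev x; have re' := rad_dev x'; have e := sk2.
rewrite -/sk in s0 rg rg' rl rl' *.
set r := rad x in re rg rl *; set r' := rad x' in re' rg' rl' *.
have r0 : 0 < r by apply: (lt_le_trans _ rg); rewrite divr_gt0.
have r0' : 0 < r' by apply: (lt_le_trans _ rg'); rewrite divr_gt0.
have rr : r <= r'.
  by rewrite leNgt; apply/negP => lt; nra.
pose K := 2 * T / sk.
have bnd q : sk / 2 <= q -> `|t / q| <= K.
  move=> sq; have q0 : 0 < q by apply: (lt_le_trans _ sq); rewrite divr_gt0.
  rewrite normrM normfV (gtr0_norm q0) /K ler_pdivrMr// mulrAC ler_pdivlMr//.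
  by have := normr_ge0 t; nra.
have key a b : `|a| <= K -> `|b| <= K ->
    normal_pdf 0 1 K * `|a - b| <= `|Phi a - Phi b|.
  wlog ab : a b / a <= b.
    move=> H ha hb; have [h|/ltW h] := leP a b; first exact: H.
    by rewrite distrC (distrC (Phi a)); exact: H.
  rewrite !ler_norml => /andP[a1 a2] /andP[b1 b2].
  have := Phi_increment a1 ab b2; have /andP[h _] := Phi_le ab.
  by rewrite distrC (distrC (Phi a)) !ger0_norm ?subr_ge0.
apply: (le_trans _ (key _ _ (bnd _ rg) (bnd _ rg'))).
rewrite -/K (_ : _ * c1 / _ * _ = normal_pdf 0 1 K *
  (`|dev x - dev x'| * (c1 * (16 * (kappa * sk))^-1))); last first.
  by field; rewrite !gt_eqF.
rewrite ler_wpM2l ?normal_pdf_ge0//.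
have -> : t / r - t / r' = t * ((r' ^+ 2 - r ^+ 2) / (r * r' * (r + r'))).
  by field; rewrite !gt_eqF// addr_gt0.
have -> : r' ^+ 2 - r ^+ 2 = dev x' - dev x by rewrite re re'; ring.
rewrite (distrC (dev x)) normrM normrM [leRHS]mulrCA ler_wpM2l//.
have rrr : 0 < r * r' * (r + r') by rewrite !mulr_gt0// addr_gt0.
rewrite normfV (gtr0_norm rrr).
apply: (@le_trans _ _ (`|t| * (16 * (kappa * sk))^-1)).
  by rewrite ler_wpM2r// invr_ge0 !mulr_ge0// ltW.
rewrite ler_wpM2l// lef_pV2 ?posrE ?mulr_gt0 ?addr_gt0//.
have h1 : r * r' <= 4 * kappa.
  by rewrite -e; have := ler_pM (ltW r0) (ltW r0') rl rl'; lra.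
have h2 : r + r' <= 4 * sk by lra.
have := ler_pM (ltW (mulr_gt0 r0 r0')) (ltW (addr_gt0 r0 r0')) h1 h2.
by lra.
Qed.

End conditional_probability.

(** * The threshold tau *)

Section threshold.
Context (R : realType).
Local Notation RM := (measurableTypeR R).
Local Notation N := (@stdn R).
Local Notation kappa := (stdn_m2 R).

Lemma Phi_0 : Phi 0 = 2^-1 :> R.
Proof.
pose lo : set RM := `]-oo, 0%R[%classic; pose hi : set RM := `]0%R, +oo[%classic.
have Ilo : L1 N (ind R lo) by apply: L1_ind; exact: measurable_itv.
have Ihi : L1 N (ind R hi) by apply: L1_ind; exact: measurable_itv.
have I00 : L1 N (ind R [set 0 : RM]) by apply: L1_ind.
have L : same_law N (fun z : RM => - z : RM) N id by move=> f mf f0; exact: stdn_opp.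
have E1 : Ex N (ind R hi) = Ex N (ind R lo).
  have := same_law_Ex L (measurable_ind (measurable_itv `]-oo, 0%R[)).
  move=> /esym; rewrite (_ : ind R _ \o id = ind R lo)// => ->.
  by apply: eq_Ex => z; rewrite /ind /= !mem_setE !in_itv/= oppr_lt0 andbT.
have E2 : Ex N (ind R hi) + (Ex N (ind R lo) + Ex N (ind R [set 0 : RM])) = 1.
  rewrite -!ExD//; last exact: L1D.
  rewrite -[RHS](Ex_cst N); apply: eq_Ex => z.
  rewrite /ind !mem_setE !in_itv/= andbT.
  rewrite (_ : (z \in [set 0]) = (z == 0)); last by apply/idP/eqP; rewrite inE.
  by case: ltgtP => _; rewrite ?addr0 ?add0r.
have E3 : Phi 0 = Ex N (ind R lo) + Ex N (ind R [set 0 : RM]).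
  rewrite -Ex_lei -ExD//.
  apply: eq_Ex => z; rewrite /lei /ind !mem_setE !in_itv/=.
  rewrite (_ : (z \in [set 0]) = (z == 0)); last by apply/idP/eqP; rewrite inE.
  by case: ltgtP => _; rewrite ?addr0 ?add0r.
have E4 : Ex N (ind R [set 0 : RM]) = 0.
  by rewrite Ex_ind//; exact: (congr1 fine (stdn_set1 (0 : R))).
move: E2; rewrite E1 E3 E4 => E2; lra.
Qed.

(** The first coordinate alone is nonzero almost surely. *)
Lemma normsq_eq0_null d : (0 < d)%N -> Ex (gauss R d) (fun x => (normsq x == 0)%:R) = 0.
Proof.
case: d => // d _.
have m0 k : measurable_fun [set: k.-tuple RM] (fun x : k.-tuple RM => (normsq x == 0)%:R : R).
  rewrite (_ : (fun _ => _) = ind R [set 0 : RM] \o (fun x : k.-tuple RM => normsq x : RM)).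
    by apply: measurableT_comp; [exact: measurable_ind|exact: measurable_normsq].
  by apply/funext => x; rewrite /ind /=; congr ((nat_of_bool _)%:R); apply/eqP/idP; rewrite inE.
have I0 : L1 (N \x gauss R d)%E (fun z => (normsq (tcons z) == 0)%:R).
  apply: (L1_bounded _ (c := 1)).
    by apply: (measurableT_comp (m0 d.+1)); exact: measurable_tcons.
  by move=> y; rewrite normr_nat; case: (_ == _).
apply/eqP; rewrite eq_le; apply/andP; split; last by apply: Ex_ge0 => x; exact: ler0n.
rewrite Ex_iidS//.
have J0 := L1_prodM (L1_ind N (measurable_set1 (0 : RM))) (L1_cst (gauss R d) 1).
have : Ex (N \x gauss R d)%E (fun z => ind R [set 0 : RM] z.1 * 1) = 0.
  rewrite (Ex_prodM (g := fun=> 1))//; last exact: L1_cst; last exact: L1_ind.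
  by rewrite Ex_ind// (congr1 fine (stdn_set1 (0 : R))) mul0r.
move=> E0; rewrite -[leRHS]E0; apply: Ex_le => // -[z y] /=.
rewrite mulr1 /ind; case: eqP => [e|_]; last exact: ler0n.
suff z0 : [set 0 : RM] z by rewrite (mem_set z0).
move: e; rewrite /normsq (_ : dotp _ _ = z * z + dotp y y); last exact: dotp_cons.
move/eqP; rewrite -expr2 paddr_eq0 ?sqr_ge0 ?normsq_ge0// => /andP[/eqP + _].
by move/eqP; rewrite sqrf_eq0 => /eqP.
Qed.

Definition scaled_dotp d (z : d.-tuple RM * d.-tuple RM) : R :=
  (Num.sqrt d%:R)^-1 * dotp z.1 z.2.

Lemma measurable_scaled_dotp d : measurable_fun [set: _] (@scaled_dotp d).
Proof. by apply: measurable_funM => //; exact: measurable_dotp2. Qed.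

HB.instance Definition _ d := isMeasurableFun.Build _ _ _ _ (@scaled_dotp d)
  (@measurable_scaled_dotp d).

(** Given x != 0 the inner product with x is Gaussian, and x = 0 is negligible. *)
Lemma scaled_dotp_no_atom d (a : R) : (0 < d)%N ->
  ((gauss R d \x gauss R d) (scaled_dotp (d := d) @^-1` [set a]) = 0)%E.
Proof.
move=> d0; set G := gauss R d.
have mA := @measurable_scaled_dotp d.
have mA1 : measurable (scaled_dotp (d := d) @^-1` [set a]).
  by rewrite -[X in measurable X]setTI; apply: mA.
have m1 : measurable_fun [set: RM] (ind R [set a : RM]) by exact: measurable_ind.
pose GG : probability (d.-tuple RM * d.-tuple RM)%type R := (G \x G)%E.
have fP : GG (scaled_dotp (d := d) @^-1` [set a]) \is a fin_num by apply: fin_num_measure.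
apply/eqP; rewrite -(fine_eq0 fP).
apply/eqP; rewrite -(Ex_ind _ mA1).
have I2 : L1 (G \x G)%E (ind R (scaled_dotp (d := d) @^-1` [set a])) by exact: L1_ind.
have Ix x : L1 G (fun y => ind R (scaled_dotp (d := d) @^-1` [set a]) (x, y)).
  apply: (L1_bounded _ (c := 1)).
    by apply: (measurableT_comp (measurable_ind mA1)); exact: pair1_measurable.
  by move=> y; rewrite /ind normr_nat; case: (_ \in _).
have [I1 ->] := Fubini12 I2 Ix.
apply/eqP; rewrite eq_le; apply/andP; split; last first.
  by apply: Ex_ge0 => x; apply: Ex_ge0 => y; exact: ler0n.
have In : L1 G (fun x => (normsq x == 0)%:R).
  apply: (L1_bounded _ (c := 1)); last by move=> y; rewrite normr_nat; case: (_ == _).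
  rewrite (_ : (fun _ => _) = ind R [set 0 : RM] \o (fun x : d.-tuple RM => normsq x : RM)).
    by apply: measurableT_comp; [exact: measurable_ind|exact: measurable_normsq].
  by apply/funext => x; rewrite /ind /=; congr ((nat_of_bool _)%:R); apply/eqP/idP; rewrite inE.
rewrite -[leRHS](normsq_eq0_null d0); apply: Ex_le => // x.
have [x0|x0] := eqVneq (normsq x) 0.
  rewrite -[leRHS](Ex_cst G); apply: Ex_le => //; first exact: L1_cst.
  by move=> y; rewrite /ind; case: (_ \in _).
pose f (v : RM) : R := ind R [set a : RM] ((Num.sqrt d%:R)^-1 * v).
have mf : measurable_fun [set: RM] f.
  by apply: (measurableT_comp m1); exact: measurable_funM.
rewrite (eq_Ex _ (g := f \o (fun y : d.-tuple RM => dotp x y : RM))); last first.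
  by move=> y; rewrite /ind /f /=; congr ((nat_of_bool _)%:R); apply/idP/idP; rewrite !inE.
rewrite (same_law_Ex (gaussian_dotp x) mf).
have s0 := sqrtd_gt0 R d0.
have a0 : 0 < Num.sqrt (normsq x) by rewrite sqrtr_gt0 lt0r x0 normsq_ge0.
pose b := a * Num.sqrt d%:R / Num.sqrt (normsq x).
rewrite (eq_Ex _ (g := ind R [set b : RM])); last first.
  move=> z; rewrite /f /ind /=; congr ((nat_of_bool _)%:R).
  by apply/idP/idP; rewrite !inE /= /b; [move=> <-|move=> ->]; field; rewrite !gt_eqF.
by rewrite Ex_ind// (congr1 fine (stdn_set1 b)).
Qed.

(** The value p is taken at the supremum t of the points where the distribution
    function is below p: right continuity gives at least p at t, and left
    continuity, for lack of an atom, at most p. *)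
Lemma atomless_quantile d (T : measurableType d) (P : probability T R)
    (X : {RV P >-> R}) (p : R) : 0 < p -> p < 1 ->
  (forall a, P (X @^-1` [set a]) = 0%E) ->
  exists t, P (X @^-1` `]-oo, t]) = p%:E.
Proof.
move=> p0 p1 na.
pose F := cdf X.
pose A := [set a | (F a < p%:E)%E].
have [a Aa] : A !=set0.
  apply: contrapT => /forallNP nA.
  have : (p%:E <= lim (F @ -oo%R))%E.
    apply: lime_ge; first by apply/cvg_ex; exists 0%E; exact: cvg_cdfNy0.
    by apply: nearW => r; rewrite leNgt; apply/negP; exact: nA.
  rewrite (cvg_lim _ (cvg_cdfNy0 X))// lee_fin.
  by rewrite leNgt p0.
have [b Fb] : exists b, (p%:E <= F b)%E.
  apply: contrapT => /forallNP nA.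
  have : (lim (F @ +oo%R) <= p%:E)%E.
    apply: lime_le; first by apply/cvg_ex; exists 1%E; exact: cvg_cdfy1.
    by apply: nearW => r; rewrite leNgt; apply/negP => /ltW; exact: nA.
  rewrite (cvg_lim _ (cvg_cdfy1 X))// lee_fin.
  by rewrite leNgt p1.
have supA : has_sup A.
  split; first by exists a.
  exists b => c; rewrite /A/= => Fc; rewrite leNgt; apply/negP => bc.
  have := le_lt_trans (le_trans Fb (cdf_nondecreasing X (ltW bc))) Fc.
  by rewrite ltxx.
exists (sup A); set t := sup A; apply/eqP; rewrite eq_le; apply/andP; split.
  have -> : X @^-1` `]-oo, t] = X @^-1` `]-oo, t[ `|` X @^-1` [set t].
    by rewrite -preimage_setU setUitv1.
  have mlt : measurable (X @^-1` `]-oo, t[) by exact: measurable_funPTI.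
  have meq : measurable (X @^-1` [set t]) by exact: measurable_funPTI.
  apply: (le_trans (measureU2 _ mlt meq)).
  rewrite [X in (_ + X <= _)%E](_ : _ = 0%E) ?adde0; last exact: na.
  pose Fn n := X @^-1` `]-oo, t - n.+1%:R^-1].
  have mFn n : measurable (Fn n) by exact: measurable_funPTI.
  have -> : X @^-1` `]-oo, t[ = \bigcup_n Fn n.
    apply/seteqP; split => w /=; rewrite /Fn.
      rewrite in_itv/= => Xt.
      exists (Num.truncn (t - X w)^-1) => //=; rewrite in_itv/=.
      rewrite lerBrDr -lerBrDl invf_ple ?posrE ?subr_gt0//.
      by rewrite ltW// truncnS_gt.
    by move=> [n _] /=; rewrite !in_itv/= => /le_lt_trans; apply; rewrite gtrBl.
  have cv : (P \o Fn) @ \oo --> P (\bigcup_n Fn n).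
    apply: nondecreasing_cvg_mu => //; first exact: bigcup_measurable.
    move=> i j ij; apply/subsetPset; apply: preimage_subset; apply: subset_itvl.
    by rewrite bnd_simp lerD2l lerN2 lef_pV2 ?posrE// ler_nat.
  rewrite -[leLHS](cvg_lim (@ereal_hausdorff R) cv); apply: lime_le; first by apply/cvg_ex; eexists; exact: cv.
  apply: nearW => n /=.
  have n0 : 0 < n.+1%:R^-1 :> R by rewrite invr_gt0 ltr0n.
  have [c Ac tc] := sup_adherent n0 supA.
  exact: (le_trans (cdf_nondecreasing X (ltW tc)) (ltW Ac)).
have cv := @cdf_right_continuous _ _ _ P X t.
rewrite -[leRHS](cvg_lim (@ereal_hausdorff R) cv); apply: lime_ge; first by apply/cvg_ex; eexists; exact: cv.
near=> r; rewrite leNgt; apply/negP => Fr.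
have : r <= t by apply: ub_le_sup => //; exact: supA.2.
by rewrite leNgt => /negP; apply; near: r; exact: nbhs_right_gt.
Unshelve. all: by end_near.
Qed.

Lemma tau_spec d (p : R) : (0 < d)%N -> 0 < p -> p < 1 ->
  (gauss R d \x gauss R d)%E [set xy | below (tau d p) xy.1 xy.2] = p%:E.
Proof.
move=> d0 p0 p1.
pose GG : probability (d.-tuple RM * d.-tuple RM)%type R := (gauss R d \x gauss R d)%E.
pose X : {RV GG >-> R} := [the {mfun _ >-> _} of @scaled_dotp d].
have na a : GG (X @^-1` [set a]) = 0%E by exact: scaled_dotp_no_atom.
have [t tE] := atomless_quantile p0 p1 na.
have ex : exists t, [set t | (gauss R d \x gauss R d)%E [set xy | below t xy.1 xy.2] = p%:E] t.
  exists t => /=; rewrite -tE.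
  rewrite (_ : [set xy : d.-tuple RM * d.-tuple RM | _] = X @^-1` `]-oo, t])//.
exact: (xgetPex 0 ex).
Qed.

Lemma Ex_cp_tau d (p : R) : (0 < d)%N -> 0 < p -> p < 1 ->
  Ex (gauss R d) (cp (tau d p)) = p.
Proof. by move=> d0 p0 p1; rewrite Ex_cp tau_spec. Qed.

(** Chebyshev's inequality for the scaled inner product, whose second moment is
    kappa^2: the tail beyond tau has probability p or 1 - p. *)
Lemma tau_bounded d (p : R) : (0 < d)%N -> 0 < p -> p < 1 ->
  `|tau d p| <= 1 + kappa ^+ 2 * (p^-1 + (1 - p)^-1).
Proof.
move=> d0 p0 p1; set t := tau d p.
have Ep := Ex_cp_tau d0 p0 p1; rewrite -/t in Ep.
set G := gauss R d in Ep.
have dn0 : 0 < d%:R :> R by rewrite ltr0n.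
have sd2 : (Num.sqrt d%:R)^-1 ^+ 2 = d%:R^-1 :> R by rewrite exprVn sqr_sqrtr ?ler0n.
have [I4 E1 _ _] := dev_moments R d0.
have I1 : L1 G (dev (d := d)) by exact: (L1_pow4 (j := 1) isT (@measurable_dev R d) I4).
have IX x : L1 G (fun y => ((Num.sqrt d%:R)^-1 * dotp x y) ^+ 2).
  apply: (L1_ext (f := fun y : d.-tuple RM => d%:R^-1 * dotp x y ^+ 2)) => [y|].
    by rewrite exprMn sd2.
  by apply: L1Z; have [] := dotp_m2 x.
have EX x : Ex G (fun y => ((Num.sqrt d%:R)^-1 * dotp x y) ^+ 2) = kappa * (dev x + kappa).
  rewrite (eq_Ex _ (g := fun y : d.-tuple RM => d%:R^-1 * dotp x y ^+ 2)); last first.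
    by move=> y; rewrite exprMn sd2.
  have [I2 E2] := dotp_m2 x; rewrite ExZ// E2 /dev subrK.
  by field; rewrite gt_eqF.
have EXX : Ex G (fun x => kappa * (dev x + kappa)) = kappa ^+ 2.
  have Ik := L1_cst G kappa.
  by rewrite (ExZ kappa (L1D I1 Ik)) ExD// E1 Ex_cst add0r expr2.
have IXX : L1 G (fun x => kappa * (dev x + kappa)).
  by apply: L1Z; apply: L1D => //; exact: L1_cst.
have k2 : 0 <= kappa ^+ 2 by exact: sqr_ge0.
have q0 : 0 < 1 - p by rewrite subr_gt0.
have t1 : `|t| <= 1 + t ^+ 2.
  by rewrite -[t ^+ 2]real_normK ?num_real//; have := sqr_ge0 (`|t| - 1); nra.
apply: (le_trans t1); rewrite lerD2l mulrDr.
have [t0|t0] := leP 0 t.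
  suff h : (1 - p) * t ^+ 2 <= kappa ^+ 2.
    rewrite (@le_trans _ _ (kappa ^+ 2 / (1 - p)))//.
      by rewrite ler_pdivlMr// mulrC.
    by rewrite lerDr divr_ge0// ltW.
  rewrite -EXX -{1}Ep -{1}(Ex_cst G 1) -ExB; [|exact: L1_cst|exact: L1_cp].
  rewrite mulrC -ExZ; last by apply: L1B; [exact: L1_cst|exact: L1_cp].
  apply: Ex_le => //; first by apply: L1Z; apply: L1B; [exact: L1_cst|exact: L1_cp].
  move=> x; rewrite -EX -{1}(Ex_cst G 1) /cp -ExB; [|exact: L1_cst|exact: L1_below].
  rewrite -ExZ; last by apply: L1B; [exact: L1_cst|exact: L1_below].
  apply: Ex_le => //; first by apply: L1Z; apply: L1B; [exact: L1_cst|exact: L1_below].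
  move=> y; rewrite below_lei /lei; case: (leP ((Num.sqrt d%:R)^-1 * dotp x y) t) => h /=; rewrite ?mulr1n ?mulr0n.
    by rewrite subrr mulr0 sqr_ge0.
  by rewrite subr0 mulr1; nra.
suff h : p * t ^+ 2 <= kappa ^+ 2.
  rewrite (@le_trans _ _ (kappa ^+ 2 / p))//.
    by rewrite ler_pdivlMr// mulrC.
  by rewrite lerDl divr_ge0// ltW.
rewrite -EXX -{1}Ep mulrC -ExZ; last exact: L1_cp.
apply: Ex_le => //; first by apply: L1Z; exact: L1_cp.
move=> x; rewrite -EX /cp -ExZ; last exact: L1_below.
apply: Ex_le => //; first by apply: L1Z; exact: L1_below.
move=> y; rewrite below_lei /lei;
  case: (leP ((Num.sqrt d%:R)^-1 * dotp x y) t) => h /=; rewrite ?mulr1n ?mulr0n;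
  last by rewrite mulr0 sqr_ge0.
by rewrite mulr1; nra.
Qed.

(** The mean of cp (tau d p) is p, while every cp is within 2 |tau| / sqrt kappa
    of Phi 0 = 1/2 up to a term of mean O(1/d). So |p - 1/2| bounds |tau| below. *)
Lemma tau_away_from_0 (p : R) : 0 < p -> p < 1 -> p != 2^-1 ->
  exists (c : R) (d1 : nat), (0 < c) /\
    forall d, (0 < d)%N -> (d1 <= d)%N -> c <= `|tau d p|.
Proof.
move=> p0 p1 pn.
have k0 := stdn_m2_gt0 R; have s0 := sqrt_kappa_gt0 R.
pose D := `|p - 2^-1|.
have D0 : 0 < D by rewrite normr_gt0 subr_eq0.
pose v := Ex N (fun z => csq z ^+ 2).
have v0 : 0 < v := Ex_csq2_gt0 R.
pose B := 4 / kappa ^+ 2 * v.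
have B0 : 0 < B by rewrite mulr_gt0// divr_gt0// exprn_gt0.
exists (D * Num.sqrt kappa / 4), (Num.truncn (2 * B / D)).+1; split.
  by rewrite divr_gt0// mulr_gt0.
move=> d d0 dd; set t := tau d p; set G := gauss R d.
have Ep := Ex_cp_tau d0 p0 p1; rewrite -/t -/G in Ep.
have dn0 : 0 < d%:R :> R by rewrite ltr0n.
have [I4 E1 E2 _] := dev_moments R d0; rewrite -/G -/v in I4 E1 E2.
have I2 : L1 G (fun x => dev x ^+ 2) by exact: (L1_pow4 (j := 2) isT (@measurable_dev R d) I4).
have pt (x : d.-tuple RM) : `|cp t x - 2^-1| <= 2 * `|t| / Num.sqrt kappa + 4 / kappa ^+ 2 * dev x ^+ 2.
  have tk : 0 <= 2 * `|t| / Num.sqrt kappa by rewrite divr_ge0 ?mulr_ge0// ltW.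
  have [h|h] := leP (- (kappa / 2)) (dev x).
    apply: (@le_trans _ _ (2 * `|t| / Num.sqrt kappa)); last first.
      by rewrite lerDl mulr_ge0 ?sqr_ge0// divr_ge0 ?sqr_ge0.
    have x0 : 0 < normsq x by exact: (normsq_gt0 d0 h).
    rewrite cp_Phi//.
    rewrite -Phi_0; apply: (le_trans (Phi_lipschitz _ _)).
    have rg := rad_ge h.
    have r0 : 0 < rad x by apply: (lt_le_trans _ rg); rewrite divr_gt0.
    rewrite subr0 normrM normfV (gtr0_norm r0) ler_pdivrMr//.
    rewrite mulrAC ler_pdivlMr//.
    by have := normr_ge0 t; nra.
  apply: (@le_trans _ _ 1).
    by have /andP[a0 a1] := cp01 t x; rewrite ler_norml; lra.
  rewrite -[leLHS]add0r lerD// mulrAC ler_pdivlMr ?exprn_gt0//.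
  by nra.
have : D <= 2 * `|t| / Num.sqrt kappa + B / d%:R.
  have Icp := L1_cp d t; have -> : B / d%:R = Ex G (fun x => 4 / kappa ^+ 2 * dev x ^+ 2).
    by rewrite ExZ// E2 /B; field; rewrite !gt_eqF.
  have IB : L1 G (fun x => cp t x - 2^-1) by apply: L1B => //; exact: L1_cst.
  have -> : D = `|Ex G (fun x => cp t x - 2^-1)|.
    by rewrite ExB ?Ex_cst ?Ep//; exact: L1_cst.
  apply: (le_trans (Ex_norm IB)).
  rewrite -[X in X + _](Ex_cst G) -ExD; [|exact: L1_cst|exact: L1Z].
  apply: Ex_le => //; first exact: L1_norm.
  by apply: L1D; [exact: L1_cst|exact: L1Z].
have h : B / d%:R <= D / 2.
  rewrite ler_pdivrMr// mulrAC ler_pdivlMr// mulrC (mulrC D) -ler_pdivrMr//.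
  have := truncnS_gt (2 * B / D); rewrite -(ler_nat R) in dd.
  by move=> /ltW/le_trans; apply.
move=> h2; rewrite ler_pdivrMr// -ler_pdivlMr//.
have : D / 2 <= 2 * `|t| / Num.sqrt kappa by lra.
rewrite ler_pdivrMr// => h3.
by rewrite (le_trans h3)// le_eqVlt; apply/orP; left; apply/eqP; field; rewrite gt_eqF.
Qed.

End threshold.

(** * One row and two rows *)

Section row_statistics.
Context (R : realType).
Local Notation RM := (measurableTypeR R).
Local Notation N := (@stdn R).
Local Notation kappa := (stdn_m2 R).
Variable (p : R).
Hypotheses (p0 : 0 < p) (p1 : p < 1).

Definition cent d (x y : d.-tuple RM) : R := (below (tau d p) x y)%:R - p.

(** The conditional mean of a centred entry given the vector x of its row. It is
    this quantity, of order d^(-1/2) and due to the fluctuation of the length of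
    x, that correlates the entries of a row. *)
Definition gdev d (x : d.-tuple RM) : R := Ex (gauss R d) (cent x).

(** The conditional mixed moment of two centred entries of one column given the
    vectors of their rows; it measures the noise of the count. *)
Definition hcov d (x x' : d.-tuple RM) : R :=
  Ex (gauss R d) (fun y => cent x y * cent x' y).

Lemma cent_le1 d (x y : d.-tuple RM) : `|cent x y| <= 1.
Proof.
have h0 := p0; have h1 := p1.
by rewrite /cent; case: below => /=; rewrite ?mulr1n ?mulr0n ler_norml; apply/andP; split; lra.
Qed.

Lemma measurable_cent d :
  measurable_fun [set: _] (fun z : d.-tuple RM * d.-tuple RM => cent z.1 z.2).
Proof. by apply: measurable_funB => //; exact: measurable_below. Qed.

Lemma L1_cent d (x : d.-tuple RM) : L1 (gauss R d) (cent x).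
Proof. by apply: L1B; [exact: L1_below|exact: L1_cst]. Qed.

Lemma gdevE d (x : d.-tuple RM) : gdev x = cp (tau d p) x - p.
Proof. by rewrite /gdev /cent ExB ?Ex_cst//; [exact: L1_below|exact: L1_cst]. Qed.

Lemma gdev_le1 d (x : d.-tuple RM) : `|gdev x| <= 1.
Proof.
have /andP[a0 a1] := cp01 (tau d p) x; have h0 := p0; have h1 := p1.
by rewrite gdevE ler_norml; lra.
Qed.

Lemma measurable_gdev d : measurable_fun [set: d.-tuple RM] (@gdev d).
Proof.
rewrite (_ : @gdev d = fun x => cp (tau d p) x - p); last first.
  by apply/funext => x; exact: gdevE.
by apply: measurable_funB => //; exact: (L1_meas (L1_cp _ _)).
Qed.

Lemma cent2_le1 d (x x' y : d.-tuple RM) : `|cent x y * cent x' y| <= 1.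
Proof. by rewrite normrM mulr_ile1// cent_le1. Qed.

Lemma L1_cent2 d (x x' : d.-tuple RM) : L1 (gauss R d) (fun y => cent x y * cent x' y).
Proof.
apply: (L1_bounded _ (c := 1)); last by move=> y; exact: cent2_le1.
by apply: measurable_funM; exact: (L1_meas (L1_cent _)).
Qed.

Lemma hcov_le1 d (x x' : d.-tuple RM) : `|hcov x x'| <= 1.
Proof.
apply: (le_trans (Ex_norm (L1_cent2 x x'))).
rewrite -[leRHS](Ex_cst (gauss R d)); apply: Ex_le; first exact: L1_norm (L1_cent2 _ _).
  exact: L1_cst.
by move=> y; exact: cent2_le1.
Qed.

Lemma measurable_hcov d :
  measurable_fun [set: _] (fun z : d.-tuple RM * d.-tuple RM => hcov z.1 z.2).
Proof.
pose G := gauss R d; pose V := d.-tuple RM.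
pose f (z : (V * V) * V) := cent z.1.1 z.2 * cent z.1.2 z.2.
have mf : measurable_fun [set: (V * V) * V] f.
  have m1 : measurable_fun [set: (V * V) * V] (fun z => (z.1.1, z.2)).
    by apply: measurable_fun_pair => //; exact: measurableT_comp.
  have m2 : measurable_fun [set: (V * V) * V] (fun z => (z.1.2, z.2)).
    by apply: measurable_fun_pair => //; exact: measurableT_comp.
  apply: measurable_funM.
    exact: (measurableT_comp (@measurable_cent d) m1).
  exact: (measurableT_comp (@measurable_cent d) m2).
have If : L1 ((G \x G) \x G)%E f.
  by apply: (L1_bounded _ (c := 1)) => // z; exact: cent2_le1.
have [I _] := Fubini12 If (fun x => L1_cent2 x.1 x.2).
exact: (L1_meas I).
Qed.

Let T : R := 1 + kappa ^+ 2 * (p^-1 + (1 - p)^-1).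
Let A : R := 2 * T / (kappa * Num.sqrt kappa) + 2 / kappa.
Let v : R := Ex N (fun z => csq z ^+ 2).
Let k4 : R := Ex N (fun z => csq z ^+ 4).

Let k0 : 0 < kappa. Proof. exact: stdn_m2_gt0. Qed.
Let T0 : 0 <= T.
Proof.
rewrite /T addr_ge0// mulr_ge0 ?sqr_ge0// addr_ge0// invr_ge0 ?ltW// subr_gt0//.
Qed.
Let A0 : 0 <= A.
Proof.
rewrite /A addr_ge0//; last by rewrite divr_ge0// ltW.
by rewrite divr_ge0 ?mulr_ge0 ?sqrtr_ge0// ltW.
Qed.
Let k40 : 0 <= k4.
Proof. by apply: Ex_ge0 => x; rewrite exprn_even_ge0. Qed.

Section fixed_dimension.
Variable d : nat.
Hypothesis d0 : (0 < d)%N.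
Local Notation G := (gauss R d).
Local Notation V := (d.-tuple RM).
Let dn0 : 0 < d%:R :> R. Proof. by rewrite ltr0n. Qed.
Let c0 : R := Phi (tau d p / Num.sqrt kappa).

Lemma cp_tau_lipschitz (x : V) : `|cp (tau d p) x - c0| <= A * `|dev x|.
Proof.
apply: (le_trans (cp_lipschitz d0 (tau d p) x)); rewrite ler_wpM2r//.
rewrite lerD2r ler_pM2r ?invr_gt0 ?mulr_gt0 ?sqrtr_gt0//.
by rewrite ler_pM2l// tau_bounded.
Qed.

Lemma L1_dev j : (j <= 4)%N -> L1 G (fun x : V => dev x ^+ j).
Proof.
move=> j4; have [I4 _ _ _] := dev_moments R d0.
exact: (L1_pow4 j4 (@measurable_dev R d) I4).
Qed.

Lemma L1_devn : L1 G (fun x : V => `|dev x|).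
Proof. exact: (L1_norm (L1_dev (j := 1) isT)). Qed.

(** Both p and c0 approximate cp: p is its mean, c0 its value at the typical
    length. *)
Lemma center_gap : (p - c0) ^+ 2 <= A ^+ 2 * (v / d%:R).
Proof.
have [_ _ E2 _] := dev_moments R d0.
have Icp := @L1_cp R d (tau d p).
have IB : L1 G (fun x : V => cp (tau d p) x - c0) by apply: L1B => //; exact: L1_cst.
have h : `|p - c0| <= A * Ex G (fun x : V => `|dev x|).
  rewrite -{1}(Ex_cp_tau d0 p0 p1) -{1}(Ex_cst G c0) -ExB//; last exact: L1_cst.
  apply: (le_trans (Ex_norm IB)); rewrite -ExZ; last exact: L1_devn.
  apply: Ex_le; [exact: L1_norm|by apply: L1Z; exact: L1_devn|].
  exact: cp_tau_lipschitz.
have I2 : L1 G (fun x : V => `|dev x| ^+ 2).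
  apply: (L1_ext (f := fun x : V => dev x ^+ 2)) => [x|]; first by rewrite real_normK ?num_real.
  exact: L1_dev.
have h2 := Ex_sqr_ge L1_devn I2.
rewrite (eq_Ex _ (f := fun x : V => `|dev x| ^+ 2) (g := fun x : V => dev x ^+ 2)) in h2; last first.
  by move=> x; rewrite real_normK ?num_real.
rewrite E2 mulrC -/v in h2.
rewrite -[leLHS]real_normK ?num_real//.
apply: (@le_trans _ _ ((A * Ex G (fun x : V => `|dev x|)) ^+ 2)).
  by rewrite lerXn2r ?nnegrE ?mulr_ge0//; apply: Ex_ge0.
by rewrite exprMn ler_wpM2l// sqr_ge0.
Qed.

Lemma L1_gdev j : L1 G (fun x : V => gdev x ^+ j).
Proof.
apply: (L1_bounded _ (c := 1)); first by apply: measurable_funX; exact: measurable_gdev.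
by move=> x; rewrite normrX exprn_ile1// gdev_le1.
Qed.

Lemma gdev_sqr_le (x : V) : gdev x ^+ 2 <= 2 * A ^+ 2 * (dev x ^+ 2 + v / d%:R).
Proof.
have h1 := cp_tau_lipschitz x; have h2 := center_gap.
have h3 : (cp (tau d p) x - c0) ^+ 2 <= A ^+ 2 * dev x ^+ 2.
  rewrite -[leLHS]real_normK ?num_real// -[X in _ <= _ * X]real_normK ?num_real//.
  by rewrite -exprMn lerXn2r ?nnegrE ?mulr_ge0.
rewrite gdevE; move: (cp _ _) c0 h2 h3 => a c h2 h3.
have := sqr_ge0 (a - c + (p - c)); nra.
Qed.

Lemma Ex_gdev2_le : Ex G (fun x : V => gdev x ^+ 2) <= (4 * A ^+ 2 * v) / d%:R.
Proof.
have [_ _ E2 _] := dev_moments R d0.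
have I2 := L1_dev (j := 2) isT.
apply: (le_trans (Ex_le (L1_gdev 2) _ gdev_sqr_le)).
  by apply: L1Z; apply: L1D => //; exact: L1_cst.
rewrite ExZ; last by apply: L1D => //; exact: L1_cst.
rewrite ExD ?Ex_cst// ?E2 -?/v; last exact: L1_cst.
by rewrite le_eqVlt; apply/orP; left; apply/eqP; field; rewrite gt_eqF.
Qed.

Lemma Ex_gdev4_le : Ex G (fun x : V => gdev x ^+ 4) <=
  (8 * A ^+ 4 * (3 * k4 + v ^+ 2)) / d%:R ^+ 2.
Proof.
have [I4 _ _ E4] := dev_moments R d0; rewrite -/k4 in E4.
have pt (x : V) : gdev x ^+ 4 <= 8 * A ^+ 4 * (dev x ^+ 4 + (v / d%:R) ^+ 2).
  have h := gdev_sqr_le x; have g0 := sqr_ge0 (gdev x).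
  rewrite -[4%N]/(2 * 2)%N !exprM.
  set B := A ^+ 2; have B0 : 0 <= B by exact: sqr_ge0.
  rewrite -/B in h; move: (gdev x ^+ 2) (dev x ^+ 2) (v / d%:R) h g0 => a b c h g0.
  apply: (@le_trans _ _ ((2 * B * (b + c)) ^+ 2)).
    by rewrite lerXn2r ?nnegrE// (le_trans g0).
  have : 0 <= B ^+ 2 * (b - c) ^+ 2 by rewrite mulr_ge0 ?sqr_ge0.
  lra.
apply: (le_trans (Ex_le (L1_gdev 4) _ pt)).
  by apply: L1Z; apply: L1D => //; exact: L1_cst.
rewrite ExZ; last by apply: L1D => //; exact: L1_cst.
rewrite ExD ?Ex_cst//; last exact: L1_cst.
have -> : 8 * A ^+ 4 * (3 * k4 + v ^+ 2) / d%:R ^+ 2 =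
    8 * A ^+ 4 * (3 * k4 / d%:R ^+ 2 + (v / d%:R) ^+ 2) by field; rewrite gt_eqF.
rewrite ler_wpM2l ?lerD2r//.
by rewrite mulr_ge0// exprn_even_ge0.
Qed.

(** The difference of gdev at two independent rows bounds its second moment from
    below. When both deviations are at most kappa / 2, cp_separation bounds that
    difference by s |dev x - dev x'|. Otherwise (dev x - dev x')^2 is at most
    K (dev x^4 + dev x'^4), so that after subtracting the latter the lower bound
    holds everywhere, at the cost of a term of mean O(1/d^2). *)
Lemma Ex_gdev2_ge (c1 : R) : 0 < c1 -> c1 <= `|tau d p| ->
  (normal_pdf 0 1 (2 * T / Num.sqrt kappa) * c1 / (16 * kappa * Num.sqrt kappa)) ^+ 2 / 4 * (2 * v / d%:R - 96 / kappa ^+ 2 * k4 / d%:R ^+ 2) <=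
  Ex G (fun x : V => gdev x ^+ 2).
Proof.
move=> c10 ct; set s := (X in X ^+ 2 / 4 * _).
have s0 : 0 <= s.
  by rewrite /s divr_ge0 ?mulr_ge0 ?normal_pdf_ge0 ?sqrtr_ge0// ltW.
have [I4 E1 E2 E4] := dev_moments R d0; rewrite -/k4 in E4; rewrite -/v in E2.
have I1 := L1_dev (j := 1) isT; have I2 := L1_dev (j := 2) isT.
set K := 16 / kappa ^+ 2.
have K0 : 0 <= K by rewrite divr_ge0 ?sqr_ge0.
have pt (x x' : V) : s ^+ 2 * ((dev x - dev x') ^+ 2 - K * (dev x ^+ 4 + dev x' ^+ 4))
    <= 2 * gdev x ^+ 2 + 2 * gdev x' ^+ 2.
  have gg0 : 0 <= 2 * gdev x ^+ 2 + 2 * gdev x' ^+ 2.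
    by rewrite addr_ge0// mulr_ge0// sqr_ge0.
  have [/andP[h h']|] := boolP ((`|dev x| <= kappa / 2) && (`|dev x'| <= kappa / 2)).
    have := cp_separation d0 (tau_bounded d0 p0 p1) ct h h'.
    rewrite -/s => sep.
    apply: (@le_trans _ _ ((gdev x - gdev x') ^+ 2)); last first.
      have := sqr_ge0 (gdev x + gdev x'); nra.
    apply: (@le_trans _ _ ((s * `|dev x - dev x'|) ^+ 2)).
      rewrite [leRHS]exprMn real_normK ?num_real// ler_wpM2l ?sqr_ge0// lerBlDr lerDl.
      by rewrite mulr_ge0// addr_ge0// exprn_even_ge0.
    rewrite -[leRHS]real_normK ?num_real// lerXn2r ?nnegrE ?(mulr_ge0 s0 (normr_ge0 _))//.
    suff -> : gdev x - gdev x' = cp (tau d p) x - cp (tau d p) x' by [].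
    by rewrite !gdevE; ring.
  move=> far; apply: le_trans gg0.
  rewrite mulr_ge0_le0 ?sqr_ge0// subr_le0.
  have big : kappa ^+ 2 / 4 <= dev x ^+ 2 + dev x' ^+ 2.
    have aux (y : R) : kappa / 2 < `|y| -> kappa ^+ 2 / 4 <= y ^+ 2.
      by move=> hy; have hk := k0; rewrite -[y ^+ 2]real_normK ?num_real//; nra.
    move: far; rewrite negb_and -!ltNge => /orP[/aux|/aux] h.
      by have := sqr_ge0 (dev x'); lra.
    by have := sqr_ge0 (dev x); lra.
  rewrite /K mulrAC ler_pdivlMr ?exprn_gt0//.
  have -> : dev x ^+ 4 = (dev x ^+ 2) ^+ 2 by rewrite -exprM.
  have -> : dev x' ^+ 4 = (dev x' ^+ 2) ^+ 2 by rewrite -exprM.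
  have h : (dev x - dev x') ^+ 2 <= 2 * (dev x ^+ 2 + dev x' ^+ 2).
    by have := sqr_ge0 (dev x + dev x'); nra.
  have a0 := sqr_ge0 (dev x); have b0 := sqr_ge0 (dev x').
  move: ((dev x - dev x') ^+ 2) (dev x ^+ 2) (dev x' ^+ 2) (kappa ^+ 2) (sqr_ge0 kappa) h a0 b0 big.
  move=> D a b k hk h a0 b0 big.
  apply: (@le_trans _ _ (2 * (a + b) * (4 * (a + b)))).
    apply: (@le_trans _ _ (2 * (a + b) * k)); first by rewrite ler_wpM2r.
    by rewrite ler_wpM2l ?mulr_ge0 ?addr_ge0//; lra.
  by have := sqr_ge0 (a - b); nra.
set g2 := Ex G (fun x : V => gdev x ^+ 2).
have I1' : L1 G (dev (d := d)) by exact: I1.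
have inner (x : V) : s ^+ 2 * (dev x ^+ 2 + v / d%:R - K * (dev x ^+ 4 + 3 * k4 / d%:R ^+ 2))
    <= 2 * gdev x ^+ 2 + 2 * g2.
  have := Ex_le _ _ (pt x); move=> /(_ G).
  have IL1 : L1 G (fun x' : V => (dev x ^+ 2 + (dev x' ^+ 2 - 2 * dev x * dev x')) -
     (K * dev x ^+ 4 + K * dev x' ^+ 4)).
    apply: L1B; first by apply: L1D; [exact: L1_cst|apply: L1B => //; exact: L1Z].
    by apply: L1D; [exact: L1_cst|exact: L1Z].
  have IL : L1 G (fun x' : V => s ^+ 2 * ((dev x - dev x') ^+ 2 - K * (dev x ^+ 4 + dev x' ^+ 4))).
    apply: L1Z; apply: L1_ext IL1 => x'; ring.
  have IR : L1 G (fun x' : V => 2 * gdev x ^+ 2 + 2 * gdev x' ^+ 2).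
    by apply: L1D; [exact: L1_cst|apply: L1Z; exact: L1_gdev].
  move=> /(_ IL IR).
  have -> : Ex G (fun x' : V => 2 * gdev x ^+ 2 + 2 * gdev x' ^+ 2) = 2 * gdev x ^+ 2 + 2 * g2.
    rewrite ExD ?Ex_cst ?ExZ//; [exact: L1_gdev|exact: L1_cst|].
    by apply: L1Z; exact: L1_gdev.
  apply: le_trans.
  rewrite ExZ; last by apply: L1_ext IL1 => x'; ring.
  rewrite ler_wpM2l ?sqr_ge0//.
  rewrite (eq_Ex _ (g := fun x' : V => (dev x ^+ 2 + (dev x' ^+ 2 - 2 * dev x * dev x')) -
     (K * dev x ^+ 4 + K * dev x' ^+ 4))); last by move=> x'; ring.
  have J1 : L1 G (fun x' : V => 2 * dev x * dev x') by exact: L1Z.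
  have J2 := L1B I2 J1.
  have J3 := L1D (L1_cst G (dev x ^+ 2)) J2.
  have J4 := L1D (L1_cst G (K * dev x ^+ 4)) (L1Z K I4).
  rewrite (ExB J3 J4) (ExD (L1_cst G (dev x ^+ 2)) J2) (ExB I2 J1).
  rewrite (ExD (L1_cst G (K * dev x ^+ 4)) (L1Z K I4)) (ExZ K I4) (ExZ _ I1') !Ex_cst E1 E2.
  by have := ler_wpM2l K0 E4; rewrite (mulrC v); lra.
have JR : L1 G (fun x : V => 2 * gdev x ^+ 2 + 2 * g2).
  by apply: L1D; [apply: L1Z; exact: L1_gdev|exact: L1_cst].
pose c2 := v / d%:R - K * (3 * k4 / d%:R ^+ 2).
have JL : L1 G (fun x : V => (dev x ^+ 2 - K * dev x ^+ 4) + c2).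
  by apply: L1D; [apply: L1B => //; exact: L1Z|exact: L1_cst].
have := Ex_le (L1Z (s ^+ 2) JL) JR.
have pt2 (x : V) : s ^+ 2 * ((dev x ^+ 2 - K * dev x ^+ 4) + c2) <= 2 * gdev x ^+ 2 + 2 * g2.
  apply: le_trans (inner x); rewrite le_eqVlt; apply/orP; left; apply/eqP.
  by rewrite /c2; ring.
move=> /(_ pt2).
rewrite (ExZ _ JL) (ExD (L1B I2 (L1Z K I4)) (L1_cst G c2)) (ExB I2 (L1Z K I4)).
rewrite (ExZ K I4) Ex_cst E2 (ExD (L1Z 2 (L1_gdev 2)) (L1_cst G (2 * g2))).
rewrite (ExZ 2 (L1_gdev 2)) Ex_cst -/g2.
have := ler_wpM2l (mulr_ge0 (sqr_ge0 s) K0) E4.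
rewrite /c2 /K (mulrC d%:R^-1).
have -> : 2 * v / d%:R = 2 * (v / d%:R) by rewrite mulrA.
move: (v / d%:R) => vd; lra.
Qed.

(** In the triangular coordinates of the pair (x, x') the second entry has, given
    the first variable z, the probability Phi ((t sqrt d - b z) / c). Replacing
    b z by 0 costs at most |b| / c |z|; what is left is the product of gdev x with
    a number in [- 1, 1]. *)
Lemma hcov_triangular (x x' : V) :
  exists b c, [/\ b ^+ 2 * normsq x = dotp x x' ^+ 2, b ^+ 2 + c ^+ 2 = normsq x', 0 <= c &
  0 < c -> `|hcov x x'| <= `|gdev x| + `|b| / c * Ex N (fun z => `|z|)].
Proof.
have [a [b [c [a0 c00 [aE abE bcE] L]]]] := gaussian_pair x x'.
exists b, c; split=> //; first by rewrite /normsq -aE mulrC -exprMn abE.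
move=> cp0; pose t := tau d p; pose sd := Num.sqrt d%:R : R.
have sd0 : 0 < sd by rewrite sqrtr_gt0.
pose W (u : RM) : R := lei t (sd^-1 * u) - p.
have mW : measurable_fun [set: RM] W.
  apply: measurable_funB => //; apply: (measurableT_comp (measurable_lei t)).
  exact: measurable_funM.
have W1 u : `|W u| <= 1.
  have h0 := p0; have h1 := p1; have /andP[h2 h3] := lei01 t (sd^-1 * u).
  by rewrite /W ler_norml; apply/andP; split; lra.
have mWW : measurable_fun [set: RM * RM] (fun z => W z.1 * W z.2).
  by apply: measurable_funM; exact: (measurableT_comp mW).
have mab : measurable_fun [set: RM] (fun z : RM => a * z : RM) by exact: measurable_funM.
have IW (f : RM -> RM) : measurable_fun [set: RM] f -> L1 N (fun z => W (f z)).
  by move=> mf; apply: (L1_bounded _ (c := 1)) => //; exact: (measurableT_comp mW).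
have gE : gdev x = Ex N (fun z => W (a * z)).
  rewrite gdevE cp_stdn (_ : Num.sqrt (normsq x) = a); last first.
    by rewrite /normsq -aE sqrtr_sqr ger0_norm.
  have m1 : measurable_fun [set: RM] (fun z : RM => lei t (sd^-1 * (a * z))).
    by apply: (measurableT_comp (measurable_lei t)); exact: measurable_funM.
  rewrite -{2}(Ex_cst N p) -ExB//; last exact: L1_cst.
  apply: (L1_bounded _ (c := 1)) => // z.
  by have /andP[h2 h3] := lei01 t (sd^-1 * (a * z)); rewrite ger0_norm.
have Pn (z : RM) : Ex N (fun z2 => W (b * z + c * z2)) = Phi ((t * sd - b * z) / c) - p.
  have m1 : measurable_fun [set: RM] (lei ((t * sd - b * z) / c) : RM -> R).
    exact: measurable_lei.
  rewrite -Ex_lei -[X in _ - X](Ex_cst N) -ExB; last exact: L1_cst.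
    apply: eq_Ex => z2; rewrite /W /lei; congr ((nat_of_bool _)%:R - _).
    rewrite ler_pdivlMr// mulrC ler_pdivrMr// (mulrC z2).
    by apply/idP/idP => h; lra.
  apply: (L1_bounded _ (c := 1)) => // u.
  by have /andP[h2 h3] := lei01 ((t * sd - b * z) / c) u; rewrite ger0_norm.
have mlp : measurable_fun [set: RM * RM] (fun z : RM * RM => b * z.1 + c * z.2 : RM).
  exact: measurable_lin2.
have I2 : L1 (N \x N)%E (fun z => W (a * z.1) * W (b * z.1 + c * z.2)).
  apply: (L1_bounded _ (c := 1)).
    apply: measurable_funM; last exact: (measurableT_comp mW).
    by apply: (measurableT_comp mW); exact: measurable_funM.
  by move=> z; rewrite normrM mulr_ile1.
have I2x (z : RM) : L1 N (fun z2 => W (a * z) * W (b * z + c * z2)).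
  apply: L1Z; apply: IW; apply: measurable_funD => //; exact: measurable_funM.
have [I1 E1] := Fubini12 I2 I2x.
have IE (z : RM) : Ex N (fun z2 => W (a * z) * W (b * z + c * z2)) =
    W (a * z) * (Phi ((t * sd - b * z) / c) - p).
  by rewrite ExZ ?Pn//; apply: IW; apply: measurable_funD => //; exact: measurable_funM.
have hE : hcov x x' = Ex N (fun z => W (a * z) * (Phi ((t * sd - b * z) / c) - p)).
  rewrite -(eq_Ex _ IE) -E1.
  exact: (same_law_Ex L mWW).
set q := Phi (t * sd / c) - p.
have IJ : L1 N (fun z : RM => W (a * z) * (Phi ((t * sd - b * z) / c) - p)).
  exact: (L1_ext IE I1).
have IK : L1 N (fun z : RM => q * W (a * z)) by apply: L1Z; exact: IW.
have q1 : `|q| <= 1.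
  have := Phi_ge0 (t * sd / c); have := Phi_le1 (t * sd / c).
  have h0 := p0; have h1 := p1; rewrite /q => h2 h3.
  by rewrite ler_norml; apply/andP; split; lra.
have -> : hcov x x' = (hcov x x' - q * gdev x) + q * gdev x by rewrite subrK.
apply: (le_trans (ler_normD _ _)); rewrite addrC; apply: lerD.
  by rewrite normrM -[leRHS]mul1r ler_wpM2r.
have In : L1 N (fun z : RM => `|z|) by exact: (L1_norm (@L1_stdn_pow R 1 isT)).
rewrite hE gE -(ExZ q (IW _ mab)) -ExB// -ExZ//.
apply: (le_trans (Ex_norm (L1B IJ IK))); apply: Ex_le.
- exact: (L1_norm (L1B IJ IK)).
- exact: L1Z.
move=> z; rewrite (_ : _ - _ =
    W (a * z) * (Phi ((t * sd - b * z) / c) - Phi (t * sd / c))); last by rewrite /q; ring.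
rewrite normrM -[leRHS]mul1r ler_pM//.
apply: (le_trans (Phi_lipschitz _ _)).
rewrite (_ : _ - _ = - (b / c * z)); last by field; rewrite gt_eqF.
by rewrite normrN normrM normrM normfV (gtr0_norm cp0).
Qed.

(** If one of the two vectors is short, or if their inner product is so large that
    b^2 >= d kappa / 4, the right-hand side is at least 1. Otherwise c^2 is at least
    d kappa / 4, and hcov_triangular applies. *)
Lemma hcov_sqr_le (x x' : V) : hcov x x' ^+ 2 <= 2 * gdev x ^+ 2 +
  4 / kappa ^+ 2 * (dev x ^+ 2 + dev x' ^+ 2) +
  (8 / kappa ^+ 2 + 16 / kappa) * (dotp x x' ^+ 2 / d%:R ^+ 2).
Proof.
have hk := k0; have k2 : 0 < kappa ^+ 2 by rewrite exprn_gt0.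
have h1 : hcov x x' ^+ 2 <= 1.
  by rewrite -[leLHS]real_normK ?num_real// exprn_ile1// hcov_le1.
set D := dotp x x' ^+ 2 / d%:R ^+ 2.
have D0 : 0 <= D by rewrite divr_ge0 ?sqr_ge0.
set t1 := 2 * gdev x ^+ 2; have t10 : 0 <= t1 by rewrite mulr_ge0 ?sqr_ge0.
set t2 := 4 / kappa ^+ 2 * _.
have t20 : 0 <= t2 by rewrite mulr_ge0 ?addr_ge0 ?sqr_ge0// divr_ge0// ltW.
have e1 : 0 <= 8 / kappa ^+ 2 * D by rewrite mulr_ge0// divr_ge0// ltW.
have e2 : 0 <= 16 / kappa * D by rewrite mulr_ge0// divr_ge0// ltW.
rewrite (mulrDl (8 / _)).
have far (y y' : V) : dev y < - (kappa / 2) ->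
    1 <= 4 / kappa ^+ 2 * (dev y ^+ 2 + dev y' ^+ 2).
  move=> h; rewrite mulrAC ler_pdivlMr//.
  by have := sqr_ge0 (dev y'); nra.
have [h|h] := leP (- (kappa / 2)) (dev x); last first.
  by have := far x x' h; rewrite -/t2; lra.
have [h'|h'] := leP (- (kappa / 2)) (dev x'); last first.
  by have := far x' x h'; rewrite (addrC (dev x' ^+ 2)) -/t2; lra.
have [b [c [bE bcE c00 hb]]] := hcov_triangular x x'.
have nE (y : V) : normsq y = d%:R * (dev y + kappa).
  by rewrite /dev subrK; field; rewrite gt_eqF.
have dE : dotp x x' ^+ 2 = d%:R ^+ 2 * D by rewrite /D; field; rewrite gt_eqF.
have bD : b ^+ 2 * (kappa / 2) <= d%:R * D.
  have : b ^+ 2 * (dev x + kappa) = d%:R * D.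
    have dnz : d%:R != 0 :> R by rewrite gt_eqF.
    apply: (mulfI dnz); rewrite mulrCA -nE bE dE; ring.
  move=> <-; rewrite ler_wpM2l ?sqr_ge0//; lra.
have [big|small] := leP (d%:R * kappa / 4) (b ^+ 2).
  have : 1 <= 8 / kappa ^+ 2 * D.
    rewrite mulrAC ler_pdivlMr// mul1r.
    have : d%:R * kappa / 4 * (kappa / 2) <= d%:R * D.
      by apply: le_trans bD; rewrite ler_wpM2r//; lra.
    rewrite (_ : _ / 4 * _ = d%:R * (kappa ^+ 2 / 8)); last by field.
    by rewrite ler_pM2l//; lra.
  by lra.
have c2 : d%:R * kappa / 4 <= c ^+ 2.
  have : d%:R * (kappa / 2) <= b ^+ 2 + c ^+ 2.
    by rewrite bcE nE ler_wpM2l//; lra.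
  by lra.
have dk : 0 < d%:R * kappa / 4 by rewrite divr_gt0// mulr_gt0.
have cp0 : 0 < c.
  rewrite lt0r c00 andbT -sqrf_eq0 gt_eqF//; exact: lt_le_trans c2.
have M2 : Ex N (fun z => `|z|) ^+ 2 <= kappa.
  have In : L1 N (fun z : RM => `|z|) by exact: (L1_norm (@L1_stdn_pow R 1 isT)).
  have In2 : L1 N (fun z : RM => `|z| ^+ 2).
    apply: (L1_ext (f := fun z : RM => z ^+ 2)) => [z|]; first by rewrite real_normK ?num_real.
    exact: (@L1_stdn_pow R 2 isT).
  apply: (le_trans (Ex_sqr_ge In In2)); rewrite le_eqVlt; apply/orP; left; apply/eqP.
  by apply: eq_Ex => z; rewrite real_normK ?num_real.
have rat : (`|b| / c) ^+ 2 <= 8 / kappa ^+ 2 * D.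
  rewrite expr_div_n real_normK ?num_real// ler_pdivrMr ?exprn_gt0//.
  apply: (@le_trans _ _ (8 / kappa ^+ 2 * D * (d%:R * kappa / 4))); last by rewrite ler_wpM2l.
  rewrite (_ : _ * (_ / 4) = d%:R * D * (2 / kappa)); last by field; rewrite gt_eqF.
  rewrite mulrA ler_pdivlMr//; lra.
have := hb cp0.
set M := Ex N _ in M2 *; set r := `|b| / c in rat *; set g := `|gdev x|.
move=> hle.
have M0 : 0 <= M by apply: Ex_ge0 => z.
have r0 : 0 <= r by rewrite divr_ge0.
have g0 : 0 <= g by exact: normr_ge0.
have gE : gdev x ^+ 2 = g ^+ 2 by rewrite real_normK ?num_real.
have rM : (r * M) ^+ 2 <= 8 / kappa * D.
  rewrite exprMn (_ : 8 / kappa * D = 8 / kappa ^+ 2 * D * kappa); last by field; rewrite gt_eqF.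
  by rewrite ler_pM ?sqr_ge0.
have hh : hcov x x' ^+ 2 <= (g + r * M) ^+ 2.
  rewrite -[leLHS]real_normK ?num_real// lerXn2r ?nnegrE//.
  by rewrite addr_ge0// mulr_ge0.
have : (g + r * M) ^+ 2 <= t1 + 16 / kappa * D.
  rewrite /t1 gE (_ : 16 / kappa * D = 2 * (8 / kappa * D)); last by field; rewrite gt_eqF.
  have := sqr_ge0 (g - r * M); move: (r * M) rM => rm; lra.
by lra.
Qed.

Lemma L1_hcov (x : V) : L1 G (fun x' => hcov x x' ^+ 2).
Proof.
apply: (L1_bounded _ (c := 1)).
  apply: measurable_funX.
  exact: (measurableT_comp (@measurable_hcov d) (pair1_measurable x)).
by move=> x'; rewrite normrX exprn_ile1// hcov_le1.
Qed.

(** The inner product of two independent rows has mean square d kappa^2, against the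
    normalisation d^2. *)
Lemma Ex_hcov2_le : Ex G (fun x => Ex G (fun x' => hcov x x' ^+ 2)) <=
  (8 * A ^+ 2 * v + 8 / kappa ^+ 2 * v + (8 / kappa ^+ 2 + 16 / kappa) * kappa ^+ 2) / d%:R.
Proof.
have [_ E1 E2 _] := dev_moments R d0; rewrite -/v in E2.
have I1 := L1_dev (j := 1) isT; have I2 := L1_dev (j := 2) isT.
have hk := k0; have k2 : 0 < kappa ^+ 2 by rewrite exprn_gt0.
set B := 8 / kappa ^+ 2 + 16 / kappa.
have B0 : 0 <= B by rewrite addr_ge0// divr_ge0// ltW.
set C := 4 / kappa ^+ 2.
pose r (x : V) := 2 * gdev x ^+ 2 + C * dev x ^+ 2 +
   B * kappa / d%:R * dev x + (C * v / d%:R + B * kappa ^+ 2 / d%:R).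
have inner (x : V) : Ex G (fun x' => hcov x x' ^+ 2) <= r x.
  have [J2 F2] := dotp_m2 x.
  have K1 : L1 G (fun x' : V => C * dev x' ^+ 2) by exact: L1Z.
  have K2 : L1 G (fun x' : V => B / d%:R ^+ 2 * dotp x x' ^+ 2) by exact: L1Z.
  have K3 := L1D (L1_cst G (2 * gdev x ^+ 2 + C * dev x ^+ 2)) K1.
  apply: (@le_trans _ _ (Ex G (fun x' : V => (2 * gdev x ^+ 2 + C * dev x ^+ 2) +
     C * dev x' ^+ 2 + B / d%:R ^+ 2 * dotp x x' ^+ 2))).
    apply: Ex_le; [exact: L1_hcov|exact: (L1D K3 K2)|move=> x'].
    apply: (le_trans (hcov_sqr_le x x')); rewrite -/B -/C.
    by rewrite le_eqVlt; apply/orP; left; apply/eqP; field; rewrite gt_eqF.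
  rewrite (ExD K3 K2) (ExD (L1_cst G _) K1) Ex_cst (ExZ C I2) (ExZ _ J2) F2 E2.
  have -> : normsq x = d%:R * (dev x + kappa) by rewrite /dev subrK; field; rewrite gt_eqF.
  rewrite /r le_eqVlt; apply/orP; left; apply/eqP; field; rewrite gt_eqF//.
have I2h : L1 (G \x G)%E (fun z => hcov z.1 z.2 ^+ 2).
  apply: (L1_bounded _ (c := 1)); first by apply: measurable_funX; exact: measurable_hcov.
  by move=> x'; rewrite normrX exprn_ile1// hcov_le1.
have [Io _] := Fubini12 I2h L1_hcov.
have H1 := L1Z 2 (L1_gdev 2); have H2 := L1Z C I2.
have I1' : L1 G (dev (d := d)) by exact: I1.
have H3 := L1Z (B * kappa / d%:R) I1'.
have H4 := L1_cst G (C * v / d%:R + B * kappa ^+ 2 / d%:R).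
apply: (le_trans (Ex_le Io (L1D (L1D (L1D H1 H2) H3) H4) inner)).
rewrite (ExD (L1D (L1D H1 H2) H3) H4) (ExD (L1D H1 H2) H3) (ExD H1 H2).
rewrite (ExZ 2 (L1_gdev 2)) (ExZ C I2) (ExZ _ I1') Ex_cst E1 E2 mulr0 addr0.
have := Ex_gdev2_le.
have -> : (8 * A ^+ 2 * v + 8 / kappa ^+ 2 * v + B * kappa ^+ 2) / d%:R =
  2 * (4 * A ^+ 2 * v / d%:R) + (C * (d%:R^-1 * v) + (C * v / d%:R + B * kappa ^+ 2 / d%:R)).
  by rewrite /C; field; rewrite !gt_eqF.
by lra.
Qed.

End fixed_dimension.

(** All that the counting argument uses of the geometry. The lower bound is the
    signal, and it is where p != 1/2 enters. *)
Lemma row_estimates : p != 2^-1 -> exists (C c : R) (d1 : nat),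
  [/\ 0 < C, 0 < c & forall d, (0 < d)%N -> (d1 <= d)%N ->
   let G := gauss R d in
   [/\ Ex G (fun x : d.-tuple RM => gdev x ^+ 4) <= C / d%:R ^+ 2,
    Ex G (fun x : d.-tuple RM => gdev x ^+ 2) <= C / d%:R,
    c / d%:R <= Ex G (fun x : d.-tuple RM => gdev x ^+ 2) &
    Ex G (fun x : d.-tuple RM => Ex G (fun x' => hcov x x' ^+ 2)) <= C / d%:R]].
Proof.
move=> pn; have [c1 [d1 [c10 tc]]] := tau_away_from_0 p0 p1 pn.
set s := normal_pdf 0 1 (2 * T / Num.sqrt kappa) * c1 / (16 * kappa * Num.sqrt kappa).
have hk := k0; have k2 : 0 < kappa ^+ 2 by rewrite exprn_gt0.
have s0 : 0 < s.
  by rewrite divr_gt0 ?mulr_gt0 ?normal_pdf_gt0 ?sqrtr_gt0.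
have v0 : 0 < v by exact: Ex_csq2_gt0.
pose C1 := 8 * A ^+ 4 * (3 * k4 + v ^+ 2).
pose C2 := 4 * A ^+ 2 * v.
pose C3 := 8 * A ^+ 2 * v + 8 / kappa ^+ 2 * v + (8 / kappa ^+ 2 + 16 / kappa) * kappa ^+ 2.
have C10 : 0 <= C1.
  rewrite /C1 mulr_ge0//; last by rewrite addr_ge0 ?sqr_ge0// mulr_ge0.
  by rewrite mulr_ge0// exprn_even_ge0.
have C20 : 0 <= C2 by rewrite /C2 !mulr_ge0 ?sqr_ge0// ltW.
have C30 : 0 <= C3.
  have vn := ltW v0; have kn := ltW k2; have kn1 := ltW hk.
  rewrite /C3; apply: addr_ge0; first apply: addr_ge0.
  - by apply: mulr_ge0 => //; apply: mulr_ge0 => //; exact: sqr_ge0.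
  - by apply: mulr_ge0 => //; exact: divr_ge0.
  - by apply: mulr_ge0 => //; apply: addr_ge0; exact: divr_ge0.
exists (C1 + C2 + C3 + 1), (s ^+ 2 / 4 * v).
pose B := 96 / kappa ^+ 2 * k4.
have B0 : 0 <= B by rewrite /B mulr_ge0// divr_ge0// ltW.
(* For d > B / v the correction of order 1/d^2 in Ex_gdev2_ge is at most half of
   the main term. *)
exists (maxn d1 (Num.truncn (B / v)).+1); split.
- by lra.
- by apply: mulr_gt0 => //; apply: divr_gt0 => //; exact: exprn_gt0.
move=> d d0; rewrite geq_max => /andP[dd1 dB] /=.
have dn0 : 0 < d%:R :> R by rewrite ltr0n.
split.
- apply: (le_trans (Ex_gdev4_le d0)); rewrite ler_pM2r ?invr_gt0 ?exprn_gt0// -/C1; lra.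
- apply: (le_trans (Ex_gdev2_le d0)); rewrite ler_pM2r ?invr_gt0// -/C2; lra.
- apply: le_trans (Ex_gdev2_ge d0 c10 (tc _ d0 dd1)); rewrite -/s -/B.
  rewrite -(mulrA (s ^+ 2 / 4) v) ler_wpM2l ?divr_ge0 ?sqr_ge0//.
  have : B / d%:R ^+ 2 <= v / d%:R.
    rewrite ler_pdivrMr ?exprn_gt0// (_ : v / d%:R * d%:R ^+ 2 = v * d%:R); last first.
      by field; rewrite gt_eqF.
    rewrite mulrC -ler_pdivrMr//.
    have := truncnS_gt (B / v); rewrite -(ler_nat R) in dB.
    by move=> /ltW/le_trans; apply.
  have -> : 2 * v / d%:R = 2 * (v / d%:R) by rewrite mulrA.
  by lra.
- apply: (le_trans (Ex_hcov2_le d0)); rewrite ler_pM2r ?invr_gt0// -/C3; lra.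
Qed.

End row_statistics.

(** * Statistics of order 2 of independent variables *)

Section averages.
Context (R : realType).
Implicit Types (S T : finType).

Definition avg T (mu f : T -> R) : R := \sum_x mu x * f x.

Lemma eq_avg T (mu f g : T -> R) : f =1 g -> avg mu f = avg mu g.
Proof. by move=> fg; apply: eq_bigr => x _; rewrite fg. Qed.

Lemma avgD T (mu f g : T -> R) : avg mu (fun x => f x + g x) = avg mu f + avg mu g.
Proof. by rewrite /avg -big_split; apply: eq_bigr => x _; rewrite mulrDr. Qed.

Lemma avgZ T (mu f : T -> R) c : avg mu (fun x => c * f x) = c * avg mu f.
Proof. by rewrite /avg mulr_sumr; apply: eq_bigr => x _; rewrite mulrCA. Qed.

Lemma avgZr T (mu f : T -> R) c : avg mu (fun x => f x * c) = avg mu f * c.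
Proof. by rewrite /avg mulr_suml; apply: eq_bigr => x _; rewrite mulrA. Qed.

Lemma avg_cst T (mu : T -> R) c : \sum_x mu x = 1 -> avg mu (fun=> c) = c.
Proof. by move=> h; rewrite /avg -mulr_suml h mul1r. Qed.

Lemma avg_sum T (I : Type) (s : seq I) (P : pred I) (mu : T -> R) (F : I -> T -> R) :
  avg mu (fun x => \sum_(i <- s | P i) F i x) = \sum_(i <- s | P i) avg mu (F i).
Proof.
rewrite /avg exchange_big; apply: eq_bigr => x _.
by rewrite mulr_sumr.
Qed.

Lemma avg_exchange S T (mu : S -> R) (nu : T -> R) (F : S -> T -> R) :
  avg mu (fun x => avg nu (F x)) = avg nu (fun y => avg mu (F ^~ y)).
Proof.
rewrite /avg; under eq_bigr do rewrite mulr_sumr.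
rewrite exchange_big; apply: eq_bigr => y _.
by rewrite mulr_sumr; apply: eq_bigr => x _; rewrite mulrCA.
Qed.

Lemma ler_avg T (mu f g : T -> R) : (forall x, 0 <= mu x) ->
  (forall x, f x <= g x) -> avg mu f <= avg mu g.
Proof. by move=> m0 fg; apply: ler_sum => x _; rewrite ler_wpM2l. Qed.

Lemma prob_sqr_le T (mu f : T -> R) (E : pred T) (s : R) : (forall x, 0 <= mu x) ->
  0 < s -> (forall x, E x -> s ^+ 2 <= f x) -> (forall x, 0 <= f x) ->
  prob mu E <= avg mu f / s ^+ 2.
Proof.
move=> m0 s0 Ef f0; rewrite ler_pdivlMr ?exprn_gt0// /prob mulr_suml.
rewrite /avg [leRHS](bigID E) /=.
apply: (@le_trans _ _ (\sum_(x | E x) mu x * f x)).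
  by apply: ler_sum => x Ex; rewrite ler_wpM2l// Ef.
by rewrite lerDl sumr_ge0// => x _; rewrite mulr_ge0.
Qed.

End averages.

Section ustatistics.
Context (R : realType) (C : finType) (nu : C -> R).
Hypothesis nu1 : \sum_c nu c = 1.
Notation E := (avg nu).

Definition tlaw m (t : m.-tuple C) : R := \prod_(k < m) nu (tnth t k).
Notation Em m := (avg (@tlaw m)).

Lemma avg_tlawS m (f : m.+1.-tuple C -> R) :
  Em m.+1 f = E (fun c => Em m (fun t => f [tuple of c :: t])).
Proof.
rewrite /avg; under [RHS]eq_bigr do rewrite mulr_sumr.
rewrite pair_big /=.
rewrite (reindex (fun x : C * m.-tuple C => [tuple of x.1 :: x.2])) /=; last first.
  exists (fun t : m.+1.-tuple C => (thead t, [tuple of behead t])) => [[c t]|t] _ /=.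
    by congr (_, _); exact: val_inj.
  by rewrite -tuple_eta.
apply: eq_bigr => -[c t] _ /=; rewrite mulrA /tlaw big_ord_recl tnth0.
by congr (_ * _ * _); apply: eq_bigr => k _; rewrite tnthS.
Qed.

Lemma avg_tlaw0 (f : 0.-tuple C -> R) : Em 0 f = f [tuple].
Proof.
rewrite /avg (big_pred1 [tuple]) => [|t]; last by rewrite [t]tuple0 /= eqxx.
by rewrite /tlaw big_ord0 mul1r.
Qed.

Lemma tlaw1 m : \sum_(t : m.-tuple C) tlaw t = 1.
Proof.
have -> : \sum_(t : m.-tuple C) tlaw t = Em m (fun=> 1).
  by apply: eq_bigr => t _; rewrite mulr1.
elim: m => [|m IH]; first by rewrite avg_tlaw0.
by rewrite avg_tlawS -[RHS](avg_cst 1 nu1); apply: eq_avg => c.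
Qed.

Lemma Em_cst m c : Em m (fun=> c) = c.
Proof. by apply: avg_cst; exact: tlaw1. Qed.

Definition tsum m (f : C -> R) (t : m.-tuple C) : R := \sum_(k < m) f (tnth t k).

Lemma tsum_cons m f c (t : m.-tuple C) : tsum f [tuple of c :: t] = f c + tsum f t.
Proof.
rewrite /tsum big_ord_recl tnth0; congr (_ + _).
by apply: eq_bigr => k _; rewrite tnthS.
Qed.

Lemma tsum0 f (t : 0.-tuple C) : tsum f t = 0. Proof. by rewrite /tsum big_ord0. Qed.

Lemma Em_tsum m f : Em m (tsum f) = m%:R * E f.
Proof.
elim: m => [|m IH]; first by rewrite avg_tlaw0 tsum0 mul0r.
rewrite avg_tlawS (eq_avg _ (g := fun c => f c + Em m (tsum f))); last first.
  move=> c; rewrite (eq_avg _ (fun t => tsum_cons f c t)) avgD Em_cst//.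
by rewrite avgD avg_cst// IH -(natr1 m) mulrDl mul1r addrC.
Qed.

Lemma Em_tsum2 m f g : Em m (fun t => tsum f t * tsum g t) =
  m%:R * E (fun c => f c * g c) + m%:R * (m%:R - 1) * (E f * E g).
Proof.
elim: m => [|m IH]; first by rewrite avg_tlaw0 tsum0 !mul0r addr0.
rewrite avg_tlawS (eq_avg _ (g := fun c => f c * g c + (f c * (m%:R * E g) +
   (g c * (m%:R * E f) + Em m (fun t => tsum f t * tsum g t))))); last first.
  move=> c; rewrite (eq_avg _ (g := fun t : m.-tuple C => f c * g c + (f c * tsum g t +
    (g c * tsum f t + tsum f t * tsum g t)))); last first.
    by move=> t; rewrite !tsum_cons; ring.
  by rewrite !avgD !avgZ !Em_tsum Em_cst.
by rewrite !avgD !avgZr avg_cst// IH -(natr1 m); ring.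
Qed.

Variable K : C -> C -> R.
Hypothesis K_sym : forall c c', K c c' = K c' c.

Definition ustat m (t : m.-tuple C) : R :=
  \sum_(k < m) \sum_(l < m | (k < l)%N) K (tnth t k) (tnth t l).

Lemma ustat_cons m c (t : m.-tuple C) : ustat [tuple of c :: t] = tsum (K c) t + ustat t.
Proof.
rewrite /ustat big_ord_recl; congr (_ + _).
  rewrite big_mkcond big_ord_recl /= add0r tnth0 /tsum.
  by apply: eq_bigr => k _; rewrite tnthS.
apply: eq_bigr => k _; rewrite [LHS]big_mkcond [RHS]big_mkcond big_ord_recl /= add0r.
by apply: eq_bigr => l _; rewrite !tnthS.
Qed.

Lemma ustat0 (t : 0.-tuple C) : ustat t = 0. Proof. by rewrite /ustat big_ord0. Qed.

Definition proj c : R := E (K c).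
Definition kmean : R := E proj.
Definition kmean2 : R := E (fun c => E (fun c' => K c c' ^+ 2)).

Lemma Em_ustat m : Em m (@ustat m) = m%:R * (m%:R - 1) / 2 * kmean.
Proof.
elim: m => [|m IH]; first by rewrite avg_tlaw0 ustat0 !mul0r.
rewrite avg_tlawS (eq_avg _ (g := fun c => m%:R * proj c + Em m (@ustat m))); last first.
  by move=> c; rewrite (eq_avg _ (fun t => ustat_cons c t)) avgD Em_tsum.
by rewrite avgD avgZ avg_cst// IH -/kmean -(natr1 m); field.
Qed.

Lemma avg_Kr c' : E (fun c => K c c') = proj c'.
Proof. by apply: eq_avg => c; rewrite K_sym. Qed.

Lemma Em_ustat_tsum m : Em m (fun t => ustat t * tsum proj t) =
  m%:R * (m%:R - 1) * E (fun c => proj c ^+ 2) +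
  m%:R * (m%:R - 1) * (m%:R - 2) / 2 * kmean ^+ 2.
Proof.
elim: m => [|m IH]; first by rewrite avg_tlaw0 ustat0 !mul0r addr0.
rewrite avg_tlawS.
rewrite (eq_avg _ (g := fun c => m%:R * proj c ^+ 2 +
   ((m%:R * E (fun c' => K c c' * proj c') + m%:R * (m%:R - 1) * (proj c * kmean)) +
   (proj c * Em m (@ustat m) + Em m (fun t => ustat t * tsum proj t))))); last first.
  move=> c; rewrite (eq_avg _ (g := fun t : m.-tuple C => proj c * tsum (K c) t +
    (tsum (K c) t * tsum proj t + (proj c * ustat t + ustat t * tsum proj t)))); last first.
    by move=> t; rewrite ustat_cons tsum_cons; ring.
  rewrite !avgD !avgZ Em_tsum Em_tsum2 -/kmean -[E (K c)]/(proj c).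
  by congr (_ + _); ring.
rewrite !avgD !avgZ !avgZr avg_cst// IH Em_ustat.
have -> : E (fun c => E (fun c' => K c c' * proj c')) = E (fun c => proj c ^+ 2).
  by rewrite avg_exchange; apply: eq_avg => c'; rewrite avgZr avg_Kr expr2.
by rewrite -/kmean -(natr1 m); field.
Qed.

(** Adding one variable c to the list t adds the sum of K c over t, whose joint
    moments with the statistic of t are those of Em_tsum2 and Em_ustat_tsum. The
    three terms correspond to pairs of pairs that share two, one or no variable. *)
Lemma Em_ustat2 m : Em m (fun t => ustat t ^+ 2) =
  m%:R * (m%:R - 1) / 2 * kmean2 +
  m%:R * (m%:R - 1) * (m%:R - 2) * E (fun c => proj c ^+ 2) +
  m%:R * (m%:R - 1) * (m%:R - 2) * (m%:R - 3) / 4 * kmean ^+ 2.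
Proof.
elim: m => [|m IH]; first by rewrite avg_tlaw0 ustat0 expr0n /= !mul0r !addr0.
rewrite avg_tlawS.
rewrite (eq_avg _ (g := fun c => (m%:R * E (fun c' => K c c' ^+ 2) +
   m%:R * (m%:R - 1) * proj c ^+ 2) + (2 * Em m (fun t => ustat t * tsum (K c) t) +
   Em m (fun t => ustat t ^+ 2)))); last first.
  move=> c; rewrite (eq_avg _ (g := fun t : m.-tuple C => tsum (K c) t * tsum (K c) t +
    (2 * (ustat t * tsum (K c) t) + ustat t ^+ 2))); last first.
    by move=> t; rewrite ustat_cons; ring.
  rewrite !avgD !avgZ Em_tsum2 -[E (K c)]/(proj c) -expr2.
  by congr (_ * _ + _ + _); apply: eq_avg => c'; rewrite expr2.
rewrite !avgD !avgZ avg_cst// IH -/kmean2.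
have -> : E (fun c => Em m (fun t => ustat t * tsum (K c) t)) =
    Em m (fun t => ustat t * tsum proj t).
  rewrite avg_exchange; apply: eq_avg => t; rewrite avgZ; congr (_ * _).
  by rewrite avg_sum; apply: eq_bigr => k _; rewrite avg_Kr.
by rewrite Em_ustat_tsum -(natr1 m); field.
Qed.

Hypothesis nu0 : forall c, 0 <= nu c.

(** The coefficient of kmean^2 in the second moment is at most the square of the
    one in the mean, so the terms without a shared variable are absorbed by the
    squared bias. *)
Lemma ustat_second_moment m (s : R) :
  Em m (fun t => (ustat t - s) ^+ 2) <=
  (m%:R * (m%:R - 1) / 2 * kmean - s) ^+ 2 +
  m%:R ^+ 3 * E (fun c => proj c ^+ 2) + m%:R ^+ 2 * kmean2.
Proof.
rewrite (eq_avg _ (g := fun t : m.-tuple C => ustat t ^+ 2 + ((- 2 * s) * ustat t + s ^+ 2))); last first.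
  by move=> t; ring.
rewrite !avgD avgZ Em_cst Em_ustat2 Em_ustat.
have p0 : 0 <= E (fun c => proj c ^+ 2).
  by apply: sumr_ge0 => c _; rewrite mulr_ge0// sqr_ge0.
have k0 : 0 <= kmean2.
  apply: sumr_ge0 => c _; rewrite mulr_ge0//.
  by apply: sumr_ge0 => c' _; rewrite mulr_ge0// sqr_ge0.
have t0 := sqr_ge0 kmean.
have h4 : m%:R * (m%:R - 1) * (m%:R - 2) * (m%:R - 3) / 4 <= (m%:R * (m%:R - 1) / 2) ^+ 2 :> R.
  case: m => [|[|m']]; first by rewrite !mul0r expr0n.
    by rewrite subrr mulr0 !mul0r expr0n.
  have : 0 <= m'%:R :> R by [].
  rewrite -(natr1 m'.+1) -(natr1 m'); move: (m'%:R : R) => x x0.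
  have : 0 <= (x + 2) * (x + 1) * (4 * x + 6 - 4) by rewrite !mulr_ge0//; lra.
  by nra.
have h2 : m%:R * (m%:R - 1) / 2 <= m%:R ^+ 2 :> R.
  by have := ler0n R m; have := sqr_ge0 (m%:R : R); lra.
have mm : 0 <= m%:R * (m%:R - 1) :> R.
  by clear h2 h4; case: m => [|m']; [rewrite mul0r|rewrite mulr_ge0// subr_ge0 ler1n].
have h3 : m%:R * (m%:R - 1) * (m%:R - 2) <= m%:R ^+ 3 :> R.
  have := ler0n R m; move: (m%:R : R) mm => x mm x0; nra.
have := ler_wpM2r k0 h2; have := ler_wpM2r p0 h3; have := ler_wpM2r t0 h4.
move: (m%:R * (m%:R - 1) * (m%:R - 2) * (m%:R - 3) / 4 * kmean ^+ 2) => a4.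
move: (m%:R * (m%:R - 1) * (m%:R - 2) * E _) (m%:R * (m%:R - 1) / 2 * kmean2) => a3 a2.
move: (m%:R * (m%:R - 1) / 2) => y.
by lra.
Qed.

End ustatistics.

(** * Masked random matrices as lists of independent columns *)

Section independent_coordinates.
Context (R : realType) (I Z : finType) (zeta : Z -> R).
Hypothesis zeta1 : \sum_z zeta z = 1.

Definition plaw (x : {ffun I -> Z}) : R := \prod_i zeta (x i).

Lemma avg_plaw_prod (G : I -> Z -> R) :
  avg plaw (fun x : {ffun I -> Z} => \prod_i G i (x i)) = \prod_i avg zeta (G i).
Proof.
rewrite /avg bigA_distr_bigA; apply: eq_bigr => x _.
by rewrite /plaw -big_split.
Qed.

Lemma avg_plaw1 i (f : Z -> R) : avg plaw (fun x : {ffun I -> Z} => f (x i)) = avg zeta f.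
Proof.
pose G j z := if j == i then f z else 1.
rewrite (eq_avg _ (g := fun x : {ffun I -> Z} => \prod_j G j (x j))); last first.
  by move=> x; rewrite (bigD1 i)//= {1}/G eqxx big1 ?mulr1// => j /negbTE; rewrite /G => ->.
rewrite avg_plaw_prod (bigD1 i)//= [X in _ * X]big1 ?mulr1; last first.
  by move=> j /negbTE ji; rewrite (eq_avg _ (g := fun=> 1)) ?avg_cst// => z; rewrite /G ji.
by apply: eq_avg => z; rewrite /G eqxx.
Qed.

Lemma avg_plaw2 i j (f g : Z -> R) : i != j ->
  avg plaw (fun x : {ffun I -> Z} => f (x i) * g (x j)) = avg zeta f * avg zeta g.
Proof.
move=> ij.
pose G k z := if k == i then f z else if k == j then g z else 1.
have ji : (j == i) = false by rewrite eq_sym (negbTE ij).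
rewrite (eq_avg _ (g := fun x : {ffun I -> Z} => \prod_k G k (x k))); last first.
  move=> x; rewrite (bigD1 i)//= (bigD1 j)//=; last by rewrite eq_sym.
  rewrite /G eqxx ji eqxx big1 ?mulr1// => k /andP[/negbTE -> /negbTE ->] //.
rewrite avg_plaw_prod (bigD1 i)//= (bigD1 j)//=; last by rewrite eq_sym.
rewrite [X in _ * (_ * X)]big1 ?mulr1; last first.
  move=> k /andP[/negbTE ki /negbTE kj].
  by rewrite (eq_avg _ (g := fun=> 1)) ?avg_cst// => z; rewrite /G ki kj.
by congr (_ * _); apply: eq_avg => z; rewrite /G ?eqxx ?ji ?eqxx.
Qed.

Lemma plaw1 : \sum_x plaw x = 1.
Proof.
transitivity (avg plaw (fun x : {ffun I -> Z} => \prod_i (fun (_ : I) (_ : Z) => 1) i (x i))).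
  by apply: eq_bigr => x _; rewrite big1 ?mulr1.
by rewrite (avg_plaw_prod (fun _ _ => 1)) big1// => i _; rewrite avg_cst.
Qed.

End independent_coordinates.

Section column.
Context (R : realType) (n : nat) (Z : finType) (zeta : Z -> R) (f : Z -> bool -> R).
Context (p q Q : R) (pi : {ffun 'I_n -> bool} -> R).
Hypotheses (zeta1 : \sum_z zeta z = 1) (zeta0 : forall z, 0 <= zeta z).
Hypotheses (pi1 : \sum_w pi w = 1) (pi0 : forall w, 0 <= pi w).
Hypothesis f_mean : forall b : bool, avg zeta (f ^~ b) = q * (b%:R - p).
Hypothesis f_sqr : forall b : bool, avg zeta (fun z => f z b ^+ 2) <= Q.
Hypothesis Q0 : 0 <= Q.

(** A column consists of a binary column w with an arbitrary law pi, from the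
    geometric or the independent model, and of independent noise at each entry,
    which holds the mask and the replacement of the masked entry. *)
Definition coltype : finType := ({ffun 'I_n -> Z} * {ffun 'I_n -> bool})%type.
Definition collaw (c : coltype) : R := plaw zeta c.1 * pi c.2.
Definition colentry (i : 'I_n) (c : coltype) : R := f (c.1 i) (c.2 i).
Definition colker (c c' : coltype) : R := \sum_i colentry i c * colentry i c'.

Notation E := (avg collaw).

Lemma avg_collaw (F : coltype -> R) :
  E F = avg pi (fun w => avg (plaw zeta) (fun x => F (x, w))).
Proof.
rewrite avg_exchange /avg; under [RHS]eq_bigr do rewrite mulr_sumr.
rewrite pair_big; apply: eq_bigr => -[x w] _.
by rewrite /collaw /= mulrA.
Qed.

Lemma collaw1 : \sum_c collaw c = 1.
Proof.
transitivity (E (fun=> 1)); first by apply: eq_bigr => c _; rewrite mulr1.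
rewrite avg_collaw -[RHS](avg_cst 1 pi1); apply: eq_avg => w.
by rewrite avg_cst// plaw1.
Qed.

Lemma collaw_ge0 c : 0 <= collaw c.
Proof. by rewrite mulr_ge0// prodr_ge0. Qed.

Definition colmean i : R := avg pi (fun w => (w i)%:R - p).
Definition colcov i j : R := avg pi (fun w => ((w i)%:R - p) * ((w j)%:R - p)).

Lemma avg_colentry i : E (colentry i) = q * colmean i.
Proof.
rewrite avg_collaw /colmean -avgZ; apply: eq_avg => w.
by rewrite -f_mean; exact: (avg_plaw1 zeta1 i (f ^~ (w i))).
Qed.

Lemma avg_colentry2 i j : i != j ->
  E (fun c => colentry i c * colentry j c) = q ^+ 2 * colcov i j.
Proof.
move=> ij; rewrite avg_collaw /colcov -avgZ; apply: eq_avg => w.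
rewrite (avg_plaw2 zeta1 (f ^~ (w i)) (f ^~ (w j)) ij) !f_mean; ring.
Qed.

Lemma avg_colentry_sqr i : 0 <= E (fun c => colentry i c * colentry i c) <= Q.
Proof.
apply/andP; split.
  by apply: sumr_ge0 => c _; rewrite mulr_ge0 ?collaw_ge0// -expr2 sqr_ge0.
rewrite avg_collaw -[leRHS](avg_cst Q pi1); apply: ler_avg => // w.
apply: le_trans (f_sqr (w i)).
rewrite -(avg_plaw1 zeta1 i (fun z => f z (w i) ^+ 2)).
by rewrite le_eqVlt; apply/orP; left; apply/eqP; apply: eq_avg => x; rewrite expr2.
Qed.

Lemma colker_sym c c' : colker c c' = colker c' c.
Proof. by apply: eq_bigr => i _; rewrite mulrC. Qed.

Lemma colker_proj c : proj collaw colker c = \sum_i colentry i c * (q * colmean i).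
Proof.
rewrite /proj avg_sum; apply: eq_bigr => i _.
by rewrite avgZ avg_colentry.
Qed.

Lemma colker_kmean : kmean collaw colker = q ^+ 2 * \sum_i colmean i ^+ 2.
Proof.
rewrite /kmean (eq_avg _ colker_proj) avg_sum mulr_sumr; apply: eq_bigr => i _.
by rewrite avgZr avg_colentry; ring.
Qed.

Lemma colker_proj2 : E (fun c => proj collaw colker c ^+ 2) <=
  q ^+ 2 * (Q * \sum_i colmean i ^+ 2 +
   q ^+ 2 * \sum_i \sum_(j | j != i) colmean i * colmean j * colcov i j).
Proof.
rewrite (eq_avg _ (g := fun c => \sum_i \sum_j
  (q ^+ 2 * (colmean i * colmean j)) * (colentry i c * colentry j c))); last first.
  move=> c; rewrite colker_proj expr2 mulr_suml; apply: eq_bigr => i _.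
  by rewrite mulr_sumr; apply: eq_bigr => j _; ring.
rewrite avg_sum !mulr_sumr -big_split mulr_sumr; apply: ler_sum => i _.
rewrite avg_sum (bigD1 i)//= avgZ.
rewrite [X in _ <= X](_ : _ = q ^+ 2 * (colmean i ^+ 2 * Q) +
  \sum_(j | j != i) q ^+ 2 * (colmean i * colmean j) * (q ^+ 2 * colcov i j)); last first.
  rewrite mulrDr (mulrC Q) mulr_sumr mulr_sumr; congr (_ + _).
  by apply: eq_bigr => j _; ring.
apply: lerD.
  rewrite -mulrA ler_wpM2l ?sqr_ge0// -expr2 ler_wpM2l ?sqr_ge0//.
  by have /andP[] := avg_colentry_sqr i.
by apply: ler_sum => j ji; rewrite avgZ avg_colentry2// eq_sym.
Qed.

(** The square of the kernel is a sum over pairs of rows (i, j) of products of a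
    function of c and the same function of c', so its mean is a sum of squares. *)
Lemma colker_kmean2 : kmean2 collaw colker <=
  n%:R * Q ^+ 2 + q ^+ 4 * \sum_i \sum_(j | j != i) colcov i j ^+ 2.
Proof.
rewrite /kmean2.
pose H i j := E (fun c => colentry i c * colentry j c).
have -> : E (fun c => E (fun c' => colker c c' ^+ 2)) = \sum_i \sum_j H i j ^+ 2.
  rewrite (eq_avg _ (g := fun c => \sum_i \sum_j (colentry i c * colentry j c) * H i j)).
    rewrite avg_sum; apply: eq_bigr => i _; rewrite avg_sum; apply: eq_bigr => j _.
    by rewrite avgZr expr2.
  move=> c; rewrite (eq_avg _ (g := fun c' => \sum_i \sum_j
     (colentry i c * colentry j c) * (colentry i c' * colentry j c'))).
    rewrite avg_sum; apply: eq_bigr => i _; rewrite avg_sum; apply: eq_bigr => j _.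
    by rewrite avgZ.
  move=> c'; rewrite expr2 mulr_suml; apply: eq_bigr => i _.
  by rewrite mulr_sumr; apply: eq_bigr => j _; ring.
rewrite (_ : n%:R * Q ^+ 2 = \sum_(i < n) Q ^+ 2); last first.
  by rewrite sumr_const card_ord mulr_natl.
rewrite mulr_sumr -big_split; apply: ler_sum => i _.
rewrite (bigD1 i)//=; apply: lerD.
  by have /andP[h1 h2] := avg_colentry_sqr i; rewrite lerXn2r ?nnegrE.
rewrite mulr_sumr; apply: ler_sum => j ji.
rewrite /H avg_colentry2 1?eq_sym// exprMn -exprM.
by [].
Qed.

Lemma column_second_moment m (s : R) :
  avg (@tlaw R coltype collaw m) (fun t => (ustat colker t - s) ^+ 2) <=
  (m%:R * (m%:R - 1) / 2 * (q ^+ 2 * \sum_i colmean i ^+ 2) - s) ^+ 2 +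
  m%:R ^+ 3 * (q ^+ 2 * (Q * \sum_i colmean i ^+ 2 +
   q ^+ 2 * \sum_i \sum_(j | j != i) colmean i * colmean j * colcov i j)) +
  m%:R ^+ 2 * (n%:R * Q ^+ 2 + q ^+ 4 * \sum_i \sum_(j | j != i) colcov i j ^+ 2).
Proof.
have h := ustat_second_moment collaw1 colker_sym collaw_ge0 m s.
apply: (le_trans h); rewrite colker_kmean -!addrA lerD2l; apply: lerD.
  by rewrite ler_wpM2l ?exprn_ge0//; exact: colker_proj2.
by rewrite ler_wpM2l ?exprn_ge0//; exact: colker_kmean2.
Qed.

End column.

Section masked_matrices.
Context (R : realType).

Lemma avg_image_law (S T : finType) (g : S -> T) (mu : S -> R) (F : T -> R) :
  avg (image_law g mu) F = avg mu (F \o g).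
Proof.
rewrite /avg /image_law /prob; under eq_bigr do rewrite mulr_suml.
rewrite (exchange_big_dep xpredT)//=; apply: eq_bigr => x _.
by rewrite (big_pred1 (g x)).
Qed.

Lemma avg_indep_law (S T : finType) (mu : S -> R) (nu : T -> R) (F : S * T -> R) :
  avg (indep_law mu nu) F = avg mu (fun x => avg nu (fun y => F (x, y))).
Proof.
rewrite /avg; under [RHS]eq_bigr do rewrite mulr_sumr.
by rewrite pair_big; apply: eq_bigr => -[x y] _; rewrite /indep_law /= mulrA.
Qed.

Lemma avg_joint_law (S T : finType) (mu : S -> R) (K : S -> T -> R) (F : S * T -> R) :
  avg (joint_law mu K) F = avg mu (fun x => avg (K x) (fun y => F (x, y))).
Proof.
rewrite /avg; under [RHS]eq_bigr do rewrite mulr_sumr.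
by rewrite pair_big; apply: eq_bigr => -[x y] _; rewrite /joint_law /= mulrA.
Qed.

Definition bern1 (p : R) (b : bool) : R := if b then p else 1 - p.

Lemma bern1_sum p : \sum_b bern1 p b = 1.
Proof. by rewrite big_bool /= addrC subrK. Qed.

Definition mx_of_ffun n m (T : Type) (x : {ffun 'I_n * 'I_m -> T}) : 'M[T]_(n, m) :=
  \matrix_(i, k) x (i, k).

Lemma avg_bern_law n m p (F : 'M[bool]_(n, m) -> R) :
  avg (bern_law p) F = avg (plaw (bern1 p)) (F \o @mx_of_ffun n m bool).
Proof.
rewrite /avg (reindex (@mx_of_ffun n m bool)) /=; last first.
  exists (fun A : 'M[bool]_(n, m) => [ffun z => A z.1 z.2]) => [x|A] _.
    by apply/ffunP => -[i k]; rewrite ffunE mxE.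
  by apply/matrixP => i k; rewrite mxE ffunE.
apply: eq_bigr => x _; congr (_ * _); rewrite /bern_law /plaw pair_big.
by apply: eq_bigr => -[i k] _; rewrite mxE.
Qed.

Lemma bern_law1 n m p : \sum_(A : 'M[bool]_(n, m)) bern_law p A = 1 :> R.
Proof.
transitivity (avg (@bern_law R n m p) (fun=> 1)).
  by apply: eq_bigr => A _; rewrite mulr1.
by rewrite avg_bern_law avg_cst// plaw1// bern1_sum.
Qed.

(** The null model is the alternative with the geometric matrix replaced by an
    independent one, so both laws can be treated together. *)
Lemma avg_masked_bern n m p (Mk : 'M[bool]_(n, m)) (F : 'M[bool]_(n, m) -> R) :
  avg (bern_law p) (fun W => avg (bern_law p) (fun B => F (mask_mx Mk W B))) =
  avg (bern_law p) F.
Proof.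
pose T := {ffun 'I_n * 'I_m -> bool}.
pose sel (x y : T) : T := [ffun z => if Mk z.1 z.2 then x z else y z].
rewrite avg_bern_law; under eq_avg => x do rewrite /= avg_bern_law.
rewrite avg_bern_law.
pose P := plaw (bern1 p) (I := ('I_n * 'I_m)%type).
(* Given the mask, the entries are independent, and each comes from one of two
   sources with the same law. *)
have pt (z : T) : avg P (fun x => avg P (fun y => (sel x y == z)%:R)) = P z.
  rewrite (eq_avg _ (g := fun x : T => \prod_e
      (if Mk e.1 e.2 then (x e == z e)%:R else bern1 p (z e)))); last first.
    move=> x; rewrite (eq_avg _ (g := fun y : T => \prod_e
        (((if Mk e.1 e.2 then x e else y e) == z e)%:R))); last first.
      move=> y; have [E|ne] := eqVneq (sel x y) z.
        by rewrite big1// => e _; rewrite -E ffunE eqxx.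
      have /existsP[e he] : [exists e, sel x y e != z e].
        rewrite -negb_forall; apply: contra ne => /forallP h.
        by apply/eqP/ffunP => e; exact/eqP.
      by rewrite (bigD1 e)//=; rewrite ffunE in he; rewrite (negbTE he) mul0r.
    rewrite (avg_plaw_prod (bern1 p) (fun e b => ((if Mk e.1 e.2 then x e else b) == z e)%:R)).
    apply: eq_bigr => e _; case: (Mk e.1 e.2); first by rewrite avg_cst// bern1_sum.
    by rewrite /avg big_bool /=; case: (z e); rewrite ?mulr1 ?mulr0 ?addr0 ?add0r.
  rewrite (avg_plaw_prod (bern1 p)
    (fun e b => if Mk e.1 e.2 then (b == z e)%:R else bern1 p (z e))).
  apply: eq_bigr => e _; case: (Mk e.1 e.2); last by rewrite avg_cst// bern1_sum.
  by rewrite /avg big_bool /=; case: (z e); rewrite ?mulr1 ?mulr0 ?addr0 ?add0r.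
rewrite -/P /avg.
transitivity (\sum_z avg P (fun x => avg P (fun y => (sel x y == z)%:R)) *
   (F \o @mx_of_ffun n m bool) z); last by apply: eq_bigr => z _; rewrite pt.
rewrite /avg; under [RHS]eq_bigr => z _ do rewrite mulr_suml.
rewrite exchange_big; apply: eq_bigr => x _.
under [RHS]eq_bigr => z _ do rewrite -mulrA mulr_suml.
rewrite -mulr_sumr exchange_big; congr (_ * _); apply: eq_bigr => y _.
under [RHS]eq_bigr => z _ do rewrite -mulrA.
rewrite -mulr_sumr; congr (_ * _).
rewrite (bigD1 (sel x y))//= eqxx mul1r big1 ?addr0 => [|z]; last first.
  by rewrite eq_sym => /negbTE ->; rewrite mul0r.
congr F; apply/matrixP => i k; rewrite !mxE ffunE.
by [].
Qed.

Variables (n m : nat) (F : bool -> bool -> R).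

(** The weight F of an entry sees its mask bit and its value. This covers the
    count on the whole matrix and the count within the mask. *)
Definition wedge_stat (Mk A : 'M[bool]_(n, m)) : R :=
  \sum_(i < n) \sum_(k < m) \sum_(l < m | (k < l)%N)
    F (Mk i k) (A i k) * F (Mk i l) (A i l).

Definition noise_law (q p : R) (z : bool * bool) : R := bern1 q z.1 * bern1 p z.2.

Definition noisy_entry (z : bool * bool) (w : bool) : R :=
  F z.1 (if z.1 then w else z.2).

Lemma noise_law1 q p : \sum_z noise_law q p z = 1.
Proof.
transitivity (avg (indep_law (bern1 q) (bern1 p)) (fun=> 1)).
  by apply: eq_bigr => z _; rewrite mulr1.
rewrite avg_indep_law -[RHS](avg_cst 1 (bern1_sum q)).
by apply: eq_avg => a; rewrite avg_cst// bern1_sum.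
Qed.

Definition col_product (pi : {ffun 'I_n -> bool} -> R) (W : 'M[bool]_(n, m)) : R :=
  \prod_(k < m) pi [ffun i => W i k].

Lemma bern_law_col p : @bern_law R n m p =1 col_product (plaw (bern1 p)).
Proof.
move=> A; rewrite /bern_law exchange_big; apply: eq_bigr => k _.
by apply: eq_bigr => i _; rewrite ffunE.
Qed.

(** A wedge joins two columns, so that for independent columns the count is a
    statistic of order 2 of the columns. *)
Lemma avg_wedge_stat (pi : {ffun 'I_n -> bool} -> R) q p (phi : R -> R) :
  avg (col_product pi) (fun W => avg (bern_law q) (fun Mk =>
    avg (bern_law p) (fun B => phi (wedge_stat Mk (mask_mx Mk W B))))) =
  avg (@tlaw R (coltype n (bool * bool)%type) (collaw (noise_law q p) pi) m)
    (fun t => phi (ustat (colker noisy_entry (n := n)) t)).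
Proof.
pose C := coltype n (bool * bool)%type.
pose dec (t : m.-tuple C) : 'M[bool]_(n, m) * ('M[bool]_(n, m) * 'M[bool]_(n, m)) :=
  (\matrix_(i, k) (tnth t k).2 i,
   (\matrix_(i, k) ((tnth t k).1 i).1, \matrix_(i, k) ((tnth t k).1 i).2)).
pose enc (x : 'M[bool]_(n, m) * ('M[bool]_(n, m) * 'M[bool]_(n, m))) : m.-tuple C :=
  [tuple ([ffun i => (x.2.1 i k, x.2.2 i k)], [ffun i => x.1 i k]) | k < m].
have encK : cancel enc dec.
  case=> W [Mk B]; congr (_, (_, _)); apply/matrixP => i k;
  by rewrite mxE tnth_mktuple /= ffunE.
have decK : cancel dec enc.
  move=> t; apply: eq_from_tnth => k; rewrite tnth_mktuple.
  case E : (tnth t k) => [a b]; congr (_, _); apply/ffunP => i; rewrite ffunE !mxE E//=.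
  by case: (a i).
transitivity (avg (indep_law (col_product pi) (indep_law (bern_law q) (bern_law p)))
    (fun x => phi (wedge_stat x.2.1 (mask_mx x.2.1 x.1 x.2.2)))).
  rewrite avg_indep_law; apply: eq_avg => W; rewrite avg_indep_law.
  by apply: eq_avg => Mk; apply: eq_avg => B.
rewrite /avg (reindex dec) /=; last first.
  by exists enc => x _; [exact: decK|exact: encK].
apply: eq_bigr => t _; congr (_ * phi _).
  rewrite /indep_law /= !bern_law_col /col_product /tlaw -!big_split.
  apply: eq_bigr => k _; rewrite /collaw [RHS]mulrC; congr (_ * _).
    by congr pi; apply/ffunP => i; rewrite ffunE mxE.
  rewrite /plaw -big_split; apply: eq_bigr => i _.
  by rewrite !ffunE !mxE.
rewrite /wedge_stat exchange_big; apply: eq_bigr => k _.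
rewrite exchange_big; apply: eq_bigr => l _; apply: eq_bigr => i _.
by rewrite !mxE.
Qed.

End masked_matrices.

(** * The geometric law given the vectors of the rows *)

Section finitely_valued.
Context d (T : measurableType d) (R : realType) (P : probability T R).

Lemma Ex_finite_valued (C : finType) (psi : T -> C) (F : C -> R) :
  (forall c, measurable_fun [set: T] (fun t => (psi t == c)%:R : R)) ->
  Ex P (F \o psi) = avg (fun c => Ex P (fun t => (psi t == c)%:R)) F.
Proof.
move=> mpsi; rewrite (eq_Ex _ (g := fun t => \sum_c F c * (psi t == c)%:R)); last first.
  move=> t /=; rewrite (bigD1 (psi t))//= eqxx mulr1 big1 ?addr0// => c.
  by rewrite eq_sym => /negbTE ->; rewrite mulr0.
rewrite Ex_sum => [|c _]; last by apply: L1Z; exact: L1_event.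
by apply: eq_bigr => c _; rewrite ExZ ?(mulrC (F c))//; exact: L1_event.
Qed.

End finitely_valued.

Section iid_marginals.
Context d (T : measurableType d) (R : realType) (P : probability T R).

Lemma Ex_fst d2 (T2 : measurableType d2) (Q : probability T2 R) (f : T -> R) : L1 P f ->
  Ex (P \x Q)%E (fun z => f z.1) = Ex P f.
Proof.
move=> If; have := Ex_prodM If (L1_cst Q 1); rewrite Ex_cst mulr1 => <-.
by apply: eq_Ex => z; rewrite mulr1.
Qed.

Lemma Ex_iid_prod k (f : 'I_k -> T -> R) :
  (forall i, measurable_fun [set: T] (f i)) -> (forall i x, `|f i x| <= 1) ->
  Ex (iid P k) (fun t => \prod_i f i (tnth t i)) = \prod_i Ex P (f i).
Proof.
elim: k f => [|k IH] f mf f1.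
  rewrite big_ord0 -[RHS](Ex_cst (iid P 0) 1); apply: eq_Ex => t.
  by rewrite big_ord0.
have mp j (g : 'I_j -> T -> R) : (forall i, measurable_fun [set: T] (g i)) ->
    measurable_fun [set: j.-tuple T] (fun t : j.-tuple T => \prod_i g i (tnth t i)).
  move=> mg; apply: measurable_prod => i _.
  exact: (measurableT_comp (mg i) (measurable_tnth i)).
have b1 j (g : 'I_j -> T -> R) (t : j.-tuple T) : (forall i x, `|g i x| <= 1) ->
    `|\prod_i g i (tnth t i)| <= 1.
  move=> g1; rewrite normr_prod; apply: prodr_ile1 => i _.
  by rewrite normr_ge0 g1.
have I1 : L1 (P \x iid P k)%E (fun z => \prod_i f i (tnth (tcons z) i)).
  apply: (L1_bounded _ (c := 1)); last by move=> z; exact: b1.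
  exact: (measurableT_comp (mp _ _ mf) (@measurable_tcons _ _ k)).
rewrite Ex_iidS//; last exact: mp.
have If0 : L1 P (f ord0) by exact: (L1_bounded _ (mf _) (f1 _)).
have Ig : L1 (iid P k) (fun t => \prod_i f (lift ord0 i) (tnth t i)).
  by apply: (L1_bounded _ (c := 1)); [exact: (mp _ (fun i => f (lift ord0 i)))|move=> z; exact: (b1 _ (fun i => f (lift ord0 i)))].
rewrite (eq_Ex _ (g := fun z => f ord0 z.1 * \prod_i f (lift ord0 i) (tnth z.2 i))).
  by rewrite (Ex_prodM If0 Ig) big_ord_recl (IH (fun i => f (lift ord0 i))).
move=> [s t]; rewrite big_ord_recl tnth_tcons0; congr (_ * _).
by apply: eq_bigr => i _; rewrite tnth_tconsS.
Qed.

Lemma Ex_iid_marginal k (i : 'I_k) (f : T -> R) (c : R) :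
  measurable_fun [set: T] f -> (forall x, `|f x| <= c) ->
  Ex (iid P k) (fun t => f (tnth t i)) = Ex P f.
Proof.
move=> mf fc; elim: k i => [[]//|k IH] i.
have mi j (l : 'I_j) : measurable_fun [set: j.-tuple T] (fun t : j.-tuple T => f (tnth t l)).
  exact: (measurableT_comp mf (measurable_tnth l)).
have I1 : L1 (P \x iid P k)%E (fun z => f (tnth (tcons z) i)).
  by apply: (L1_bounded _ (c := c)) => //; exact: (measurableT_comp (mi _ i) (@measurable_tcons _ _ k)).
rewrite Ex_iidS//.
case: (unliftP ord0 i) => [j|] ->.
  rewrite (eq_Ex _ (g := fun z => f (tnth z.2 j))); last first.
    by move=> [s t]; rewrite tnth_tconsS.
  rewrite -(IH j); pose fj (t : k.-tuple T) := f (tnth t j).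
  have Ij : L1 (iid P k) fj by exact: (L1_bounded _ (mi k j) (fun t => fc _)).
  have := Ex_prodM (L1_cst P 1) Ij; rewrite Ex_cst mul1r => <-.
  by apply: eq_Ex => z; rewrite mul1r.
rewrite (eq_Ex _ (g := fun z => f z.1)); last by move=> [s t]; rewrite tnth_tcons0.
by rewrite Ex_fst//; exact: (L1_bounded _ mf fc).
Qed.

Lemma Ex_iid_marginal2 k (i j : 'I_k) (f : T -> T -> R) (c : R) : i != j ->
  measurable_fun [set: T * T] (fun z => f z.1 z.2) -> (forall x y, `|f x y| <= c) ->
  Ex (iid P k) (fun t => f (tnth t i) (tnth t j)) = Ex P (fun x => Ex P (f x)).
Proof.
move=> + mf fc; elim: k i j => [[]//|k IH] i j ij.
have mi l (a b : 'I_l) :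
    measurable_fun [set: l.-tuple T] (fun t : l.-tuple T => f (tnth t a) (tnth t b)).
  have mab : measurable_fun [set: l.-tuple T] (fun t : l.-tuple T => (tnth t a, tnth t b)).
    by apply: measurable_fun_pair; exact: measurable_tnth.
  exact: (measurableT_comp mf mab).
have I1 : L1 (P \x iid P k)%E (fun z => f (tnth (tcons z) i) (tnth (tcons z) j)).
  by apply: (L1_bounded _ (c := c)) => //; exact: (measurableT_comp (mi _ i j) (@measurable_tcons _ _ k)).
have mx x : measurable_fun [set: T] (f x).
  exact: (measurableT_comp mf (pair1_measurable x)).
have my y : measurable_fun [set: T] (f ^~ y).
  exact: (measurableT_comp mf (pair2_measurable y)).
rewrite Ex_iidS//.
have Ix s : L1 (iid P k) (fun t => f (tnth (tcons (s, t)) i) (tnth (tcons (s, t)) j)).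
  apply: (L1_bounded _ (c := c)) => //.
  have m1 : measurable_fun [set: k.-tuple T] (fun t : k.-tuple T => tcons (s, t)).
    exact: (measurableT_comp (@measurable_tcons _ _ k) (pair1_measurable s)).
  exact: (measurableT_comp (mi _ i j) m1).
have [_ ->] := Fubini12 I1 Ix.
have If2 : L1 (P \x P)%E (fun z => f z.1 z.2) by apply: (L1_bounded _ (c := c)).
have Ifx x : L1 P (f x) by apply: (L1_bounded _ (c := c)).
have Ify y : L1 P (f ^~ y) by apply: (L1_bounded _ (c := c)).
case: (unliftP ord0 i) ij => [i'|] ->; case: (unliftP ord0 j) => [j'|] -> ij.
- rewrite -[RHS](Ex_cst P); apply: eq_Ex => s.
  rewrite -(IH i' j'); last by apply: contra ij => /eqP ->.
  by apply: eq_Ex => t; rewrite !tnth_tconsS.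
- have [_ <-] := Fubini12 If2 Ifx; rewrite (Fubini21 If2 Ify).
  apply: eq_Ex => s; rewrite -(Ex_iid_marginal i' (my s) (c := c))//.
  by apply: eq_Ex => t; rewrite tnth_tconsS tnth_tcons0.
- apply: eq_Ex => s; rewrite -(Ex_iid_marginal j' (mx s) (c := c))//.
  by apply: eq_Ex => t; rewrite tnth_tconsS tnth_tcons0.
- by rewrite eqxx in ij.
Qed.

End iid_marginals.

Section geometric_law.
Context (R : realType) (p : R) (n m d : nat).
Local Notation RM := (measurableTypeR R).
Local Notation G := (gauss R d).
Local Notation V := (d.-tuple RM).

Definition colvec (X : n.-tuple V) (y : V) : {ffun 'I_n -> bool} :=
  [ffun i => below (tau d p) (tnth X i) y].

(** Given the vectors X of the rows, the law of a column. *)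
Definition colprob (X : n.-tuple V) (w : {ffun 'I_n -> bool}) : R :=
  Ex G (fun y => (colvec X y == w)%:R).

Lemma measurable_below_eq d' (T : measurableType d') (b : bool) (f g : T -> V) :
  measurable_fun [set: T] f -> measurable_fun [set: T] g ->
  measurable_fun [set: T] (fun t => (below (tau d p) (f t) (g t) == b)%:R : R).
Proof.
move=> mf mg.
have m1 : measurable_fun [set: T] (fun t => (below (tau d p) (f t) (g t))%:R : R).
  exact: (measurableT_comp (@measurable_below R d (tau d p)) (measurable_fun_pair mf mg)).
case: b.
  by rewrite (_ : (fun t => _) = fun t => (below (tau d p) (f t) (g t))%:R : R)//;
    apply/funext => t; rewrite eqb_id.
rewrite (_ : (fun t => _) = fun t => 1 - (below (tau d p) (f t) (g t))%:R : R).
  exact: measurable_funB.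
by apply/funext => t; case: below; rewrite ?subrr ?subr0.
Qed.

Lemma eq_colvec X y w :
  (colvec X y == w)%:R = \prod_i (below (tau d p) (tnth X i) y == w i)%:R :> R.
Proof.
have [<-|ne] := eqVneq; first by rewrite big1// => i _; rewrite ffunE eqxx.
have /existsP[i hi] : [exists i, colvec X y i != w i].
  rewrite -negb_forall; apply: contra ne => /forallP h.
  by apply/eqP/ffunP => i; exact/eqP.
by rewrite (bigD1 i)//=; rewrite ffunE in hi; rewrite (negbTE hi) mul0r.
Qed.

Lemma measurable_colvec X w : measurable_fun [set: V] (fun y => (colvec X y == w)%:R : R).
Proof.
rewrite (_ : (fun y => _) =
    fun y => \prod_i (below (tau d p) (tnth X i) y == w i)%:R : R); last first.
  by apply/funext => y; exact: eq_colvec.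
by apply: measurable_prod => i _; exact: measurable_below_eq.
Qed.

Lemma colprob_ge0 X w : 0 <= colprob X w.
Proof. by apply: Ex_ge0 => y. Qed.

Lemma avg_colprob X (F : {ffun 'I_n -> bool} -> R) :
  avg (colprob X) F = Ex G (fun y => F (colvec X y)).
Proof. by rewrite -(Ex_finite_valued _ _ (measurable_colvec X)). Qed.

Lemma colprob1 X : \sum_w colprob X w = 1.
Proof.
transitivity (avg (colprob X) (fun=> 1)); first by apply: eq_bigr => w _; rewrite mulr1.
by rewrite avg_colprob Ex_cst.
Qed.

Lemma colmean_colprob X i : colmean p (colprob X) i = gdev p (tnth X i).
Proof.
rewrite /colmean avg_colprob; apply: eq_Ex => y.
by rewrite ffunE.
Qed.

Lemma colcov_colprob X i j : colcov p (colprob X) i j = hcov p (tnth X i) (tnth X j).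
Proof.
rewrite /colcov avg_colprob; apply: eq_Ex => y.
by rewrite !ffunE.
Qed.

Local Notation W := (n.-tuple V * m.-tuple V)%type.

Lemma eq_geom_mx (x : W) (A : 'M[bool]_(n, m)) :
  (geom_mx p x == A)%:R =
  \prod_(k < m) (colvec x.1 (tnth x.2 k) == [ffun i => A i k])%:R :> R.
Proof.
have [<-|ne] := eqVneq.
  rewrite big1// => k _.
  suff -> : colvec x.1 (tnth x.2 k) = [ffun i => geom_mx p x i k] by rewrite eqxx.
  by apply/ffunP => i; rewrite !ffunE mxE.
have /existsP[k hk] : [exists k, colvec x.1 (tnth x.2 k) != [ffun i => A i k]].
  rewrite -negb_forall; apply: contra ne => /forallP h.
  apply/eqP/matrixP => i k; have /eqP/ffunP/(_ i) := h k.
  by rewrite !ffunE mxE.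
by rewrite (bigD1 k)//= (negbTE hk) mul0r.
Qed.

Lemma measurable_geom_mx (A : 'M[bool]_(n, m)) :
  measurable_fun [set: W] (fun x : W => (geom_mx p x == A)%:R : R).
Proof.
rewrite (_ : (fun x => _) = fun x : W => \prod_(k < m) \prod_(i < n)
    (below (tau d p) (tnth x.1 i) (tnth x.2 k) == A i k)%:R : R); last first.
  apply/funext => x; rewrite eq_geom_mx; apply: eq_bigr => k _.
  by rewrite eq_colvec; apply: eq_bigr => i _; rewrite ffunE.
apply: measurable_prod => k _; apply: measurable_prod => i _.
apply: measurable_below_eq.
  exact: (measurableT_comp (measurable_tnth i) measurable_fst).
exact: (measurableT_comp (measurable_tnth k) measurable_snd).
Qed.

(** By Fubini's theorem: for fixed row vectors, distinct columns are functions of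
    distinct independent vectors. *)
Lemma geom_law_disintegration (A : 'M[bool]_(n, m)) :
  L1 (iid G n) (fun X => col_product (colprob X) A) /\
  geom_law p d A = Ex (iid G n) (fun X => col_product (colprob X) A).
Proof.
have mA := measurable_geom_mx A.
pose PP : probability W R := (iid G n \x iid G m)%E.
have I1 : L1 PP (fun x : W => (geom_mx p x == A)%:R) by exact: L1_event.
have Ix (X : n.-tuple V) : L1 (iid G m) (fun Y : m.-tuple V => (geom_mx p (X, Y) == A)%:R).
  have mAX : measurable_fun [set: m.-tuple V]
      (fun Y : m.-tuple V => (geom_mx p (X, Y) == A)%:R : R).
    exact: (measurableT_comp mA (pair1_measurable X)).
  exact: L1_event mAX.
have E (X : n.-tuple V) : Ex (iid G m) (fun Y : m.-tuple V => (geom_mx p (X, Y) == A)%:R) =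
    col_product (colprob X) A.
  rewrite (eq_Ex _ (fun Y => eq_geom_mx (X, Y) A)) /=.
  rewrite (Ex_iid_prod _ (f := fun k y => (colvec X y == [ffun i => A i k])%:R))//.
    by move=> k; exact: measurable_colvec.
  by move=> k y; rewrite normr_nat; case: (_ == _).
have [I2 E2] := Fubini12 I1 Ix.
split; first exact: (L1_ext E I2).
rewrite -(eq_Ex _ E) -E2 /geom_law.
rewrite (Ex_event PP mA); congr (fine (_ _)).
by apply/seteqP; split => x /=; [move=> ->|move/eqP].
Qed.

Lemma geom_law_ge0 (A : 'M[bool]_(n, m)) : 0 <= geom_law p d A.
Proof. by rewrite /geom_law fine_ge0. Qed.

Lemma avg_geom_law (F : 'M[bool]_(n, m) -> R) :
  L1 (iid G n) (fun X => avg (col_product (colprob X)) F) /\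
  avg (geom_law p d) F = Ex (iid G n) (fun X => avg (col_product (colprob X)) F).
Proof.
have IA A : L1 (iid G n) (fun X => col_product (colprob X) A * F A).
  apply: (L1_ext (f := fun X => F A * col_product (colprob X) A)) => [X|].
    by rewrite mulrC.
  by apply: L1Z; have [] := geom_law_disintegration A.
split; first by apply: L1_sum => A _; exact: IA.
rewrite /avg Ex_sum => [|A _]; last exact: IA.
apply: eq_bigr => A _; have [I1 ->] := geom_law_disintegration A.
rewrite mulrC -ExZ//; apply: eq_Ex => X; by rewrite mulrC.
Qed.

End geometric_law.

(** * Second moments of the wedge count *)

Section iid_sums.
Context d (T : measurableType d) (R : realType) (P : probability T R) (n : nat).

Lemma iid_sum1 (f : T -> R) (c : R) : measurable_fun [set: T] f -> (forall x, `|f x| <= c) ->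
  L1 (iid P n) (fun X => \sum_i f (tnth X i)) /\
  Ex (iid P n) (fun X => \sum_i f (tnth X i)) = n%:R * Ex P f.
Proof.
move=> mf fc.
have I1 (i : 'I_n) : L1 (iid P n) (fun X => f (tnth X i)).
  exact: (L1_bounded _ (measurableT_comp mf (measurable_tnth i)) (fun _ => fc _)).
split; first by apply: L1_sum.
rewrite Ex_sum => [|i _]; last exact: I1.
rewrite (eq_bigr (fun=> Ex P f)); last first.
  by move=> i _; exact: (Ex_iid_marginal P i mf fc).
by rewrite sumr_const card_ord mulr_natl.
Qed.

Lemma sum_neq_const (c : R) : \sum_(i < n) \sum_(j < n | j != i) c = n%:R * (n%:R - 1) * c.
Proof.
rewrite (eq_bigr (fun=> (n%:R - 1) * c)) => [|i _].
  by rewrite sumr_const card_ord -mulrA [RHS]mulr_natl.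
have : \sum_(j < n) c = n%:R * c by rewrite sumr_const card_ord mulr_natl.
by rewrite (bigD1 i)//= mulrBl mul1r => <-; rewrite addrAC subrr add0r.
Qed.

Lemma iid_sum2 (f : T -> T -> R) (c : R) :
  measurable_fun [set: T * T] (fun z => f z.1 z.2) -> (forall x y, `|f x y| <= c) ->
  L1 (iid P n) (fun X => \sum_i \sum_(j | j != i) f (tnth X i) (tnth X j)) /\
  Ex (iid P n) (fun X => \sum_i \sum_(j | j != i) f (tnth X i) (tnth X j)) =
    n%:R * (n%:R - 1) * Ex P (fun x => Ex P (f x)).
Proof.
move=> mf fc.
have I2 (i j : 'I_n) : L1 (iid P n) (fun X => f (tnth X i) (tnth X j)).
  have mij : measurable_fun [set: n.-tuple T] (fun X : n.-tuple T => (tnth X i, tnth X j)).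
    by apply: measurable_fun_pair; exact: measurable_tnth.
  exact: (L1_bounded _ (measurableT_comp mf mij) (fun _ => fc _ _)).
have I1 (i : 'I_n) : L1 (iid P n) (fun X => \sum_(j | j != i) f (tnth X i) (tnth X j)).
  by apply: L1_sum => j _; exact: I2.
split; first by apply: L1_sum => i _; exact: I1.
rewrite Ex_sum => [|i _]; last exact: I1.
rewrite -sum_neq_const; apply: eq_bigr => i _.
rewrite Ex_sum => [|j _]; last exact: I2.
by apply: eq_bigr => j ji; apply: (Ex_iid_marginal2 P _ mf fc); rewrite eq_sym.
Qed.

End iid_sums.

Section second_moments.
Context (R : realType) (p q Q : R) (F : bool -> bool -> R).
Hypotheses (p0 : 0 < p) (p1 : p < 1) (q0 : 0 <= q) (q1 : q <= 1) (Q0 : 0 <= Q).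
Hypothesis F_mean : forall b : bool,
  avg (noise_law q p) (fun z => noisy_entry F z b) = q * (b%:R - p).
Hypothesis F_sqr : forall b : bool,
  avg (noise_law q p) (fun z => noisy_entry F z b ^+ 2) <= Q.
Variables (n m : nat).

Let bern1_ge0 (x : R) b : 0 <= x -> x <= 1 -> 0 <= bern1 x b.
Proof. by move=> x0 x1; case: b => //=; rewrite subr_ge0. Qed.

Let noise_ge0 z : 0 <= noise_law q p z.
Proof. by rewrite mulr_ge0// bern1_ge0// ltW. Qed.

Lemma bern_law_ge0 (x : R) (A : 'M[bool]_(n, m)) : 0 <= x -> x <= 1 -> 0 <= bern_law x A.
Proof.
move=> x0 x1; apply: prodr_ge0 => i _; apply: prodr_ge0 => k _.
exact: (bern1_ge0 (A i k)).
Qed.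

Definition null_law := indep_law (@bern_law R n m q) (@bern_law R n m p).
Definition alt_law d := joint_law (@bern_law R n m q) (masked_law p d).

Lemma null_law_ge0 x : 0 <= null_law x.
Proof. by rewrite mulr_ge0// bern_law_ge0// ltW. Qed.

Lemma alt_law_ge0 d x : 0 <= alt_law d x.
Proof.
rewrite mulr_ge0// ?bern_law_ge0//; apply: sumr_ge0 => y _.
by rewrite mulr_ge0// ?geom_law_ge0// bern_law_ge0// ltW.
Qed.

(** Conditional means and covariances vanish for independent entries, which leaves
    the diagonal term of column_second_moment. *)
Lemma null_second_moment :
  avg null_law (fun x => wedge_stat F x.1 x.2 ^+ 2) <= m%:R ^+ 2 * (n%:R * Q ^+ 2).
Proof.
rewrite avg_indep_law /=.
rewrite (eq_avg _ (g := fun Mk => avg (bern_law p) (fun W => avg (bern_law p)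
    (fun B => wedge_stat F Mk (mask_mx Mk W B) ^+ 2)))); last first.
  by move=> Mk; rewrite (avg_masked_bern p Mk (fun A => wedge_stat F Mk A ^+ 2)).
rewrite avg_exchange.
pose pi := plaw (bern1 p) (I := 'I_n).
have colE (Psi : 'M[bool]_(n, m) -> R) :
    avg (bern_law p) Psi = avg (col_product pi) Psi.
  by apply: eq_bigr => W _; rewrite bern_law_col.
rewrite colE (avg_wedge_stat m F pi q p (fun s => s ^+ 2)).
have pi1 : \sum_w pi w = 1 by rewrite plaw1// bern1_sum.
have pi_ge0 w : 0 <= pi w by apply: prodr_ge0 => i _; rewrite bern1_ge0// ltW.
have b0 : avg (bern1 p) (fun b => b%:R - p) = 0.
  by rewrite /avg big_bool /= ?mulr1n ?mulr0n; ring.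
have cm i : colmean p pi i = 0.
  by rewrite /colmean (avg_plaw1 (bern1_sum p) i (fun b => b%:R - p)).
have cc i j : i != j -> colcov p pi i j = 0.
  move=> ij; rewrite /colcov.
  by rewrite (avg_plaw2 (bern1_sum p) (fun b => b%:R - p) (fun b => b%:R - p) ij) b0 mul0r.
have := column_second_moment (noise_law1 q p) noise_ge0 pi1 pi_ge0 F_mean F_sqr Q0 m 0.
have -> : \sum_i colmean p pi i ^+ 2 = 0.
  by rewrite big1// => i _; rewrite cm expr0n.
have -> : \sum_i \sum_(j | j != i) colmean p pi i * colmean p pi j * colcov p pi i j = 0.
  by rewrite big1// => i _; rewrite big1// => j ji; rewrite cc 1?eq_sym// mulr0.
have -> : \sum_i \sum_(j | j != i) colcov p pi i j ^+ 2 = 0.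
  by rewrite big1// => i _; rewrite big1// => j ji; rewrite cc 1?eq_sym// expr0n.
rewrite !mulr0 !addr0 !mulr0 subr0 expr0n /= add0r add0r.
apply: le_trans; rewrite le_eqVlt; apply/orP; left; apply/eqP.
by apply: eq_avg => t; rewrite subr0.
Qed.

Section alternative.
Variable d : nat.
Hypothesis d0 : (0 < d)%N.
Local Notation RM := (measurableTypeR R).
Local Notation G := (gauss R d).
Local Notation V := (d.-tuple RM).
Let v := Ex G (fun x : V => gdev p x ^+ 2).
Let g4 := Ex G (fun x : V => gdev p x ^+ 4).
Let H := Ex G (fun x : V => Ex G (fun x' => hcov p x x' ^+ 2)).
Let N : R := m%:R * (m%:R - 1) / 2.
Let e : R := Num.sqrt d%:R.

Lemma alt_avgE (phi : 'M[bool]_(n, m) -> 'M[bool]_(n, m) -> R) :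
  avg (alt_law d) (fun x => phi x.1 x.2) = avg (geom_law p d) (fun W =>
    avg (bern_law q) (fun Mk => avg (bern_law p) (fun B => phi Mk (mask_mx Mk W B)))).
Proof.
rewrite avg_joint_law -avg_exchange; apply: eq_avg => Mk /=.
by rewrite avg_image_law avg_indep_law.
Qed.

(** Given the vectors of the rows the columns are independent and
    column_second_moment applies. The bias is a centred sum over the rows of
    gdev^2 - v, so only its variance remains; the mixed terms g g' h are split by
    the arithmetic-geometric inequality. *)
Lemma alt_second_moment :
  avg (alt_law d) (fun x => (wedge_stat F x.1 x.2 - N * (q ^+ 2 * (n%:R * v))) ^+ 2) <=
  (N * q ^+ 2) ^+ 2 * (n%:R * g4) +
  m%:R ^+ 3 * (q ^+ 2 * (Q * (n%:R * v) +
   q ^+ 2 * (n%:R ^+ 2 * ((e * v ^+ 2 + H / e) / 2)))) +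
  m%:R ^+ 2 * (n%:R * Q ^+ 2 + q ^+ 4 * (n%:R ^+ 2 * H)).
Proof.
set s := N * _.
have e0 : 0 < e by rewrite sqrtr_gt0 ltr0n.
have v0 : 0 <= v by apply: Ex_ge0 => x; exact: sqr_ge0.
have H0 : 0 <= H by apply: Ex_ge0 => x; apply: Ex_ge0 => y; exact: sqr_ge0.
rewrite (alt_avgE (fun Mk A => (wedge_stat F Mk A - s) ^+ 2)).
have [Ig ->] := avg_geom_law p d (fun W : 'M[bool]_(n, m) =>
    avg (bern_law q) (fun Mk => avg (bern_law p) (fun B =>
      (wedge_stat F Mk (mask_mx Mk W B) - s) ^+ 2))).
pose g (x : V) := gdev p x.
have mg : measurable_fun [set: V] g := @measurable_gdev R p d.
have g1 x : `|g x| <= 1 := gdev_le1 p0 p1 x.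
pose phi (x : V) := g x ^+ 2 - v.
have mg2 : measurable_fun [set: V] (fun x => g x ^+ 2) by exact: measurable_funX.
have g21 x : `|g x ^+ 2| <= 1 by rewrite normrX exprn_ile1.
have Ig2 : L1 G (fun x => g x ^+ 2) := L1_bounded _ mg2 g21.
have Ig4 : L1 G (fun x => g x ^+ 4).
  apply: (L1_bounded _ (c := 1)); first exact: measurable_funX.
  by move=> x; rewrite normrX exprn_ile1.
have mphi : measurable_fun [set: V] phi by exact: measurable_funB.
have v1 : v <= 1.
  rewrite -[leRHS](Ex_cst G); apply: Ex_le => //; first exact: L1_cst.
  by move=> x; exact: le_trans (ler_norm _) (g21 x).
have phi1 x : `|phi x| <= 1.
  have := g21 x; rewrite ger0_norm ?sqr_ge0// => h; have := sqr_ge0 (g x).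
  by rewrite /phi ler_norml => h'; apply/andP; split; lra.
have phi21 x : `|phi x ^+ 2| <= 1 by rewrite normrX exprn_ile1.
have mphi2 : measurable_fun [set: V] (fun x => phi x ^+ 2) by exact: measurable_funX.
have Iphi : L1 G phi := L1_bounded _ mphi phi1.
have Ephi : Ex G phi = 0 by rewrite /phi ExB ?Ex_cst ?subrr//; exact: L1_cst.
have Ephi2 : Ex G (fun x => phi x ^+ 2) <= g4.
  rewrite (eq_Ex _ (g := fun x => (g x ^+ 4 - (2 * v) * g x ^+ 2) + v ^+ 2)); last first.
    by move=> x; rewrite /phi; ring.
  have J1 := L1Z (2 * v) Ig2.
  rewrite (ExD (L1B Ig4 J1) (L1_cst G (v ^+ 2))) (ExB Ig4 J1) (ExZ _ Ig2) Ex_cst.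
  by rewrite -/g -/g4 -/v; have := sqr_ge0 v; lra.
have mh : measurable_fun [set: V * V] (fun z => hcov p z.1 z.2) := @measurable_hcov R p p0 p1 d.
have h1 (x y : V) : `|hcov p x y| <= 1 := hcov_le1 p0 p1 x y.
have mgg1 : measurable_fun [set: V * V] (fun z => g z.1) by exact: (measurableT_comp mg).
have mgg2 : measurable_fun [set: V * V] (fun z => g z.2) by exact: (measurableT_comp mg).
(* The weight e = sqrt d balances the two halves, as g^2 g'^2 has mean of order
   d^(-2) and h^2 has mean of order d^(-1). *)
pose rho (x y : V) := (e * (g x ^+ 2 * g y ^+ 2) + e^-1 * hcov p x y ^+ 2) / 2.
have mrho : measurable_fun [set: V * V] (fun z => rho z.1 z.2).
  apply: measurable_funM => //; apply: measurable_funD; apply: measurable_funM => //.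
    by apply: measurable_funM; exact: measurable_funX.
  exact: measurable_funX.
have rho1 (x y : V) : `|rho x y| <= (e + e^-1) / 2.
  rewrite ger0_norm; last first.
    rewrite divr_ge0// addr_ge0// mulr_ge0 ?invr_ge0 ?sqr_ge0 ?(ltW e0)//.
    by rewrite mulr_ge0 ?sqr_ge0.
  rewrite ler_pM2r ?invr_gt0//; apply: lerD.
    rewrite -[leRHS]mulr1 ler_wpM2l ?(ltW e0)// mulr_ile1 ?sqr_ge0//.
      exact: le_trans (ler_norm _) (g21 x).
    exact: le_trans (ler_norm _) (g21 y).
  rewrite -[leRHS]mulr1 ler_wpM2l ?invr_ge0 ?(ltW e0)//.
  by rewrite -[leLHS]ger0_norm ?sqr_ge0// normrX exprn_ile1.
pose hh (x y : V) := hcov p x y ^+ 2.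
have mhh : measurable_fun [set: V * V] (fun z => hh z.1 z.2) by exact: measurable_funX.
have hh1 (x y : V) : `|hh x y| <= 1 by rewrite normrX exprn_ile1.
pose pp (x y : V) := phi x * phi y.
have mpp : measurable_fun [set: V * V] (fun z => pp z.1 z.2).
  by apply: measurable_funM; exact: (measurableT_comp mphi).
have pp1 (x y : V) : `|pp x y| <= 1 by rewrite normrM mulr_ile1.
have [Jg Eg] := iid_sum1 G n mg2 g21.
have [Jp Ep] := iid_sum1 G n mphi2 phi21.
have [Jpp Epp] := iid_sum2 G n mpp pp1.
have [Jr Er] := iid_sum2 G n mrho rho1.
have [Jh Eh] := iid_sum2 G n mhh hh1.
have K1 := L1Z ((N * q ^+ 2) ^+ 2) (L1D Jp Jpp).
have K2 := L1Z (m%:R ^+ 3 * q ^+ 2) (L1D (L1Z Q Jg) (L1Z (q ^+ 2) Jr)).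
have K3 := L1Z (m%:R ^+ 2) (L1D (L1_cst (iid G n) (n%:R * Q ^+ 2)) (L1Z (q ^+ 4) Jh)).
apply: (le_trans (Ex_le Ig (L1D (L1D K1 K2) K3) _)).
  move=> X.
  rewrite (avg_wedge_stat m F (colprob p X) q p (fun u => (u - s) ^+ 2)).
  have := column_second_moment (noise_law1 q p) noise_ge0 (colprob1 p X)
    (colprob_ge0 p X) F_mean F_sqr Q0 m s.
  move=> h; apply: (le_trans h).
  apply: lerD; [apply: lerD|].
  - rewrite le_eqVlt; apply/orP; left; apply/eqP.
    have -> : \sum_i colmean p (colprob p X) i ^+ 2 = \sum_i phi (tnth X i) + n%:R * v.
      rewrite /phi sumrB sumr_const card_ord -(mulr_natl v) subrK.
      by apply: eq_bigr => i _; rewrite colmean_colprob.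
    rewrite -/N /s (_ : _ - _ = N * q ^+ 2 * \sum_i phi (tnth X i)); last by ring.
    rewrite exprMn; congr (_ * _); rewrite expr2 mulr_suml -big_split.
    apply: eq_bigr => i _; rewrite mulr_sumr (bigD1 i)//= expr2.
  - rewrite mulrA ler_wpM2l ?mulr_ge0 ?exprn_ge0//; apply: lerD.
      by rewrite ler_wpM2l//; apply: ler_sum => i _; rewrite colmean_colprob.
    rewrite ler_wpM2l ?sqr_ge0//; apply: ler_sum => i _; apply: ler_sum => j _.
    rewrite !colmean_colprob colcov_colprob -/(g _) -/(g _) /rho.
    move: (g _) (g _) (hcov _ _ _) => b a c.
    have -> : (e * (a ^+ 2 * b ^+ 2) + e^-1 * c ^+ 2) / 2 =
        a * b * c + e / 2 * (a * b - e^-1 * c) ^+ 2 by field; rewrite gt_eqF.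
    by rewrite lerDl mulr_ge0 ?sqr_ge0// divr_ge0// ltW.
  - rewrite ler_wpM2l ?sqr_ge0// lerD2l ler_wpM2l ?exprn_ge0//.
    by apply: ler_sum => i _; apply: ler_sum => j _; rewrite colcov_colprob.
rewrite (ExD (L1D K1 K2) K3) (ExD K1 K2) (ExZ _ (L1D Jp Jpp)) (ExD Jp Jpp).
rewrite (ExZ _ (L1D (L1Z Q Jg) (L1Z (q ^+ 2) Jr))) (ExD (L1Z Q Jg) (L1Z (q ^+ 2) Jr)).
rewrite (ExZ Q Jg) (ExZ _ Jr).
rewrite (ExZ _ (L1D (L1_cst (iid G n) (n%:R * Q ^+ 2)) (L1Z (q ^+ 4) Jh))).
rewrite (ExD (L1_cst (iid G n) (n%:R * Q ^+ 2)) (L1Z (q ^+ 4) Jh)) Ex_cst (ExZ _ Jh).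
rewrite Eg Ep Epp Er Eh -/v.
have -> : Ex G (fun x => Ex G (pp x)) = 0.
  rewrite -[RHS](Ex_cst G); apply: eq_Ex => x.
  by rewrite /pp ExZ// Ephi mulr0.
rewrite -[Ex G (fun x => Ex G (hh x))]/H.
have -> : Ex G (fun x => Ex G (rho x)) = (e * v ^+ 2 + H / e) / 2.
  have Ih x : L1 G (fun y => hcov p x y ^+ 2).
    apply: (L1_bounded _ (c := 1)) => [|y]; last exact: hh1.
    exact: (measurableT_comp mhh (pair1_measurable x)).
  have I2h : L1 (G \x G)%E (fun z => hh z.1 z.2) by apply: (L1_bounded _ (c := 1)).
  have [Io _] := Fubini12 I2h Ih.
  rewrite (eq_Ex _ (g := fun x => (e * v / 2) * g x ^+ 2 +
      (e^-1 / 2) * Ex G (fun y => hcov p x y ^+ 2))); last first.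
    move=> x; rewrite (eq_Ex _ (g := fun y => (e * g x ^+ 2 / 2) * g y ^+ 2 +
        (e^-1 / 2) * hcov p x y ^+ 2)); last by move=> y; rewrite /rho; field; rewrite gt_eqF.
    rewrite (ExD (L1Z _ Ig2) (L1Z _ (Ih x))) (ExZ _ Ig2) (ExZ _ (Ih x)) -/v.
    by congr (_ + _); ring.
  rewrite (ExD (L1Z _ Ig2) (L1Z _ Io)) (ExZ _ Ig2) (ExZ _ Io).
  rewrite -[Ex G (fun x0 => g x0 ^+ 2)]/v -[Ex G (fun x => Ex G _)]/H.
  by field; rewrite gt_eqF.
have nn : n%:R * (n%:R - 1) <= n%:R ^+ 2 :> R by rewrite expr2 ler_wpM2l// gerBl.
have r0 : 0 <= (e * v ^+ 2 + H / e) / 2.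
  by rewrite divr_ge0// addr_ge0 ?divr_ge0 ?mulr_ge0 ?sqr_ge0// ltW.
apply: lerD; [apply: lerD|].
- by rewrite mulr0 addr0 ler_wpM2l ?sqr_ge0// ler_wpM2l.
- rewrite -mulrA ler_wpM2l ?exprn_ge0// ler_wpM2l ?sqr_ge0// lerD2l.
  by rewrite ler_wpM2l ?sqr_ge0// ler_wpM2r.
- by rewrite ler_wpM2l ?exprn_ge0// lerD2l ler_wpM2l ?exprn_ge0// ler_wpM2r.
Qed.

End alternative.

End second_moments.

(** * Signal against noise *)

Section ratios.
Context (R : rcfType) (C c q Q m sn e r : R).
Hypotheses (C0 : 0 < C) (c0 : 0 < c) (q0 : 0 < q) (Q0 : 0 < Q) (qQ : q ^+ 2 <= Q).
Hypotheses (sn1 : 1 <= sn) (snm : sn <= m) (e0 : 0 < e) (r0 : 0 < r).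
Hypothesis rE : r ^+ 2 = Q * e ^+ 2 / (m * sn * q ^+ 2).

(** A lower bound on half the mean of the count under the alternative, where n and
    d are written as squares of sn and e so that all ratios are rational. *)
Let signal := m ^+ 2 * q ^+ 2 * sn ^+ 2 * c / (8 * e ^+ 2).
Let const := 128 * (1 + C) ^+ 2 / c ^+ 2.
Let rate := (sn ^+ 2)^-1 + r ^+ 2 + r + r ^+ 4.

Let sn0 : 0 < sn. Proof. exact: lt_le_trans ltr01 sn1. Qed.
Let m0 : 0 < m. Proof. exact: lt_le_trans sn0 snm. Qed.

Let signal_gt0 : 0 < signal.
Proof. by rewrite divr_gt0// !mulr_gt0 ?exprn_gt0. Qed.

Let QE : Q = r ^+ 2 * (m * sn * q ^+ 2) / e ^+ 2.
Proof. by rewrite rE; field; rewrite !gt_eqF. Qed.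

(** As q^2 <= Q and sn <= m, the equation for r gives e^2 <= m^2 r^2. *)
Let e_le : e <= m * r.
Proof.
have mr0 : 0 <= m * r by rewrite mulr_ge0// ltW.
rewrite -ler_sqr ?nnegrE ?(ltW e0)// exprMn rE.
have -> : m ^+ 2 * (Q * e ^+ 2 / (m * sn * q ^+ 2)) = e ^+ 2 * ((m / sn) * (Q / q ^+ 2)).
  by field; rewrite !gt_eqF.
rewrite -[leLHS]mulr1 ler_wpM2l ?sqr_ge0//.
rewrite -[leLHS]mulr1 ler_pM// ler_pdivlMr ?mul1r ?exprn_gt0//.
Qed.

Lemma signal_le (N v : R) : m ^+ 2 / 4 <= N -> c / e ^+ 2 <= v ->
  signal <= N * (q ^+ 2 * (sn ^+ 2 * v)) / 2.
Proof.
move=> hN hv.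
have -> : signal = (m ^+ 2 / 4) * (q ^+ 2 * (sn ^+ 2 * (c / e ^+ 2))) / 2.
  by rewrite /signal; field; rewrite gt_eqF.
rewrite ler_pM2r ?invr_gt0// ler_pM//.
- by rewrite divr_ge0// sqr_ge0.
- by rewrite !mulr_ge0 ?invr_ge0 ?sqr_ge0// ltW.
by rewrite !ler_wpM2l ?sqr_ge0.
Qed.

Lemma noise_null_le : m ^+ 2 * (sn ^+ 2 * Q ^+ 2) <= signal ^+ 2 * (const * rate / 2).
Proof.
have -> : m ^+ 2 * (sn ^+ 2 * Q ^+ 2) = signal ^+ 2 * (64 / c ^+ 2 * r ^+ 4).
  by rewrite QE /signal; field; rewrite !gt_eqF.
rewrite ler_wpM2l ?sqr_ge0//.
have -> : const * rate / 2 = (c ^+ 2)^-1 * (64 * (1 + C) ^+ 2 * rate).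
  by rewrite /const; field; rewrite gt_eqF.
have -> : 64 / c ^+ 2 * r ^+ 4 = (c ^+ 2)^-1 * (64 * r ^+ 4) by ring.
rewrite ler_wpM2l ?invr_ge0 ?sqr_ge0// -mulrA ler_wpM2l//.
have rr : r ^+ 4 <= rate.
  by rewrite lerDr !addr_ge0 ?invr_ge0 ?exprn_ge0// ltW.
apply: (le_trans rr); rewrite -[leLHS]mul1r ler_wpM2r//.
  exact: le_trans (exprn_ge0 _ (ltW r0)) rr.
have := C0; nra.
Qed.

(** Divided by signal^2, the five terms of the second moment are constant multiples
    of 1/n, r^2 / sqrt n, e / m, r^4 and (e / m)^2, and e / m <= r. *)
Lemma noise_alt_le (N v g4 H : R) : 0 <= N -> N <= m ^+ 2 / 2 -> 0 <= v ->
  v <= C / e ^+ 2 -> g4 <= C / e ^+ 4 -> 0 <= H -> H <= C / e ^+ 2 ->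
  (N * q ^+ 2) ^+ 2 * (sn ^+ 2 * g4) +
  m ^+ 3 * (q ^+ 2 * (Q * (sn ^+ 2 * v) +
   q ^+ 2 * ((sn ^+ 2) ^+ 2 * ((e * v ^+ 2 + H / e) / 2)))) +
  m ^+ 2 * (sn ^+ 2 * Q ^+ 2 + q ^+ 4 * ((sn ^+ 2) ^+ 2 * H)) <=
  signal ^+ 2 * (const * rate).
Proof.
move=> N0 Nm v0 vC g4C H0 HC.
have s2 := sqr_ge0 (R := R).
apply: (@le_trans _ _ ((m ^+ 2 / 2 * q ^+ 2) ^+ 2 * (sn ^+ 2 * (C / e ^+ 4)) +
  m ^+ 3 * (q ^+ 2 * (Q * (sn ^+ 2 * (C / e ^+ 2)) +
   q ^+ 2 * ((sn ^+ 2) ^+ 2 * ((e * (C / e ^+ 2) ^+ 2 + C / e ^+ 2 / e) / 2)))) +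
  m ^+ 2 * (sn ^+ 2 * Q ^+ 2 + q ^+ 4 * ((sn ^+ 2) ^+ 2 * (C / e ^+ 2))))).
  apply: lerD; [apply: lerD|].
  - apply: (@le_trans _ _ ((N * q ^+ 2) ^+ 2 * (sn ^+ 2 * (C / e ^+ 4)))).
      by rewrite !ler_wpM2l.
    apply: ler_wpM2r; first by rewrite mulr_ge0// divr_ge0 ?exprn_ge0// ltW.
    rewrite ler_sqr ?nnegrE ?(mulr_ge0 _ (s2 q)) ?divr_ge0//.
    by rewrite ler_wpM2r.
  - apply: ler_wpM2l; first by rewrite exprn_ge0// ltW.
    apply: ler_wpM2l => //; apply: lerD; first by rewrite !ler_wpM2l// ltW.
    apply: ler_wpM2l => //; apply: ler_wpM2l => //; rewrite ler_pM2r ?invr_gt0//; apply: lerD.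
      by rewrite ler_wpM2l ?(ltW e0)// ler_sqr ?nnegrE// (le_trans v0).
    by rewrite ler_pM2r ?invr_gt0.
  - by rewrite !ler_wpM2l// lerD2l !ler_wpM2l ?exprn_ge0// ltW.
have -> : (m ^+ 2 / 2 * q ^+ 2) ^+ 2 * (sn ^+ 2 * (C / e ^+ 4)) +
  m ^+ 3 * (q ^+ 2 * (Q * (sn ^+ 2 * (C / e ^+ 2)) +
   q ^+ 2 * ((sn ^+ 2) ^+ 2 * ((e * (C / e ^+ 2) ^+ 2 + C / e ^+ 2 / e) / 2)))) +
  m ^+ 2 * (sn ^+ 2 * Q ^+ 2 + q ^+ 4 * ((sn ^+ 2) ^+ 2 * (C / e ^+ 2))) =
  signal ^+ 2 * ((c ^+ 2)^-1 * (16 * C * (sn ^+ 2)^-1 + 64 * C * (r ^+ 2 / sn) +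
    32 * (C ^+ 2 + C) * (e / m) + 64 * r ^+ 4 + 64 * C * (e / m) ^+ 2)).
  by rewrite QE /signal; field; rewrite !gt_eqF.
rewrite ler_wpM2l//.
have -> : const * rate = (c ^+ 2)^-1 * (128 * (1 + C) ^+ 2 * rate).
  by rewrite /const; ring.
rewrite ler_wpM2l ?invr_ge0//.
have em : e / m <= r by rewrite ler_pdivrMr// mulrC.
have em0 : 0 <= e / m by rewrite divr_ge0// ltW.
have em2 : (e / m) ^+ 2 <= r ^+ 2 by rewrite ler_sqr ?nnegrE// ltW.
have rs : r ^+ 2 / sn <= r ^+ 2 by rewrite ler_pdivrMr// ler_peMr.
have i0 : 0 <= (sn ^+ 2)^-1 by rewrite invr_ge0.
have r40 : 0 <= r ^+ 4 by rewrite exprn_ge0// ltW.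
have r20 := s2 r.
rewrite /rate.
have c00 := C0; have r00 := ltW r0.
move: (r ^+ 2 / sn) (e / m) ((e / m) ^+ 2) (sn ^+ 2)^-1 (r ^+ 4) (r ^+ 2) em em0 em2 rs i0 r40 r20.
move=> a b b2 i r4 r2 *.
apply: (@le_trans _ _ (16 * C * i + 64 * C * r2 +
    32 * (C ^+ 2 + C) * r + 64 * r4 + 64 * C * r2)).
  apply: lerD; last by rewrite ler_wpM2l ?mulr_ge0// ltW.
  apply: lerD => //; apply: lerD.
    apply: lerD => //; by rewrite ler_wpM2l ?mulr_ge0// ltW.
  by rewrite ler_wpM2l// mulr_ge0// addr_ge0// ?sqr_ge0// ltW.
have -> : 128 * (1 + C) ^+ 2 * (i + r2 + r + r4) =
  128 * (1 + C) ^+ 2 * i + 128 * (1 + C) ^+ 2 * r2 + 128 * (1 + C) ^+ 2 * r + 128 * (1 + C) ^+ 2 * r4 by ring.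
have h1 : 16 * C <= 128 * (1 + C) ^+ 2 by nra.
have h2 : 128 * C <= 128 * (1 + C) ^+ 2 by nra.
have h3 : 32 * (C ^+ 2 + C) <= 128 * (1 + C) ^+ 2 by nra.
have h4 : 64 <= 128 * (1 + C) ^+ 2 by nra.
have k1 : 16 * C * i <= 128 * (1 + C) ^+ 2 * i by rewrite ler_wpM2r.
have k2 : 128 * C * r2 <= 128 * (1 + C) ^+ 2 * r2 by rewrite ler_wpM2r.
have k3 : 32 * (C ^+ 2 + C) * r <= 128 * (1 + C) ^+ 2 * r by rewrite ler_wpM2r.
have k4 : 64 * r4 <= 128 * (1 + C) ^+ 2 * r4 by rewrite ler_wpM2r.
lra.
Qed.

End ratios.

(** * Detection by the wedge count *)

Section detection.
Context (R : realType) (p : R).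
Hypotheses (p0 : 0 < p) (p1 : p < 1) (pn : p != 2^-1).

(** The reciprocal of the ratio that tends to infinity. *)
Definition loss n m d (q Q : R) : R := Q * d%:R / (m%:R * Num.sqrt n%:R * q ^+ 2).

(** Chebyshev's inequality at the threshold t halfway between the means of the
    count, 0 under the null law and 2 t under the alternative. *)
Lemma error_bound : exists (K : R) (d1 : nat), forall (q Q : R) (F : bool -> bool -> R),
  0 < q -> q <= 1 -> q ^+ 2 <= Q ->
  (forall b : bool, avg (noise_law q p) (fun z => noisy_entry F z b) = q * (b%:R - p)) ->
  (forall b : bool, avg (noise_law q p) (fun z => noisy_entry F z b ^+ 2) <= Q) ->
  forall n m d, (1 < n)%N -> (n <= m)%N -> (0 < d)%N -> (d1 <= d)%N ->
  exists t : R, let r := Num.sqrt (loss n m d q Q) in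
   prob (@null_law R p q n m) (fun x => t <= wedge_stat F x.1 x.2) +
   prob (@alt_law R p q n m d) (fun x => wedge_stat F x.1 x.2 < t) <=
   K * (n%:R^-1 + r ^+ 2 + r + r ^+ 4).
Proof.
have [C [c [d1 [C0 c0 est]]]] := row_estimates p0 p1 pn.
exists (128 * (1 + C) ^+ 2 / c ^+ 2 * 2), d1.
move=> q Q F q0 q1 qQ F_mean F_sqr n m d n2 nm d0 dd1.
have [] := est d d0 dd1.
have Q0 : 0 < Q := lt_le_trans (exprn_gt0 2 q0) qQ.
have N2 := null_second_moment p0 p1 (ltW q0) q1 (ltW Q0) F_mean F_sqr n m.
have A2 := alt_second_moment p0 p1 (ltW q0) q1 (ltW Q0) F_mean F_sqr n m d0.
have H0 : 0 <= Ex (gauss R d) (fun x : d.-tuple (measurableTypeR R) =>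
    Ex (gauss R d) (fun x' => hcov p x x' ^+ 2)).
  by apply: Ex_ge0 => x; apply: Ex_ge0 => y; exact: sqr_ge0.
have v0 : 0 <= Ex (gauss R d) (fun x : d.-tuple (measurableTypeR R) => gdev p x ^+ 2).
  by apply: Ex_ge0 => x; exact: sqr_ge0.
move: A2 H0 v0; move: (Ex _ _) (Ex _ _) (Ex _ _) => v g4 H A2 H0 v0 g4C vC vc HC.
set N := m%:R * (m%:R - 1) / 2 in A2.
set s := N * _ in A2.
set r := Num.sqrt (loss n m d q Q).
pose sn : R := Num.sqrt n%:R; pose e : R := Num.sqrt d%:R.
have snE : sn ^+ 2 = n%:R by rewrite sqr_sqrtr.
have eE : e ^+ 2 = d%:R by rewrite sqr_sqrtr.
have e4E : e ^+ 4 = d%:R ^+ 2 by rewrite -eE -exprM.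
have e0 : 0 < e by rewrite sqrtr_gt0 ltr0n.
have sn1 : 1 <= sn by rewrite -sqrtr1 ler_sqrt// ler1n ltnW.
have sn0 : 0 < sn := lt_le_trans ltr01 sn1.
have snm : sn <= m%:R.
  apply: (@le_trans _ _ n%:R); last by rewrite ler_nat.
  by rewrite -snE expr2 ler_peMl// ltW.
have m0 : 0 < m%:R :> R := lt_le_trans sn0 snm.
have m2 : 2 <= m%:R :> R by rewrite ler_nat (leq_trans n2).
have rE : r ^+ 2 = Q * e ^+ 2 / (m%:R * sn * q ^+ 2).
  by rewrite sqr_sqrtr /loss ?eE// divr_ge0 ?mulr_ge0 ?sqr_ge0// ltW.
have r0 : 0 < r.
  by rewrite sqrtr_gt0 divr_gt0// !mulr_gt0 ?exprn_gt0// ltr0n.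
have N0 : 0 <= N by rewrite /N; nra.
have N4 : m%:R ^+ 2 / 4 <= N by rewrite /N; nra.
have Nm : N <= m%:R ^+ 2 / 2 by rewrite /N; nra.
rewrite -eE in vC vc HC; rewrite -e4E in g4C; rewrite -snE in N2 A2.
have sig := signal_le c0 q0 sn1 e0 N4 vc.
have noise0 := noise_null_le C0 c0 q0 sn1 snm e0 r0 rE.
have noise1 := noise_alt_le C0 c0 q0 Q0 qQ sn1 snm e0 r0 rE N0 Nm v0 vC g4C H0 HC.
rewrite snE in sig noise0 noise1 N2 A2.
set Y := (X in X <= _) in sig; rewrite -/Y in noise0 noise1.
set rate := _ + r ^+ 4 in noise0 noise1 *.
set K := 128 * _ / _ in noise0 noise1 *.
have nR : 0 < n%:R :> R by rewrite ltr0n ltnW.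
have dR : 0 < e ^+ 2 by rewrite exprn_gt0.
have Y0 : 0 < Y by rewrite divr_gt0// !mulr_gt0// exprn_gt0.
rewrite -/s in sig.
have t0 : 0 < s / 2 := lt_le_trans Y0 sig.
have sY : Y ^+ 2 <= (s / 2) ^+ 2 by rewrite ler_sqr ?nnegrE ?(ltW t0) ?(ltW Y0).
have K0 : 0 <= K by apply: divr_ge0; [apply: mulr_ge0 => //; exact: sqr_ge0 | exact: sqr_ge0].
have rate0 : 0 <= rate.
  by rewrite /rate; do ?apply: addr_ge0; rewrite ?invr_ge0 ?exprn_ge0 ?(ltW r0) ?(ltW nR).
exists (s / 2) => /=.
have -> : K * 2 * rate = K * rate + K * rate by ring.
apply: lerD.
  have mu0 := @null_law_ge0 R p q p0 p1 (ltW q0) q1 n m.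
  have B : prob (@null_law R p q n m) (fun x => s / 2 <= wedge_stat F x.1 x.2) <=
      avg (@null_law R p q n m) (fun x => wedge_stat F x.1 x.2 ^+ 2) / (s / 2) ^+ 2.
    apply: (prob_sqr_le mu0 t0) => [x xs|x]; last exact: sqr_ge0.
    by rewrite ler_sqr ?nnegrE ?(ltW t0)// (le_trans (ltW t0)).
  apply: (le_trans B).
  rewrite ler_pdivrMr ?exprn_gt0//; apply: (le_trans N2); apply: (le_trans noise0).
  have KR : 0 <= K * rate := mulr_ge0 K0 rate0.
  rewrite mulrC ler_pM ?sqr_ge0// ?divr_ge0//.
  by rewrite ler_pdivrMr// ler_peMr// ler1n.
have mu1 := @alt_law_ge0 R p q p0 p1 (ltW q0) q1 n m d.
have B : prob (@alt_law R p q n m d) (fun x => wedge_stat F x.1 x.2 < s / 2) <=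
    avg (@alt_law R p q n m d) (fun x => (wedge_stat F x.1 x.2 - s) ^+ 2) / (s / 2) ^+ 2.
  apply: (prob_sqr_le mu1 t0) => [x xs|x]; last exact: sqr_ge0.
  have h : s / 2 <= s - wedge_stat F x.1 x.2.
    rewrite lerBrDr -lerBrDl; apply: le_trans (ltW xs) _.
    by rewrite {2}(splitr s) addrK.
  by rewrite -[leRHS]sqrrN opprB ler_sqr ?nnegrE ?(ltW t0)// (le_trans (ltW t0)).
apply: (le_trans B).
rewrite ler_pdivrMr ?exprn_gt0//; apply: (le_trans A2); apply: (le_trans noise1).
by rewrite mulrC; apply: ler_wpM2l (mulr_ge0 K0 rate0) _ _ sY.
Qed.

Lemma loss_cvg0 (m d : nat -> nat) (q Q : nat -> R) :
  (forall n, (0 < n)%N -> (n <= m n)%N) -> (forall n, (0 < n)%N -> (0 < d n)%N) ->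
  (forall n, (0 < n)%N -> 0 < q n) -> (forall n, (0 < n)%N -> 0 < Q n) ->
  gg (fun n => (m n)%:R * Num.sqrt n%:R * (q n ^+ 2 / Q n)) (fun n => (d n)%:R) ->
  (fun n => loss n (m n) (d n) (q n) (Q n)) @ \oo --> 0.
Proof.
move=> mn d0 q0 Q0 gap.
have E : {near \oo, (fun n => ((m n)%:R * Num.sqrt n%:R * (q n ^+ 2 / Q n) / (d n)%:R)^-1) =1
    (fun n => loss n (m n) (d n) (q n) (Q n))}.
  near=> n; have n0 : (0 < n)%N by near: n; exact: nbhs_infty_ge.
  have m0 : (0 < m n)%N by exact: leq_trans (mn n n0).
  by rewrite /loss; field; rewrite !pnatr_eq0 -!lt0n m0 d0// sqrtr_eq0 -ltNge ltr0n n0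
    !gt_eqF ?q0 ?Q0.
apply: cvg_trans (near_eq_cvg E) _; apply/gtr0_cvgV0 => //.
near=> n; have n0 : (0 < n)%N by near: n; exact: nbhs_infty_ge.
by rewrite !(mulr_gt0, invr_gt0, exprn_gt0, q0, Q0)// ?ltr0n ?sqrtr_gt0 ?ltr0n ?d0 ?(leq_trans n0 (mn n n0)).
Unshelve. all: by end_near. Qed.

(** For n >= 2 the logarithm is bounded below. *)
Lemma gg_ln_eventually_ge (d : nat -> nat) :
  gg (fun n => (d n)%:R : R) (fun n => ln (n%:R : R) ^+ 3) ->
  forall d1 : nat, \forall n \near \oo, (d1 <= d n)%N.
Proof.
move=> gap d1.
have l2 : 0 < ln 2 :> R by rewrite ln_gt0// ltr1n.
move/cvgryPge : gap => /(_ (d1%:R / ln 2 ^+ 3)) gap.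
near=> n; have n2 : (2 <= n)%N by near: n; exact: nbhs_infty_ge.
have n0 : (0 < n)%N by exact: ltnW.
have ln2n : ln 2 <= ln n%:R :> R.
  by rewrite ler_ln ?posrE ?ltr0n// ler_nat.
have lnn : 0 < ln n%:R :> R := lt_le_trans l2 ln2n.
have : d1%:R / ln 2 ^+ 3 <= (d n)%:R / ln n%:R ^+ 3 :> R by near: n.
rewrite ler_pdivlMr ?exprn_gt0// => h.
rewrite -(ler_nat R); apply: le_trans h.
rewrite mulrAC ler_pdivlMr ?exprn_gt0// ler_wpM2l//.
by rewrite lerXn2r ?nnegrE ?(ltW l2) ?(ltW lnn).
Unshelve. all: by end_near. Qed.

(** For Q = 1 and weight b - p, and for Q = q and weight a (b - p), this is the
    detection by the count on the whole matrix and within the mask. *)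
Lemma detection (m d : nat -> nat) (q Q : nat -> R) (F : bool -> bool -> R) :
  (forall n, (0 < n)%N -> (n <= m n)%N) -> (forall n, (0 < n)%N -> (0 < d n)%N) ->
  (forall n, (0 < n)%N -> 0 < q n) -> (forall n, (0 < n)%N -> q n <= 1) ->
  (forall n, (0 < n)%N -> q n ^+ 2 <= Q n) ->
  (forall n (b : bool), avg (noise_law (q n) p) (fun z => noisy_entry F z b) =
    q n * (b%:R - p)) ->
  (forall n (b : bool), (0 < n)%N ->
    avg (noise_law (q n) p) (fun z => noisy_entry F z b ^+ 2) <= Q n) ->
  gg (fun n => (d n)%:R) (fun n => ln (n%:R : R) ^+ 3) ->
  gg (fun n => (m n)%:R * Num.sqrt n%:R * (q n ^+ 2 / Q n)) (fun n => (d n)%:R) ->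
  exists t : nat -> R, (fun n =>
    prob (@null_law R p (q n) n (m n)) (fun x => t n <= wedge_stat F x.1 x.2) +
    prob (@alt_law R p (q n) n (m n) (d n)) (fun x => wedge_stat F x.1 x.2 < t n))
   @ \oo --> (0 : R).
Proof.
move=> mn d0 q0 q1 qQ F_mean F_sqr dlarge gap.
have [K [d1 bound]] := error_bound.
pose r n := Num.sqrt (loss n (m n) (d n) (q n) (Q n)).
pose risk n t := prob (@null_law R p (q n) n (m n)) (fun x => t <= wedge_stat F x.1 x.2) +
    prob (@alt_law R p (q n) n (m n) (d n)) (fun x => wedge_stat F x.1 x.2 < t).
have tex n : exists t : R, (1 < n)%N -> (d1 <= d n)%N ->
    risk n t <= K * (n%:R^-1 + r n ^+ 2 + r n + r n ^+ 4).
  case: (boolP ((1 < n)%N && (d1 <= d n)%N)) => [/andP[n2 dn]|h].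
    have n0 : (0 < n)%N by exact: ltnW.
    have [t ht] := bound (q n) (Q n) F (q0 n n0) (q1 n n0) (qQ n n0) (F_mean n)
      (F_sqr n ^~ n0) n (m n) (d n) n2 (mn n n0) (d0 n n0) dn.
    by exists t.
  by exists 0 => n2 dn; rewrite n2 dn in h.
have [t ht] := choice tex.
exists t; rewrite -/(risk _ _).
have Q0 n : (0 < n)%N -> 0 < Q n.
  by move=> n0; apply: lt_le_trans (qQ n n0); rewrite exprn_gt0 ?q0.
have r_cvg : r @ \oo --> (0 : R).
  have := loss_cvg0 mn d0 q0 Q0 gap.
  by move=> /(continuous_cvg _ (@sqrt_continuous R 0)); rewrite sqrtr0.
have rX k : (fun n => r n ^+ k.+1) @ \oo --> (0 : R).
  elim: k => [|k IH]; first exact: r_cvg.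
  under eq_fun do rewrite exprS.
  by rewrite -(mulr0 (0 : R)); exact: (cvgM r_cvg IH).
have n_cvg : (fun n => n%:R^-1) @ \oo --> (0 : R).
  apply/gtr0_cvgV0.
    near=> n; rewrite ltr0n; near: n; exact: nbhs_infty_ge.
  exact: cvgr_idn.
apply: (@squeeze_cvgr _ _ _ _ (fun=> 0) (fun n => K * (n%:R^-1 + r n ^+ 2 + r n + r n ^+ 4))).
- near=> n; have n2 : (1 < n)%N by near: n; exact: nbhs_infty_ge.
  have n0 : (0 < n)%N by exact: ltnW.
  apply/andP; split; last first.
    by apply: ht => //; near: n; exact: (gg_ln_eventually_ge dlarge).
  by apply: addr_ge0; apply: sumr_ge0 => x _; [apply: null_law_ge0|apply: alt_law_ge0];
    rewrite ?(ltW (q0 n n0)) ?q1.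
- exact: cvg_cst.
rewrite -[X in _ --> X](mulr0 K) -[X in K * X](addr0 0) -{1}[0](addr0 0) -{1}[0](addr0 0).
apply: cvgM; first exact: cvg_cst.
by apply: cvgD; [apply: cvgD; [apply: cvgD|]|].
Unshelve. all: by end_near. Qed.

End detection.

(** * The two counts *)

Section two_statistics.
Context (R : realType) (p q : R).
Hypotheses (p0 : 0 < p) (p1 : p < 1) (q0 : 0 <= q) (q1 : q <= 1).

Definition signed (a b : bool) : R := b%:R - p.
Definition masked_signed (a b : bool) : R := a%:R * (b%:R - p).

Lemma avg_noise (f : bool * bool -> R) : avg (noise_law q p) f =
  q * (p * f (true, true) + (1 - p) * f (true, false)) +
  (1 - q) * (p * f (false, true) + (1 - p) * f (false, false)).
Proof. by rewrite avg_indep_law /avg !big_bool /bern1. Qed.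

Lemma sqr_signed_le1 (b : bool) : (b%:R - p) ^+ 2 <= 1.
Proof. by have h0 := p0; have h1 := p1; case: b => /=; nra. Qed.

Lemma signed_mean (b : bool) :
  avg (noise_law q p) (fun z => noisy_entry signed z b) = q * (b%:R - p).
Proof. by rewrite avg_noise /noisy_entry /signed /= ?mulr1n ?mulr0n; ring. Qed.

Lemma signed_sqr (b : bool) :
  avg (noise_law q p) (fun z => noisy_entry signed z b ^+ 2) <= 1.
Proof.
rewrite -[leRHS](avg_cst 1 (noise_law1 q p)); apply: ler_avg => z.
  by case: z => -[] []; rewrite /noise_law /= mulr_ge0 ?subr_ge0// ltW.
exact: sqr_signed_le1.
Qed.

Lemma masked_signed_mean (b : bool) :
  avg (noise_law q p) (fun z => noisy_entry masked_signed z b) = q * (b%:R - p).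
Proof. by rewrite avg_noise /noisy_entry /masked_signed /= ?mulr1n ?mulr0n; ring. Qed.

Lemma masked_signed_sqr (b : bool) :
  avg (noise_law q p) (fun z => noisy_entry masked_signed z b ^+ 2) <= q.
Proof.
have h := sqr_signed_le1 b.
rewrite avg_noise /noisy_entry /masked_signed /=.
rewrite mul1r !mul0r expr0n /= !mulr0 !addr0 mulr0 addr0 -mulrDl.
by rewrite addrC subrK mul1r -[leRHS]mulr1 ler_wpM2l.
Qed.

Variables (n m : nat).

Lemma wedge_stat_masked (Mk A : 'M[bool]_(n, m)) :
  wedge_stat masked_signed Mk A = mask_wedges p Mk A.
Proof.
apply: eq_bigr => i _; apply: eq_bigr => k _; rewrite [RHS]big_mkcondr; apply: eq_bigr => l _.
rewrite /masked_signed; case: (Mk i k) => /=; last by rewrite !mul0r.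
by case: (Mk i l); rewrite /= ?mul1r ?mul0r ?mulr0.
Qed.

Lemma prob_null (E : pred 'M[bool]_(n, m)) :
  prob (@null_law R p q n m) (fun x => E x.2) = prob (@bern_law R n m p) E.
Proof.
rewrite /prob /null_law /indep_law -(pair_big xpredT E (fun Mk A => bern_law q Mk * bern_law p A)) /=.
by under eq_bigr do rewrite -mulr_sumr; rewrite -mulr_suml bern_law1 mul1r.
Qed.

Lemma prob_alt d (E : pred 'M[bool]_(n, m)) :
  prob (@alt_law R p q n m d) (fun x => E x.2) = prob (@mixed_law R n m q p d) E.
Proof.
rewrite /prob /alt_law /joint_law /mixed_law /mixture exchange_big /=.
by rewrite (pair_big xpredT E (fun Mk A => bern_law q Mk * masked_law p d Mk A)).
Qed.

End two_statistics.

Theorem theorem8p2 (R : realType) (p : R) (m d : nat -> nat) (q : nat -> R)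
  (p_gt0 : 0 < p) (p_lt1 : p < 1) (p_neq : p != 2^-1)
  (m_ge : forall n, (0 < n)%N -> (n <= m n)%N)
  (d_gt0 : forall n, (0 < n)%N -> (0 < d n)%N)
  (q_gt0 : forall n, (0 < n)%N -> 0 < q n)
  (q_le1 : forall n, (0 < n)%N -> q n <= 1) :
  (gg (fun n => (d n)%:R) (fun n => ln (n%:R : R) ^+ 3) ->
   gg (fun n => (m n)%:R * Num.sqrt n%:R * q n ^+ 2) (fun n => (d n)%:R) ->
   exists t : nat -> R,
     (fun n =>
        prob (@bern_law R n (m n) p) (fun A => t n <= wedges p A) +
        prob (@mixed_law R n (m n) (q n) p (d n)) (fun A => wedges p A < t n))
     @ \oo --> (0 : R))
  /\
  (gg (fun n => (d n)%:R) (fun n => ln (n%:R : R) ^+ 3) ->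
   gg (fun n => (m n)%:R * Num.sqrt n%:R * q n) (fun n => (d n)%:R) ->
   exists t : nat -> R,
     (fun n =>
        prob (indep_law (@bern_law R n (m n) (q n)) (@bern_law R n (m n) p))
          (fun MA => t n <= mask_wedges p MA.1 MA.2) +
        prob (joint_law (@bern_law R n (m n) (q n)) (masked_law p (d n)))
          (fun MA => mask_wedges p MA.1 MA.2 < t n))
     @ \oo --> (0 : R)).
Proof.
split => dlarge gap.
- have [] := @detection R p p_gt0 p_lt1 p_neq m d q (fun=> 1) (signed p) m_ge d_gt0 q_gt0 q_le1.
  + move=> n n0; rewrite exprn_ile1 ?q_le1//; exact: ltW (q_gt0 n n0).
  + by move=> n b; exact: signed_mean.
  + move=> n b n0; apply: signed_sqr; rewrite ?q_le1//; exact: ltW (q_gt0 n n0).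
  + exact: dlarge.
  + by under eq_fun do rewrite divr1.
  move=> t conv; exists t; apply: cvg_trans conv; apply: near_eq_cvg; near=> n.
  congr (_ + _).
    exact: (prob_null p (q n) (fun A => t n <= wedges p A)).
  exact: (prob_alt p (q n) (d n) (fun A => wedges p A < t n)).
- have [] := @detection R p p_gt0 p_lt1 p_neq m d q q (masked_signed p) m_ge d_gt0 q_gt0 q_le1.
  + by move=> n n0; rewrite expr2 ler_piMr ?q_le1// ltW// q_gt0.
  + by move=> n b; exact: masked_signed_mean.
  + by move=> n b n0; apply: masked_signed_sqr => //; exact: ltW (q_gt0 n n0).
  + exact: dlarge.
  + apply: cvg_trans gap; apply: near_eq_cvg; near=> n.
    have n0 : (0 < n)%N by near: n; exact: nbhs_infty_ge.
    by congr (_ * _ / _); field; rewrite gt_eqF ?q_gt0.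
  move=> t conv; exists t; apply: cvg_trans conv; apply: near_eq_cvg; near=> n.
  by congr (_ + _); apply: eq_bigl => x; rewrite /= wedge_stat_masked.
Unshelve. all: by end_near. Qed.
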